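(* Every $6$-dimensional real Drinfeld double belongs to exactly one of the following $22$ classes. It allows decomposition into all Manin triples listed in its class (for the corresponding value of the parameters $a$, $b$, where present) and into their duals, obtained by interchanging $\mathcal G\leftrightarrow\tilde{\mathcal G}$. In particular, Manin triples joined by $\cong$ below, with the same values of the parameters, define isomorphic Drinfeld doubles, and Drinfeld doubles from different classes are non-isomorphic. If a class contains a parameter $a$ or $b$ (or both), then the Drinfeld doubles with different values of the parameter(s), within the range indicated, are non-isomorphic. 1. $(9|5|b)\cong(8|5.ii|b)\cong(7_0|5.ii|b)$, $b>0$; 2. $(8|5.i|b)\cong(6_0|5.iii|b)$, $b>0$; 3. $(7_a|7_{1/a}|b)\cong(7_{1/a}|7_a|b)$, $a\ge 1$, $b\in\mathbb R\setminus\{0\}$; 4. $(6_a|6_{1/a}.i|b)\cong(6_{1/a}|6_a.i|b)$, $a>1$, $b\in\mathbb R\setminus\{0\}$; 5. $(9|1)$; 6. $(8|1)\cong(8|5.iii)\cong(7_0|5.i)\cong(6_0|5.i)\cong(5|2.ii)$; 7. $(7_0|4|b)\cong(4|2.iii|b)\cong(6_0|4.i|-b)$, $b\in\mathbb R\setminus\{0\}$; 8. $(3|3.i|b)$, $b\in\mathbb R\setminus\{0\}$; 9. $(7_a|1)\cong(7_a|2.i)\cong(7_a|2.ii)$, $a>1$; 10. $(6_a|1)\cong(6_a|2)\cong(6_a|6_{1/a}.ii)\cong(6_a|6_{1/a}.iii)$, $a>1$; 11. $(6_0|1)\cong(6_0|5.ii)\cong(5|1)\cong(5|2.i)$; 12.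 $(6_0|2)\cong(6_0|4.ii)\cong(4|1)\cong(4|2.i)\cong(4|2.ii)$; 13. $(3|1)\cong(3|2)\cong(3|3.ii)\cong(3|3.iii)$; 14. $(7_a|1)\cong(7_a|2.i)\cong(7_a|2.ii)$, $0<a<1$; 15. $(7_0|1)$; 16. $(7_0|2.i)$; 17. $(7_0|2.ii)$; 18. $(7_1|1)\cong(7_1|2.i)\cong(7_1|2.ii)$; 19. $(2|1)$; 20. $(2|2.i)$; 21. $(2|2.ii)$; 22. $(1|1)$.
   Context: **Drinfeld doubles and Manin triples.** A Drinfeld double is a connected Lie group whose real Lie algebra $\mathcal D$, equipped with a symmetric ad-invariant nondegenerate bilinear form $\langle\cdot,\cdot\rangle$, admits a decomposition $\mathcal D=\mathcal G\oplus\tilde{\mathcal G}$ (direct sum of vector spaces) into two Lie subalgebras $\mathcal G,\tilde{\mathcal G}$, both maximally isotropic with respect to $\langle\cdot,\cdot\rangle$. Such an ordered triple $(\mathcal D,\mathcal G,\tilde{\mathcal G})$ is called a Manin triple, and it is called a decomposition of the double. Only the algebraic structure is considered: a Drinfeld double is identified with the pair $(\mathcal D,\langle\cdot,\cdot\rangle)$. Two Drinfeld doubles $(\mathcal D,\langle\cdot,\cdot\rangle)$, $(\mathcal D',\langle\cdot,\cdot\rangle')$ are isomorphic if there is a Lie algebra isomorphism $\mathcal D\to\mathcal D'$ carrying $\langle\cdot,\cdot\rangle$ to $\langle\cdot,\cdot\rangle'$. Here $\dim\mathcal D=6$ and $\dim\mathcal G=\dim\tilde{\mathcal G}=3$. **Structure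 constants.** Given a Manin triple one can choose bases $X_1,X_2,X_3$ of $\mathcal G$ and $\tilde X^1,\tilde X^2,\tilde X^3$ of $\tilde{\mathcal G}$ with $\langle X_i,X_j\rangle=0=\langle\tilde X^i,\tilde X^j\rangle$ and $\langle X_i,\tilde X^j\rangle=\delta_i^j$. If $[X_i,X_j]=f_{ij}{}^kX_k$ and $[\tilde X^i,\tilde X^j]=\tilde f^{ij}{}_k\tilde X^k$, ad-invariance forces $[X_i,\tilde X^j]=f_{ki}{}^j\tilde X^k+\tilde f^{jk}{}_iX_k$. So a Manin triple is completely specified by the brackets of $\mathcal G$ and of $\tilde{\mathcal G}$ in such mutually dual bases. A Drinfeld double allows decomposition into a given Manin triple if it has a Manin triple decomposition with mutually dual bases having the given brackets (equivalently, it is isomorphic to the Drinfeld double defined by those brackets). The symbol $\cong$ between Manin triples means that the Drinfeld doubles they define are isomorphic. The dual of $(\mathcal D,\mathcal G,\tilde{\mathcal G})$ is $(\mathcal D,\tilde{\mathcal G},\mathcal G)$. **Notation for Manin triples.** A symbol such as $(k|l.j|b)$ (with $j$ a roman numeral, $b$ a real parameter; either may be absent) denotes a Manin triple in which $\mathcal G$ has the brackets of the Bianchi algebra $k$ below, and $\tilde{\mathcal G}$ has the brackets listed further below. Triples of numbers after a symbol are always the brackets in the order $([\cdot_1,\cdot_2],[\cdot_2,\cdot_3],[\cdot_3,\cdot_1])$. Bianchi algebras, $([X_1,X_2],\ [X_2,X_3],\ [X_3,X_1])$: - $9$: $(X_3,\ X_1,\ X_2)$ - $8$: $(-X_3,\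 X_1,\ X_2)$ - $7_a$ ($a>0$): $(-aX_2+X_3,\ 0,\ X_2+aX_3)$ - $7_0$: $(0,\ X_1,\ X_2)$ - $6_a$ ($a>0$, $a\ne1$): $(-aX_2-X_3,\ 0,\ X_2+aX_3)$ - $6_0$: $(0,\ X_1,\ -X_2)$ - $5$: $(-X_2,\ 0,\ X_3)$ - $4$: $(-X_2+X_3,\ 0,\ X_3)$ - $3$: $(-X_2-X_3,\ 0,\ X_2+X_3)$ - $2$: $(0,\ X_1,\ 0)$ - $1$: $(0,0,0)$ Brackets of $\tilde{\mathcal G}$, $([\tilde X^1,\tilde X^2],\ [\tilde X^2,\tilde X^3],\ [\tilde X^3,\tilde X^1])$ (with $\mathcal G$ as in the list above): - $(k|1)$ for every $k$: $(0,0,0)$ - $(9|5|b)$: $(-b\tilde X^2,\ 0,\ b\tilde X^3)$ - $(8|5.i|b)$: $(-b\tilde X^2,\ 0,\ b\tilde X^3)$ - $(8|5.ii|b)$: $(0,\ b\tilde X^2,\ -b\tilde X^1)$ - $(8|5.iii)$: $(\tilde X^2,\ \tilde X^2,\ -(\tilde X^1+\tilde X^3))$ - $(7_a|2.i)$: $(0,\ \tilde X^1,\ 0)$ - $(7_a|2.ii)$: $(0,\ -\tilde X^1,\ 0)$ - $(7_a|7_{1/a}|b)$: $(b(-\tfrac1a\tilde X^2+\tilde X^3),\ 0,\ b(\tilde X^2+\tfrac1a\tilde X^3))$ - $(7_0|2.i)$: $(\tilde X^3,\ 0,\ 0)$ - $(7_0|2.ii)$: $(-\tilde X^3,\ 0,\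 0)$ - $(7_0|4|b)$: $(b(-\tilde X^2+\tilde X^3),\ 0,\ b\tilde X^3)$ - $(7_0|5.i)$: $(-\tilde X^2,\ 0,\ \tilde X^3)$ - $(7_0|5.ii|b)$: $(0,\ b\tilde X^2,\ -b\tilde X^1)$ - $(6_a|2)$: $(0,\ \tilde X^1,\ 0)$ - $(6_a|6_{1/a}.i|b)$: $(-b(\tfrac1a\tilde X^2+\tilde X^3),\ 0,\ b(\tilde X^2+\tfrac1a\tilde X^3))$ - $(6_a|6_{1/a}.ii)$: $(\tilde X^1,\ \tfrac{a+1}{a-1}(\tilde X^2+\tilde X^3),\ \tilde X^1)$ - $(6_a|6_{1/a}.iii)$: $(\tilde X^1,\ \tfrac{a-1}{a+1}(-\tilde X^2+\tilde X^3),\ -\tilde X^1)$ - $(6_0|2)$: $(\tilde X^3,\ 0,\ 0)$ - $(6_0|4.i|b)$: $(b(-\tilde X^2+\tilde X^3),\ 0,\ b\tilde X^3)$ - $(6_0|4.ii)$: $(-\tilde X^1+\tilde X^2+\tilde X^3,\ \tilde X^3,\ -\tilde X^3)$ - $(6_0|5.i)$: $(-\tilde X^2,\ 0,\ \tilde X^3)$ - $(6_0|5.ii)$: $(-\tilde X^1+\tilde X^2,\ \tilde X^3,\ -\tilde X^3)$ - $(6_0|5.iii|b)$: $(0,\ -b\tilde X^2,\ b\tilde X^1)$ - $(5|2.i)$: $(0,\ \tilde X^1,\ 0)$ - $(5|2.ii)$: $(\tilde X^3,\ 0,\ 0)$ - $(4|2.i)$: $(0,\ \tilde X^1,\ 0)$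 - $(4|2.ii)$: $(0,\ -\tilde X^1,\ 0)$ - $(4|2.iii|b)$: $(0,\ 0,\ b\tilde X^2)$ - $(3|2)$: $(0,\ \tilde X^1,\ 0)$ - $(3|3.i|b)$: $(-b(\tilde X^2+\tilde X^3),\ 0,\ b(\tilde X^2+\tilde X^3))$ - $(3|3.ii)$: $(0,\ \tilde X^2+\tilde X^3,\ 0)$ - $(3|3.iii)$: $(\tilde X^1,\ 0,\ -\tilde X^1)$ - $(2|2.i)$: $(\tilde X^3,\ 0,\ 0)$ - $(2|2.ii)$: $(-\tilde X^3,\ 0,\ 0)$ The symbols $(7_{1/a}|7_a|b)$ and $(6_{1/a}|6_a.i|b)$ are obtained from $(7_a|7_{1/a}|b)$ and $(6_a|6_{1/a}.i|b)$ by replacing $a$ with $1/a$ throughout. *)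

(* Defs.v *)
From HB Require Import structures.
From mathcomp Require Import all_boot all_order all_algebra.
From mathcomp Require Import reals.

Set Implicit Arguments.
Unset Strict Implicit.
Unset Printing Implicit Defensive.

Import Order.TTheory GRing.Theory Num.Theory.
Local Open Scope ring_scope.

(* Raw data (D, [.,.], <.,.>), without axioms: a Drinfeld double is identified
   with its real Lie algebra and bilinear form. *)
Record metric_algebra (R : realType) := MetricAlgebra {
  carrier :> vectType R;
  bracket : carrier -> carrier -> carrier;
  form : carrier -> carrier -> R
}.

Definition lie_bracket (R : realType) (D : metric_algebra R) : Prop :=
  [/\ forall x : D, linear (fun y : D => bracket x y),
      forall y : D, linear (fun x : D => bracket x y),
      forall x : D, bracket x x = 0
    & forall x y z : D,
        bracket x (bracket y z) + bracket y (bracket z x)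
          + bracket z (bracket x y) = 0].

Definition invariant_form (R : realType) (D : metric_algebra R) : Prop :=
  [/\ forall x : D, scalar (fun y : D => form x y),
      forall x y : D, form x y = form y x,
      forall x y z : D, form (bracket z x) y + form x (bracket z y) = 0
    & forall x : D, (forall y : D, form x y = 0) -> x = 0].

Definition subalgebra (R : realType) (D : metric_algebra R)
    (G : {vspace D}) : Prop :=
  {in G &, forall x y : D, bracket x y \in G}.

Definition isotropic (R : realType) (D : metric_algebra R)
    (G : {vspace D}) : Prop :=
  {in G &, forall x y : D, form x y = 0}.

Definition maximally_isotropic (R : realType) (D : metric_algebra R)
    (G : {vspace D}) : Prop :=
  isotropic G /\
  forall G' : {vspace D}, isotropic G' -> (G <= G')%VS -> G' = G.

(* In a Drinfeld double with \dim {:D} = 6 these conditions force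
   \dim G = \dim Gt = 3. *)
Definition manin_triple (R : realType) (D : metric_algebra R)
    (G Gt : {vspace D}) : Prop :=
  [/\ (G + Gt)%VS = fullv, (G :&: Gt)%VS = 0%VS,
      subalgebra G /\ subalgebra Gt
    & maximally_isotropic G /\ maximally_isotropic Gt].

Definition drinfeld_double (R : realType) (D : metric_algebra R) : Prop :=
  [/\ lie_bracket D, invariant_form D
    & exists G Gt : {vspace D}, manin_triple G Gt].

Definition drinfeld_double6 (R : realType) (D : metric_algebra R) : Prop :=
  drinfeld_double D /\ \dim {:D} = 6%N.

Definition isomorphic (R : realType) (D D' : metric_algebra R) : Prop :=
  exists f : {linear D -> D'},
    [/\ bijective f,
        forall x y : D, f (bracket x y) = bracket (f x) (f y)
      & forall x y : D, form (f x) (f y) = form x y].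

(* (c12, c23, c31): the coordinates of [X1,X2], [X2,X3], [X3,X1] in the basis
   X1, X2, X3. *)
Definition brackets3 (R : realType) : Type :=
  ('rV[R]_3 * 'rV[R]_3 * 'rV[R]_3)%type.

(* The brackets of G and of Gt in mutually dual bases. *)
Definition mtriple (R : realType) : Type :=
  (brackets3 R * brackets3 R)%type.

Definition dual_mtriple (R : realType) (T : mtriple R) : mtriple R :=
  (T.2, T.1).

Definition has_brackets (R : realType) (D : metric_algebra R)
    (X : 3.-tuple D) (c : brackets3 R) : Prop :=
  [/\ bracket X`_0 X`_1 = \sum_(k < 3) c.1.1 0 k *: X`_k,
      bracket X`_1 X`_2 = \sum_(k < 3) c.1.2 0 k *: X`_k
    & bracket X`_2 X`_0 = \sum_(k < 3) c.2 0 k *: X`_k].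

Definition allows_decomposition (R : realType) (D : metric_algebra R)
    (T : mtriple R) : Prop :=
  exists (G Gt : {vspace D}) (X Xt : 3.-tuple D),
    [/\ manin_triple G Gt,
        basis_of G X /\ basis_of Gt Xt,
        forall i j : 'I_3, form X`_i Xt`_j = (i == j)%:R
      & has_brackets X T.1 /\ has_brackets Xt T.2].

Definition bracket3 (R : realType) (c : brackets3 R)
    (x y : 'rV[R]_3) : 'rV[R]_3 :=
  (x 0 0 * y 0 1 - x 0 1 * y 0 0) *: c.1.1
  + (x 0 1 * y 0 2 - x 0 2 * y 0 1) *: c.1.2
  + (x 0 2 * y 0 0 - x 0 0 * y 0 2) *: c.2.

(* struct_const c i j k is f_{ij}^k (indices shifted to start at 0). *)
Definition struct_const (R : realType) (c : brackets3 R) (i j k : 'I_3) : R :=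
  bracket3 c (delta_mx 0 i) (delta_mx 0 j) 0 k.

(* [x, xi] for x in G and xi in Gt, extending bilinearly
   [X_i, Xt^j] = f_{ki}^j Xt^k + ft^{jk}_i X_k. *)
Definition mixed_bracket (R : realType) (T : mtriple R) (x xi : 'rV[R]_3) :
    'rV[R]_3 * 'rV[R]_3 :=
  \sum_(i < 3) \sum_(j < 3) (x 0 i * xi 0 j) *:
    (\row_(k < 3) struct_const T.2 j k i, \row_(k < 3) struct_const T.1 k i j).

(* The Drinfeld double defined by T: the pair (x, xi) stands for
   x_i X_i + xi_j Xt^j. *)
Definition double_of (R : realType) (T : mtriple R) : metric_algebra R :=
  @MetricAlgebra R ('rV[R]_3 * 'rV[R]_3)%type
    (fun u v => (bracket3 T.1 u.1 v.1, bracket3 T.2 u.2 v.2)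
                + mixed_bracket T u.1 v.2 - mixed_bracket T v.1 u.2)
    (fun u v => \sum_(i < 3) (u.1 0 i * v.2 0 i + u.2 0 i * v.1 0 i)).

Section Tables.
Variable R : realType.
Implicit Types a b : R.

Local Notation e1 := (delta_mx 0 0 : 'rV[R]_3).
Local Notation e2 := (delta_mx 0 1 : 'rV[R]_3).
Local Notation e3 := (delta_mx 0 2 : 'rV[R]_3).

Definition bianchi9 : brackets3 R := (e3, e1, e2).
Definition bianchi8 : brackets3 R := (- e3, e1, e2).
Definition bianchi7 a : brackets3 R := (- a *: e2 + e3, 0, e2 + a *: e3).
Definition bianchi70 : brackets3 R := (0, e1, e2).
Definition bianchi6 a : brackets3 R := (- a *: e2 - e3, 0, e2 + a *: e3).
Definition bianchi60 : brackets3 R := (0, e1, - e2).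
Definition bianchi5 : brackets3 R := (- e2, 0, e3).
Definition bianchi4 : brackets3 R := (- e2 + e3, 0, e3).
Definition bianchi3 : brackets3 R := (- e2 - e3, 0, e2 + e3).
Definition bianchi2 : brackets3 R := (0, e1, 0).
Definition bianchi1 : brackets3 R := (0, 0, 0).

Definition mt9_1 : mtriple R := (bianchi9, bianchi1).
Definition mt9_5 b : mtriple R := (bianchi9, (- b *: e2, 0, b *: e3)).

Definition mt8_1 : mtriple R := (bianchi8, bianchi1).
Definition mt8_5i b : mtriple R := (bianchi8, (- b *: e2, 0, b *: e3)).
Definition mt8_5ii b : mtriple R := (bianchi8, (0, b *: e2, - b *: e1)).
Definition mt8_5iii : mtriple R := (bianchi8, (e2, e2, - (e1 + e3))).

Definition mt7_1 a : mtriple R := (bianchi7 a, bianchi1).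
Definition mt7_2i a : mtriple R := (bianchi7 a, (0, e1, 0)).
Definition mt7_2ii a : mtriple R := (bianchi7 a, (0, - e1, 0)).
Definition mt7_7 a b : mtriple R :=
  (bianchi7 a,
   (b *: (- a^-1 *: e2 + e3), 0, b *: (e2 + a^-1 *: e3))).

Definition mt70_1 : mtriple R := (bianchi70, bianchi1).
Definition mt70_2i : mtriple R := (bianchi70, (e3, 0, 0)).
Definition mt70_2ii : mtriple R := (bianchi70, (- e3, 0, 0)).
Definition mt70_4 b : mtriple R :=
  (bianchi70, (b *: (- e2 + e3), 0, b *: e3)).
Definition mt70_5i : mtriple R := (bianchi70, (- e2, 0, e3)).
Definition mt70_5ii b : mtriple R := (bianchi70, (0, b *: e2, - b *: e1)).

Definition mt6_1 a : mtriple R := (bianchi6 a, bianchi1).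
Definition mt6_2 a : mtriple R := (bianchi6 a, (0, e1, 0)).
Definition mt6_6i a b : mtriple R :=
  (bianchi6 a,
   (- b *: (a^-1 *: e2 + e3), 0, b *: (e2 + a^-1 *: e3))).
Definition mt6_6ii a : mtriple R :=
  (bianchi6 a, (e1, ((a + 1) / (a - 1)) *: (e2 + e3), e1)).
Definition mt6_6iii a : mtriple R :=
  (bianchi6 a, (e1, ((a - 1) / (a + 1)) *: (- e2 + e3), - e1)).

Definition mt60_1 : mtriple R := (bianchi60, bianchi1).
Definition mt60_2 : mtriple R := (bianchi60, (e3, 0, 0)).
Definition mt60_4i b : mtriple R :=
  (bianchi60, (b *: (- e2 + e3), 0, b *: e3)).
Definition mt60_4ii : mtriple R := (bianchi60, (- e1 + e2 + e3, e3, - e3)).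
Definition mt60_5i : mtriple R := (bianchi60, (- e2, 0, e3)).
Definition mt60_5ii : mtriple R := (bianchi60, (- e1 + e2, e3, - e3)).
Definition mt60_5iii b : mtriple R := (bianchi60, (0, - b *: e2, b *: e1)).

Definition mt5_1 : mtriple R := (bianchi5, bianchi1).
Definition mt5_2i : mtriple R := (bianchi5, (0, e1, 0)).
Definition mt5_2ii : mtriple R := (bianchi5, (e3, 0, 0)).

Definition mt4_1 : mtriple R := (bianchi4, bianchi1).
Definition mt4_2i : mtriple R := (bianchi4, (0, e1, 0)).
Definition mt4_2ii : mtriple R := (bianchi4, (0, - e1, 0)).
Definition mt4_2iii b : mtriple R := (bianchi4, (0, 0, b *: e2)).

Definition mt3_1 : mtriple R := (bianchi3, bianchi1).
Definition mt3_2 : mtriple R := (bianchi3, (0, e1, 0)).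
Definition mt3_3i b : mtriple R :=
  (bianchi3, (- b *: (e2 + e3), 0, b *: (e2 + e3))).
Definition mt3_3ii : mtriple R := (bianchi3, (0, e2 + e3, 0)).
Definition mt3_3iii : mtriple R := (bianchi3, (e1, 0, - e1)).

Definition mt2_1 : mtriple R := (bianchi2, bianchi1).
Definition mt2_2i : mtriple R := (bianchi2, (e3, 0, 0)).
Definition mt2_2ii : mtriple R := (bianchi2, (- e3, 0, 0)).

Definition mt1_1 : mtriple R := (bianchi1, bianchi1).

(* A class together with the values of its parameters; inequality c <> c' thus
   means different classes, or the same class with different parameters. *)
Inductive dclass : Type :=
  | Class1 of R
  | Class2 of R
  | Class3 of R & R
  | Class4 of R & R
  | Class5
  | Class6
  | Class7 of R
  | Class8 of R
  | Class9 of R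
  | Class10 of R
  | Class11
  | Class12
  | Class13
  | Class14 of R
  | Class15
  | Class16
  | Class17
  | Class18
  | Class19
  | Class20
  | Class21
  | Class22.

Definition in_range (c : dclass) : Prop :=
  match c with
  | Class1 b | Class2 b => 0 < b
  | Class3 a b => 1 <= a /\ b <> 0
  | Class4 a b => 1 < a /\ b <> 0
  | Class7 b | Class8 b => b <> 0
  | Class9 a | Class10 a => 1 < a
  | Class14 a => 0 < a /\ a < 1
  | _ => True
  end.

Definition class_triples (c : dclass) : seq (mtriple R) :=
  match c with
  | Class1 b => [:: mt9_5 b; mt8_5ii b; mt70_5ii b]
  | Class2 b => [:: mt8_5i b; mt60_5iii b]
  | Class3 a b => [:: mt7_7 a b; mt7_7 a^-1 b]
  | Class4 a b => [:: mt6_6i a b; mt6_6i a^-1 b]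
  | Class5 => [:: mt9_1]
  | Class6 => [:: mt8_1; mt8_5iii; mt70_5i; mt60_5i; mt5_2ii]
  | Class7 b => [:: mt70_4 b; mt4_2iii b; mt60_4i (- b)]
  | Class8 b => [:: mt3_3i b]
  | Class9 a => [:: mt7_1 a; mt7_2i a; mt7_2ii a]
  | Class10 a => [:: mt6_1 a; mt6_2 a; mt6_6ii a; mt6_6iii a]
  | Class11 => [:: mt60_1; mt60_5ii; mt5_1; mt5_2i]
  | Class12 => [:: mt60_2; mt60_4ii; mt4_1; mt4_2i; mt4_2ii]
  | Class13 => [:: mt3_1; mt3_2; mt3_3ii; mt3_3iii]
  | Class14 a => [:: mt7_1 a; mt7_2i a; mt7_2ii a]
  | Class15 => [:: mt70_1]
  | Class16 => [:: mt70_2i]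
  | Class17 => [:: mt70_2ii]
  | Class18 => [:: mt7_1 1; mt7_2i 1; mt7_2ii 1]
  | Class19 => [:: mt2_1]
  | Class20 => [:: mt2_2i]
  | Class21 => [:: mt2_2ii]
  | Class22 => [:: mt1_1]
  end.

End Tables.

(* Membership asks for one listed decomposition only; that all the listed ones
   (and their duals) then occur is a claim, not part of the definition. *)
Definition belongs_to (R : realType) (D : metric_algebra R)
    (c : dclass R) : Prop :=
  exists2 T : mtriple R, T \in class_triples c & allows_decomposition D T.

(* Main.v *)
(** Write the brackets of G as [x, y] = (x x y) S + a x (x x y) with S symmetric, and those
    of the dual algebra likewise with T and b. The Jacobi identities of the double become
    a S = 0, b T = 0 and S T = (a.b) 1 - b^T a. Three moves preserve the double: a change of
    basis of G, the exchange of G and its dual, and the twist by a vector r, which replaces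
    the dual algebra by its graph over r x _, that is T by T - (a^T r + r^T a) and b by
    b + r S, and is allowed if r S r^T + 2 b.r = 0.

    If a or b is nonzero, exchange to have a nonzero, rotate a to the first axis, and twist
    so that T and S both live on the last two coordinates and b on the first. As S T is then
    scalar on that plane, S and T are diagonalized together and rescaled to a listed triple.
    If a = b = 0, then S T = 0, S and T are diagonalized together and rescaled.

    Each class thus has a normal form. Normal forms are separated by invariants of the metric
    Lie algebra: the trace of the Killing operator and of its square (classes 1 to 4 and 8),
    the sign of the Killing form and the coefficient of a cubic identity satisfied by ad u
    (classes 5 to 7), and, when the Killing form has rank at most 1, the ratio of tr (ad u)^4
    to (tr (ad u)^2)^2 and the signs of semidefinite forms built from ad u. *)

Require Import Defs.
From mathcomp Require Import all_boot all_order all_algebra.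
From mathcomp Require Import reals.
From HB Require Import structures.
From mathcomp Require Import ring lra.
(* Required again because [form] is also defined in mathcomp, for sesquilinear forms. *)
Require Import Defs.

Set Implicit Arguments.
Unset Strict Implicit.
Unset Printing Implicit Defensive.
Import Order.TTheory GRing.Theory Num.Theory.
Local Open Scope ring_scope.

(** The moves are isomorphisms of raw metric algebras. They are checked on the trilinear form
    <[u, v], w> alone, since the metric is nondegenerate and gives the bracket back. Jacobi
    identities can then be transported along them: they are computed for the normal forms only, and
    every listed triple inherits them.

    The vector a is a trace: tr (ad x) = -2 a.x on G, so a = 0 says that G is unimodular. This is
    why the reduction splits on a and b.

    The ranges of the parameter a have a spectral explanation. In the double of 6_a or 7_a with
    abelian dual, the nonzero eigenvalues of ad X_1 are among +-(a +- 1), respectively +-(a +- i).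
    Replacing a by 1/a multiplies the first set by a real factor, which rescaling absorbs, and
    indeed the two doubles are isomorphic. It multiplies the second set by i/a, which changes the
    sign of tr (ad X_1)^2, so 7_a and 7_{1/a} fall into different classes, with a = 1 as the
    traceless case in between. *)

Lemma I3P (P : 'I_3 -> Prop) : P 0 -> P 1 -> P 2 -> forall i, P i.
Proof.
move=> P0 P1 P2 [[|[|[|//]]] Hi].
- by rewrite (_ : Ordinal Hi = 0) //; apply/val_inj.
- by rewrite (_ : Ordinal Hi = 1) //; apply/val_inj.
- by rewrite (_ : Ordinal Hi = 2) //; apply/val_inj.
Qed.

Lemma sum3 (V : nmodType) (F : 'I_3 -> V) : \sum_(i < 3) F i = F 0 + F 1 + F 2.
Proof.
rewrite !big_ord_recl big_ord0 addr0 addrA.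
by congr (_ + F _ + F _); apply/val_inj.
Qed.

(** * Brackets in coordinates *)

Section Coordinates.
Variable R : realType.
Implicit Types (x y z : 'rV[R]_3) (c : brackets3 R) (T : mtriple R).

(** Locked, so that [mxE] and simplification stop here and coordinates are read off only through
    [rvE]. *)
Definition rv (p q r : R) : 'rV[R]_3 := locked (\row_i [:: p; q; r]`_i).

Lemma rv0 p q r : rv p q r 0 0 = p. Proof. by rewrite /rv -lock mxE. Qed.
Lemma rv1 p q r : rv p q r 0 1 = q. Proof. by rewrite /rv -lock mxE. Qed.
Lemma rv2 p q r : rv p q r 0 2 = r. Proof. by rewrite /rv -lock mxE. Qed.
Definition rvE := (rv0, rv1, rv2).

Lemma rvP x y : x 0 0 = y 0 0 -> x 0 1 = y 0 1 -> x 0 2 = y 0 2 -> x = y.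
Proof. by move=> H0 H1 H2; apply/rowP; apply: I3P. Qed.

Lemma rv_eta x : x = rv (x 0 0) (x 0 1) (x 0 2).
Proof. by apply: rvP; rewrite !rvE. Qed.

Definition dot x y : R := x 0 0 * y 0 0 + x 0 1 * y 0 1 + x 0 2 * y 0 2.

Definition cross x y : 'rV[R]_3 :=
  rv (x 0 1 * y 0 2 - x 0 2 * y 0 1) (x 0 2 * y 0 0 - x 0 0 * y 0 2)
     (x 0 0 * y 0 1 - x 0 1 * y 0 0).

(* A bracket on a 3-dimensional space is a linear function of the cross product:
   [bmx c] maps the dual basis vectors e_2 x e_3, e_3 x e_1, e_1 x e_2 to the brackets. *)
Definition bmx c (x : 'rV[R]_3) : 'rV[R]_3 :=
  x 0 0 *: c.1.2 + x 0 1 *: c.2 + x 0 2 *: c.1.1.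
(** The transpose of [bmx c] for [dot], see [dot_bmxT]; it carries the coadjoint action in the mixed
    brackets. *)
Definition bmxT c (x : 'rV[R]_3) : 'rV[R]_3 :=
  rv (dot c.1.2 x) (dot c.2 x) (dot c.1.1 x).

Lemma bracket3E c x y : bracket3 c x y = bmx c (cross x y).
Proof.
by apply: rvP; rewrite /bracket3 /bmx /cross !(mxE, rvE); ring.
Qed.

Lemma struct_constE c k :
  ((struct_const c 0 0 k = 0) * (struct_const c 1 1 k = 0) *
  (struct_const c 2 2 k = 0) *
  (struct_const c 0 1 k = c.1.1 0 k) * (struct_const c 1 0 k = - c.1.1 0 k) *
  (struct_const c 1 2 k = c.1.2 0 k) * (struct_const c 2 1 k = - c.1.2 0 k) *
  (struct_const c 2 0 k = c.2 0 k) * (struct_const c 0 2 k = - c.2 0 k))%type.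
Proof. by rewrite /struct_const; do !split; rewrite !mxE /=; ring. Qed.

Lemma mixed_bracketE T (p q : 'rV[R]_3) : mixed_bracket T p q =
    (cross (bmxT T.2 p) q, cross p (bmxT T.1 q)).
Proof.
rewrite /mixed_bracket !sum3 /=.
by congr (_, _); apply: rvP; rewrite /cross /bmxT !(mxE, struct_constE, rvE) /dot; ring.
Qed.

Lemma double_bracketE T (u v : double_of T) :
  bracket u v =
   (bmx T.1 (cross u.1 v.1) + cross (bmxT T.2 u.1) v.2 - cross (bmxT T.2 v.1) u.2,
    bmx T.2 (cross u.2 v.2) + cross u.1 (bmxT T.1 v.2) - cross v.1 (bmxT T.1 u.2)).
Proof.
by case: u v => [x xi] [y eta]; rewrite /= !mixed_bracketE -!bracket3E.
Qed.

Lemma dotC x y : dot x y = dot y x.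
Proof. by rewrite /dot; ring. Qed.

Lemma dotDl x y z : dot (x + y) z = dot x z + dot y z.
Proof. by rewrite /dot !mxE; ring. Qed.

Lemma dotZl k x y : dot (k *: x) y = k * dot x y.
Proof. by rewrite /dot !mxE; ring. Qed.

Lemma dot_cross x y z : dot (cross x y) z = dot (cross y z) x.
Proof. by rewrite /dot /cross !rvE; ring. Qed.

Lemma crossZl k x y : cross (k *: x) y = k *: cross x y.
Proof. by apply: rvP; rewrite /cross !(mxE, rvE); ring. Qed.

Lemma dotDr x y z : dot x (y + z) = dot x y + dot x z.
Proof. by rewrite !(dotC x) dotDl. Qed.

Lemma dotNl x z : dot (- x) z = - dot x z.
Proof. by rewrite /dot !mxE; ring. Qed.

Lemma crossDl x y z : cross (x + y) z = cross x z + cross y z.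
Proof. by apply: rvP; rewrite /cross !(mxE, rvE); ring. Qed.

Lemma crossC x y : cross x y = - cross y x.
Proof. by apply: rvP; rewrite /cross !(mxE, rvE); ring. Qed.

Lemma crossDr x y z : cross x (y + z) = cross x y + cross x z.
Proof. by rewrite crossC crossDl opprD -!(crossC x). Qed.

Lemma dot_nondeg x : (forall y, dot x y = 0) -> x = 0.
Proof.
move=> H; apply: rvP; rewrite mxE.
- by rewrite -(H (rv 1 0 0)) /dot !rvE; ring.
- by rewrite -(H (rv 0 1 0)) /dot !rvE; ring.
- by rewrite -(H (rv 0 0 1)) /dot !rvE; ring.
Qed.

Lemma bmxP c k x y : bmx c (k *: x + y) = k *: bmx c x + bmx c y.
Proof. by apply: rvP; rewrite /bmx !mxE; ring. Qed.

Lemma bmxTP c k x y : bmxT c (k *: x + y) = k *: bmxT c x + bmxT c y.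
Proof. by apply: rvP; rewrite /bmxT /dot !(mxE, rvE); ring. Qed.

Lemma crossPl k x y z : cross (k *: x + y) z = k *: cross x z + cross y z.
Proof. by rewrite crossDl crossZl. Qed.

Lemma crossPr k x y z : cross z (k *: x + y) = k *: cross z x + cross z y.
Proof. by apply: rvP; rewrite /cross !(mxE, rvE); ring. Qed.

Lemma cross0r x : cross x 0 = 0.
Proof. by apply: rvP; rewrite /cross !(mxE, rvE); ring. Qed.

Lemma cross0l x : cross 0 x = 0.
Proof. by rewrite crossC cross0r oppr0. Qed.

Lemma bmx0 c : bmx c 0 = 0.
Proof. by apply: rvP; rewrite /bmx !mxE; ring. Qed.

Lemma bmxT0 c : bmxT c 0 = 0.
Proof. by apply: rvP; rewrite /bmxT /dot !(mxE, rvE); ring. Qed.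

Lemma cross_rv p1 p2 p3 q1 q2 q3 : cross (rv p1 p2 p3) (rv q1 q2 q3) =
  rv (p2 * q3 - p3 * q2) (p3 * q1 - p1 * q3) (p1 * q2 - p2 * q1) :> 'rV[R]_3.
Proof. by rewrite /cross !rvE. Qed.

Lemma add_rv p1 p2 p3 q1 q2 q3 : rv p1 p2 p3 + rv q1 q2 q3 =
  rv (p1 + q1) (p2 + q2) (p3 + q3) :> 'rV[R]_3.
Proof. by apply: rvP; rewrite !(mxE, rvE). Qed.

Lemma opp_rv p1 p2 p3 : - rv p1 p2 p3 = rv (- p1) (- p2) (- p3) :> 'rV[R]_3.
Proof. by apply: rvP; rewrite !(mxE, rvE). Qed.

Lemma scale_rv k p1 p2 p3 : k *: rv p1 p2 p3 = rv (k * p1) (k * p2) (k * p3) :> 'rV[R]_3.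
Proof. by apply: rvP; rewrite !(mxE, rvE). Qed.

Lemma zero_rv : 0 = rv 0 0 0 :> 'rV[R]_3.
Proof. by apply: rvP; rewrite !(mxE, rvE). Qed.

Lemma rv_inj (p1 p2 p3 q1 q2 q3 : R) : rv p1 p2 p3 = rv q1 q2 q3 ->
  [/\ p1 = q1, p2 = q2 & p3 = q3].
Proof.
by move=> E; split; [rewrite -(rv0 p1 p2 p3)|rewrite -(rv1 p1 p2 p3)|
  rewrite -(rv2 p1 p2 p3)]; rewrite E rvE.
Qed.

Lemma bmxN c x : bmx c (- x) = - bmx c x.
Proof. by apply: rvP; rewrite /bmx !mxE; ring. Qed.

Lemma dot_bmxT c x y : dot x (bmxT c y) = dot (bmx c x) y.
Proof. by rewrite /dot /bmx /bmxT !(mxE, rvE) /dot; ring. Qed.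

Lemma crossxx x : cross x x = 0.
Proof. by apply: rvP; rewrite /cross !(mxE, rvE); ring. Qed.

Lemma cross_crossr x y z : cross x (cross y z) = dot x z *: y - dot x y *: z.
Proof. by apply: rvP; rewrite /cross /dot !(mxE, rvE); ring. Qed.

End Coordinates.

Section Doubles.
Variable R : realType.
Implicit Types (x y z : 'rV[R]_3) (c : brackets3 R) (T : mtriple R).
Implicit Types (D : metric_algebra R).

Lemma isomorphic_sym D D' : isomorphic D D' -> isomorphic D' D.
Proof.
case=> f [[g fK gK] fB fF].
have glin : linear g.
  by move=> a u v; apply: (can_inj fK); rewrite linearP !gK.
pose G : {linear D' -> D} := HB.pack g (GRing.isLinear.Build R D' D _ g glin).
exists G; split; first by exists f.
- by move=> x y; apply: (can_inj fK); rewrite fB /= !gK.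
- by move=> x y; rewrite -fF /= !gK.
Qed.

Lemma isomorphic_trans D1 D2 D3 :
  isomorphic D1 D2 -> isomorphic D2 D3 -> isomorphic D1 D3.
Proof.
case=> f [fbij fB fF] [g [gbij gB gF]].
exists (g \o f : {linear D1 -> D3}); split; first exact: bij_comp.
- by move=> x y; rewrite /= fB gB.
- by move=> x y; rewrite /= gF fF.
Qed.

Lemma isomorphic_refl D : isomorphic D D.
Proof. by exists idfun; split=> //; exists idfun. Qed.

Local Notation vec := ('rV[R]_3 * 'rV[R]_3)%type.

Definition pairing (u v : vec) : R := dot u.1 v.2 + dot u.2 v.1.

Lemma formE T (u v : double_of T) : form u v = pairing u v.
Proof. by rewrite /= sum3 /pairing /dot; ring. Qed.

(* The invariant alternating form <[u, v], w>, from which the bracket is recovered. *)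
Definition cartan T (u v w : vec) : R :=
  dot (bmx T.1 (cross u.1 v.1)) w.2 + dot (bmx T.1 (cross v.1 w.1)) u.2 +
  dot (bmx T.1 (cross w.1 u.1)) v.2 +
  (dot (bmx T.2 (cross u.2 v.2)) w.1 + dot (bmx T.2 (cross v.2 w.2)) u.1 +
  dot (bmx T.2 (cross w.2 u.2)) v.1).

(** Each mixed term of the bracket turns into a term of [cartan] once [bmxT] is moved across [dot]
    and the triple product is rotated. *)
Lemma form_bracketE T (u v w : double_of T) :
  form (bracket u v) w = cartan T u v w.
Proof.
rewrite formE double_bracketE /pairing /cartan /=.
rewrite (dotDl (bmx T.1 (cross u.1 v.1) + _)) (dotDl (bmx T.1 (cross u.1 v.1))).
rewrite (dotDl (bmx T.2 (cross u.2 v.2) + _)) (dotDl (bmx T.2 (cross u.2 v.2))) !dotNl.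
rewrite !(dot_cross (bmxT _ _)) !dot_bmxT.
rewrite -!(dot_cross w.1) !dot_bmxT (crossC w.1 v.1) bmxN dotNl.
by rewrite (crossC u.2 w.2) bmxN dotNl; ring.
Qed.

Lemma pairing_nondeg (u : vec) : (forall v, pairing u v = 0) -> u = 0.
Proof.
case: u => x xi H; congr (_, _); apply: rvP; rewrite mxE.
- by have := H (0, rv 1 0 0); rewrite /pairing /dot /= !(mxE, rvE) => <-; ring.
- by have := H (0, rv 0 1 0); rewrite /pairing /dot /= !(mxE, rvE) => <-; ring.
- by have := H (0, rv 0 0 1); rewrite /pairing /dot /= !(mxE, rvE) => <-; ring.
- by have := H (rv 1 0 0, 0); rewrite /pairing /dot /= !(mxE, rvE) => <-; ring.
- by have := H (rv 0 1 0, 0); rewrite /pairing /dot /= !(mxE, rvE) => <-; ring.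
- by have := H (rv 0 0 1, 0); rewrite /pairing /dot /= !(mxE, rvE) => <-; ring.
Qed.

Lemma pairingBl (u v w : vec) : pairing (u - v) w = pairing u w - pairing v w.
Proof. by rewrite /pairing /dot /= !mxE; ring. Qed.

Lemma pairing_inj (u v : vec) : (forall w, pairing u w = pairing v w) -> u = v.
Proof.
move=> H; apply/eqP; rewrite -subr_eq0; apply/eqP/pairing_nondeg => w.
by rewrite pairingBl H subrr.
Qed.

(** For an isometry, preserving [cartan] means preserving the bracket: every test vector is an image
    [f (g w)], and pairings with all test vectors determine a vector. *)
Lemma double_iso T T' (f : {linear vec -> vec}) (g : vec -> vec) :
  cancel f g -> cancel g f -> (forall u v, pairing (f u) (f v) = pairing u v) ->
  (forall u v w, cartan T' (f u) (f v) (f w) = cartan T u v w) ->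
  isomorphic (double_of T) (double_of T').
Proof.
move=> fK gK fF fC; exists (f : {linear double_of T -> double_of T'}); split.
- by exists g.
- move=> x y; apply: pairing_inj => w; rewrite -(gK w) fF -!formE.
  rewrite (@form_bracketE T) -fC -(@form_bracketE T').
  by rewrite gK.
- by move=> x y; rewrite !formE fF.
Qed.

End Doubles.

(** * Changes of Manin triple *)

Section Moves.
Variable R : realType.
Local Notation vec := ('rV[R]_3 * 'rV[R]_3)%type.
Implicit Types (x y z a b : 'rV[R]_3) (S T P Q : 'M[R]_3).

(** The determinant as the triple product of the rows, the shape in which it arises from cross
    products. *)
Definition det3 (M : 'M[R]_3) : R := dot (cross (row 0 M) (row 1 M)) (row 2 M).

Lemma det3M P Q : det3 (P *m Q) = det3 P * det3 Q.
Proof. by rewrite /det3 /dot /cross !(mxE, rvE) !sum3; ring. Qed.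

Lemma det3_tr P : det3 P^T = det3 P.
Proof. by rewrite /det3 /dot /cross !(mxE, rvE); ring. Qed.

Lemma det31 : det3 1%:M = 1.
Proof. by rewrite /det3 /dot /cross !(mxE, rvE) /=; ring. Qed.

Lemma rowE3 x S k : (x *m S) 0 k = x 0 0 * S 0 k + x 0 1 * S 1 k + x 0 2 * S 2 k.
Proof. by rewrite mxE sum3. Qed.

Lemma dot_mulmxr x y S : dot x (y *m S) = dot (x *m S^T) y.
Proof. by rewrite /dot !rowE3 !mxE; ring. Qed.

(** [Q] is the inverse transpose of [P], so [det3 P *: Q] is the cofactor matrix. Both sides are
    tested against the vectors [z *m P], which are all vectors; there only the scaling of volume by
    [det3 P] is needed. *)
Lemma cross_mulmx P Q x y : Q *m P^T = 1%:M ->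
  cross (x *m P) (y *m P) = det3 P *: (cross x y *m Q).
Proof.
move=> QP; have PQ : Q^T *m P = 1%:M.
  by apply: mulmx1C; apply: trmx_inj; rewrite trmx_mul trmxK trmx1.
have volume z : dot (cross (x *m P) (y *m P)) (z *m P) = det3 P * dot (cross x y) z.
  rewrite /det3 /dot /cross !(rvE, rowE3, mxE); ring.
have dotP n : dot (cross (x *m P) (y *m P)) n = dot (det3 P *: (cross x y *m Q)) n.
  by rewrite -[in LHS](mulmx1 n) -PQ mulmxA volume dotZl dot_mulmxr trmxK.
apply: rvP; [have := dotP (rv 1 0 0)|have := dotP (rv 0 1 0)|have := dotP (rv 0 0 1)];
by rewrite /dot !rvE !(mulr0, mulr1, addr0, add0r).
Qed.

(* The bracket (x, y) |-> (x x y) S + a x (x x y): Bianchi's decomposition of the structure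
   constants into a symmetric matrix S and a vector a. *)
Definition brackets_of S a : brackets3 R :=
  (row 2 S + rv (a 0 1) (- a 0 0) 0, row 0 S + rv 0 (a 0 2) (- a 0 1),
   row 1 S + rv (- a 0 2) 0 (a 0 0)).

Lemma bmx_brackets_of S a x : bmx (brackets_of S a) x = x *m S + cross a x.
Proof. by apply: rvP; rewrite /bmx /cross /= !(mxE, rvE) !sum3; ring. Qed.

Definition triple_of S a T b : mtriple R := (brackets_of S a, brackets_of T b).

Lemma triple_of_eta (t : mtriple R) :
  exists S a T b, [/\ S^T = S, T^T = T & t = triple_of S a T b].
Proof.
have decomposition c : exists S a, S^T = S /\ c = brackets_of S a.
  (* The rows are the images of e_2 x e_3, e_3 x e_1 and e_1 x e_2; [S] is the symmetric part of
     this matrix and [a] the axial vector of its antisymmetric part. *)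
  pose N : 'M_3 := \matrix_(i, j) [:: c.1.2 0 j; c.2 0 j; c.1.1 0 j]`_i.
  exists (2^-1 *: (N + N^T)), (rv (2^-1 * (N 1 2 - N 2 1)) (2^-1 * (N 2 0 - N 0 2))
    (2^-1 * (N 0 1 - N 1 0))); split.
    by rewrite linearZ linearD /= trmxK addrC.
  case: c @N => [[c12 c23] c31] /=.
  by congr (_, _, _); apply: rvP; rewrite !(mxE, rvE) /=; field.
case: t => [c d].
have [S [a [Ss ->]]] := decomposition c; have [T [b [Ts ->]]] := decomposition d.
by exists S, a, T, b.
Qed.

Lemma cartan_triple_of S a T b (u v w : vec) : cartan (triple_of S a T b) u v w =
  (dot (cross u.1 v.1 *m S) w.2 + dot (cross v.1 w.1 *m S) u.2 +
   dot (cross w.1 u.1 *m S) v.2 +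
   (dot (cross (cross u.1 v.1) w.2) a + dot (cross (cross v.1 w.1) u.2) a +
   dot (cross (cross w.1 u.1) v.2) a)) +
  (dot (cross u.2 v.2 *m T) w.1 + dot (cross v.2 w.2 *m T) u.1 +
   dot (cross w.2 u.2 *m T) v.1 +
   (dot (cross (cross u.2 v.2) w.1) b + dot (cross (cross v.2 w.2) u.1) b +
   dot (cross (cross w.2 u.2) v.1) b)).
Proof.
rewrite /cartan /= !bmx_brackets_of !dotDl !(dot_cross a) !(dot_cross b).
ring.
Qed.

(** The isometry is [P] on the first factor and its inverse transpose [Q] on the second. The
    determinants enter because [S] and [T] act on cross products; in the terms with [a] and [b] two
    nested cross products contribute inverse determinants, which cancel. *)
Lemma GL_iso S a T b P Q : Q *m P^T = 1%:M ->
  isomorphic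
    (double_of (triple_of (det3 P *: (Q *m S *m Q^T)) (a *m P^T)
                    (det3 Q *: (P *m T *m P^T)) (b *m Q^T)))
    (double_of (triple_of S a T b)).
Proof.
move=> QP.
have PQ : P *m Q^T = 1%:M by apply: trmx_inj; rewrite trmx_mul trmxK trmx1.
have QP' := mulmx1C QP; have PQ' := mulmx1C PQ.
have dPQ : det3 P * det3 Q = 1 by rewrite mulrC -(det3_tr P) -det3M QP det31.
pose g (u : vec) : vec := (u.1 *m Q^T, u.2 *m P^T).
pose f (u : vec) : vec := (u.1 *m P, u.2 *m Q).
have flin : linear f.
  by move=> k [x xi] [y eta]; congr (_, _); rewrite /= mulmxDl scalemxAl.
pose F : {linear vec -> vec} := HB.pack f (GRing.isLinear.Build R vec vec _ f flin).
apply: (@double_iso _ _ _ F g).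
- by case=> x xi; congr (_, _); rewrite -mulmxA ?PQ ?QP mulmx1.
- by case=> x xi; congr (_, _); rewrite -mulmxA ?PQ' ?QP' mulmx1.
- case=> [x xi] [y eta]; rewrite /pairing /= !dot_mulmxr -!mulmxA.
  by rewrite PQ QP !mulmx1.
- have CC P' Q' p q r : Q' *m P'^T = 1%:M -> P' *m Q'^T = 1%:M ->
      det3 P' * det3 Q' = 1 ->
      cross (cross (p *m P') (q *m P')) (r *m Q') = cross (cross p q) r *m P'.
    move=> H1 H2 H3; rewrite (cross_mulmx _ _ H1) crossZl (cross_mulmx _ _ H2).
    by rewrite scalerA H3 scale1r.
  have dQP : det3 Q * det3 P = 1 by rewrite mulrC.
  have SE p q r : dot (cross (p *m P) (q *m P) *m S) (r *m Q) =
      dot (cross p q *m (det3 P *: (Q *m S *m Q^T))) r.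
    by rewrite dot_mulmxr (cross_mulmx _ _ QP) -!scalemxAl -scalemxAr !mulmxA.
  have TE p q r : dot (cross (p *m Q) (q *m Q) *m T) (r *m P) =
      dot (cross p q *m (det3 Q *: (P *m T *m P^T))) r.
    by rewrite dot_mulmxr (cross_mulmx _ _ PQ) -!scalemxAl -scalemxAr !mulmxA.
  case=> [x xi] [y eta] [z zeta]; rewrite !cartan_triple_of /=.
  rewrite (SE x y zeta) (SE y z xi) (SE z x eta).
  rewrite (TE xi eta z) (TE eta zeta x) (TE zeta xi y).
  rewrite !(CC P Q _ _ _ QP PQ dPQ) !(CC Q P _ _ _ PQ QP dQP).
  by rewrite !(dot_mulmxr _ _ P^T) !(dot_mulmxr _ _ Q^T) !trmxK.
Qed.

End Moves.

(** * The exchange of factors, and the terms of a twisted trilinear form *)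

Section TwistIdentities.
Variable R : realType.
Local Notation vec := ('rV[R]_3 * 'rV[R]_3)%type.
Implicit Types (x y z a b r : 'rV[R]_3) (S T P Q : 'M[R]_3).

Lemma sym3E S : S^T = S -> ((S 1 0 = S 0 1) * (S 2 0 = S 0 2) * (S 2 1 = S 1 2))%type.
Proof. by move=> Ss; do !split; rewrite -[in LHS]Ss mxE. Qed.

Lemma dual_iso (t : mtriple R) :
  isomorphic (double_of (dual_mtriple t)) (double_of t).
Proof.
pose f (u : vec) : vec := (u.2, u.1).
have flin : linear f by move=> k [x xi] [y eta]; congr (_, _).
pose F : {linear vec -> vec} := HB.pack f (GRing.isLinear.Build R vec vec _ f flin).
apply: (@double_iso _ _ _ F f); [by case|by case|by move=> u v; rewrite /pairing /= addrC|].
by move=> u v w; rewrite /cartan /= addrC.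
Qed.

Lemma cross_cross r x y : cross (cross r x) (cross r y) = dot (cross x y) r *: r.
Proof. by apply: rvP; rewrite /cross /dot !(mxE, rvE); ring. Qed.

(** Cramer's rule for [r] in terms of [xi], [eta], [zeta], paired with [m]. *)
Lemma twist_quadratic r xi eta zeta m :
  dot (cross xi eta) r * dot m zeta + dot (cross eta zeta) r * dot m xi +
  dot (cross zeta xi) r * dot m eta = dot (cross xi eta) zeta * dot m r.
Proof. by rewrite /dot /cross !rvE; ring. Qed.

Lemma dot_mulmx_sym S x y : S^T = S -> dot (x *m S) y = dot (y *m S) x.
Proof. by move=> Ss; rewrite dotC dot_mulmxr Ss. Qed.

(** These terms of the twisted form have the shape of those of the vector [b], hence the new vector
    [b + r *m S]. *)
Lemma twist_S S r x eta zeta : S^T = S ->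
  dot (cross x (cross r eta) *m S) zeta + dot (cross (cross r zeta) x *m S) eta =
  dot (cross (cross eta zeta) x) (r *m S).
Proof.
move=> Ss; rewrite (crossC (cross _ _) x) (crossC (cross eta zeta)) !cross_crossr.
rewrite !(mulmxBl, mulNmx) -!scalemxAl !(dotDl, dotNl, dotZl).
rewrite (dot_mulmx_sym eta zeta Ss) (dotC zeta) (dotC eta (r *m S)); ring.
Qed.

(** A symmetric bilinear expression in [a] and [r]: it is absorbed by the matrix [T], which loses
    [a^T *m r + r^T *m a]. *)
Lemma twist_a a r x eta zeta :
  dot (cross (cross x (cross r eta)) zeta) a + dot (cross (cross (cross r zeta) x) eta) a =
  - (dot (cross eta zeta) a * dot r x + dot (cross eta zeta) r * dot a x).
Proof. by rewrite /dot /cross !rvE; ring. Qed.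

Lemma twist_T T r xi eta zeta : T^T = T ->
  dot (cross xi eta *m T) (cross r zeta) + dot (cross eta zeta *m T) (cross r xi) +
  dot (cross zeta xi *m T) (cross r eta) = 0.
Proof.
move=> Ts; rewrite /dot !rowE3 !(sym3E Ts) /cross !rvE; ring.
Qed.

(** One of the two obstructions proportional to the volume of [xi], [eta], [zeta]; the other comes
    from [S] through [twist_quadratic]. *)
Lemma twist_b b r xi eta zeta :
  dot (cross (cross xi eta) (cross r zeta)) b +
  dot (cross (cross eta zeta) (cross r xi)) b +
  dot (cross (cross zeta xi) (cross r eta)) b =
  2 * (dot (cross xi eta) zeta * dot b r).
Proof. rewrite /dot /cross !rvE; ring. Qed.

Lemma dot_rank1 a r x y : dot (x *m (a^T *m r)) y = dot x a * dot r y.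
Proof.
by rewrite mulmxA /dot !(mxE, big_ord1) !sum3 !mxE; ring.
Qed.

End TwistIdentities.

Section Twist.
Variable R : realType.
Local Notation vec := ('rV[R]_3 * 'rV[R]_3)%type.
Implicit Types (x y z a b r : 'rV[R]_3) (S T P Q : 'M[R]_3).

(* The maps x + xi |-> x + r x xi + xi are the isometries of the metric fixing the first
   factor; the last term vanishes exactly when they send the second factor to a subalgebra. *)
Lemma twist_cartan S a T b r (u v w : vec) : S^T = S -> T^T = T ->
  let f (u : vec) : vec := (u.1 + cross r u.2, u.2) in
  cartan (triple_of S a T b) (f u) (f v) (f w) =
  cartan (triple_of S a (T - (a^T *m r + r^T *m a)) (b + r *m S)) u v w
  + dot (cross u.2 v.2) w.2 * (dot (r *m S) r + 2 * dot b r).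
Proof.
case: u v w => [x xi] [y eta] [z zeta] Ss Ts /=; rewrite !cartan_triple_of /=.
rewrite !crossDl !crossDr !cross_cross !(crossDl, mulmxDl, mulmxDr, mulmxN, dotDl, dotDr, dotNl).
rewrite !dot_rank1 -!scalemxAl !crossZl !dotZl.
have E1 := twist_S r x eta zeta Ss; have E1' := twist_S r y zeta xi Ss.
have E1'' := twist_S r z xi eta Ss; have E2 := twist_a a r x eta zeta.
have E2' := twist_a a r y zeta xi; have E2'' := twist_a a r z xi eta.
have E3 := twist_T r xi eta zeta Ts.
have E4 := twist_b b r xi eta zeta.
have E5 := twist_quadratic r xi eta zeta (r *m S).
(* The terms quadratic in [r] that come from [a] vanish: by Cramer's rule they add up to a multiple
   of the product of [cross a r] with [r]. *)
have E6 : dot (cross xi eta) r * dot (cross r zeta) a +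
  dot (cross eta zeta) r * dot (cross r xi) a +
  dot (cross zeta xi) r * dot (cross r eta) a = 0.
  rewrite !(dot_cross r) !(dot_cross _ a r) twist_quadratic.
  by rewrite /dot /cross !rvE; ring.
lra.
Qed.

Lemma twist_iso S a T b r : S^T = S -> T^T = T -> dot (r *m S) r + 2 * dot b r = 0 ->
  isomorphic (double_of (triple_of S a (T - (a^T *m r + r^T *m a)) (b + r *m S)))
             (double_of (triple_of S a T b)).
Proof.
move=> Ss Ts close.
pose f (u : vec) : vec := (u.1 + cross r u.2, u.2).
pose g (u : vec) : vec := (u.1 - cross r u.2, u.2).
have flin : linear f.
  move=> k [x xi] [y eta]; congr (_, _).
  by apply: rvP; rewrite /cross !(mxE, rvE); ring.
pose F : {linear vec -> vec} := HB.pack f (GRing.isLinear.Build R vec vec _ f flin).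
apply: (@double_iso _ _ _ F g).
- by case=> x xi; rewrite /g /= addrK.
- by case=> x xi; congr (_, _); rewrite /= subrK.
- by case=> [x xi] [y eta]; rewrite /pairing /dot /cross /= !(mxE, rvE); ring.
- by move=> u v w; rewrite [LHS]twist_cartan // close mulr0 addr0.
Qed.

End Twist.

(** * Decompositions as isomorphisms *)

Section Frames.
Variable R : realType.
Local Notation vec := ('rV[R]_3 * 'rV[R]_3)%type.
Implicit Types (c d : brackets3 R) (T : mtriple R).

Section Bilinear.
Variable D : metric_algebra R.
Hypothesis lieD : lie_bracket D.
Hypothesis formD : invariant_form D.
Implicit Types (x y z : D) (X Xt : 3.-tuple D) (p q : 'rV[R]_3).

Lemma bracketDl x y z : bracket (x + y) z = bracket x z + bracket y z.
Proof. by case: lieD => _ H _ _; have := H z 1 x y; rewrite !scale1r. Qed.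
Lemma bracketDr x y z : bracket z (x + y) = bracket z x + bracket z y.
Proof. by case: lieD => H _ _ _; have := H z 1 x y; rewrite !scale1r. Qed.
Lemma bracket0l x : bracket 0 x = 0.
Proof. by apply: (addrI (bracket 0 x)); rewrite -bracketDl !addr0. Qed.
Lemma bracket0r x : bracket x 0 = 0.
Proof. by apply: (addrI (bracket x 0)); rewrite -bracketDr !addr0. Qed.
Lemma bracketZl k x y : bracket (k *: x) y = k *: bracket x y.
Proof. by case: lieD => _ H _ _; have := H y k x 0; rewrite bracket0l !addr0. Qed.
Lemma bracketZr k x y : bracket x (k *: y) = k *: bracket x y.
Proof. by case: lieD => H _ _ _; have := H x k y 0; rewrite bracket0r !addr0. Qed.
Lemma bracketxx x : bracket x x = 0. Proof. by case: lieD. Qed.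
Lemma bracketC x y : bracket x y = - bracket y x.
Proof.
apply/eqP; rewrite -addr_eq0; have := bracketxx (x + y).
by rewrite bracketDl !bracketDr !bracketxx add0r addr0 => ->.
Qed.
Lemma mformC x y : form x y = form y x. Proof. by case: formD. Qed.
Lemma mformDr x y z : form z (x + y) = form z x + form z y.
Proof. by case: formD => H _ _ _; have := H z 1 x y; rewrite scale1r => ->; rewrite mul1r. Qed.
Lemma mformDl x y z : form (x + y) z = form x z + form y z.
Proof. by rewrite !(mformC _ z) mformDr. Qed.
Lemma mform0r x : form x 0 = 0.
Proof. by apply: (addrI (form x 0)); rewrite -mformDr !addr0. Qed.
Lemma mformZr k x y : form x (k *: y) = k * form x y.
Proof. by case: formD => H _ _ _; have := H x k y 0; rewrite mform0r !addr0. Qed.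
Lemma mformZl k x y : form (k *: x) y = k * form x y.
Proof. by rewrite !(mformC _ y) mformZr. Qed.
Lemma mformNl x y : form (- x) y = - form x y.
Proof. by rewrite -scaleN1r mformZl mulN1r. Qed.
Lemma form_cyc x y z : form (bracket x y) z = form (bracket y z) x.
Proof.
case: formD => _ _ H _; have := H x z y.
by rewrite bracketC mformNl addrC => /eqP; rewrite subr_eq0 mformC => /eqP ->.
Qed.

Definition comb (X : 3.-tuple D) p : D :=
  locked (p 0 0 *: X`_0 + p 0 1 *: X`_1 + p 0 2 *: X`_2).

Lemma combE X p : comb X p = p 0 0 *: X`_0 + p 0 1 *: X`_1 + p 0 2 *: X`_2.
Proof. by rewrite /comb -lock. Qed.

Lemma comb_sum X p : comb X p = \sum_(i < 3) p 0 i *: X`_i.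
Proof. by rewrite combE sum3. Qed.

Lemma comb_linear X : linear (comb X).
Proof.
move=> k p q; rewrite !comb_sum scaler_sumr -big_split; apply: eq_bigr => i _ /=.
by rewrite !mxE scalerDl scalerA.
Qed.

Lemma bracket_comb X c p q : has_brackets X c ->
  bracket (comb X p) (comb X q) = comb X (bmx c (cross p q)).
Proof.
case=> H01 H12 H20.
have E (r : 'rV[R]_3) : \sum_(k < 3) r 0 k *: X`_k = comb X r by rewrite comb_sum.
rewrite !E in H01 H12 H20.
have add r s : comb X (r + s) = comb X r + comb X s.
  by have := comb_linear X 1 r s; rewrite !scale1r.
have sca k r : comb X (k *: r) = k *: comb X r.
  have := comb_linear X k r 0; rewrite addr0 => ->.
  by rewrite [comb X 0]comb_sum big1 ?addr0 // => i _; rewrite mxE scale0r.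
rewrite [in RHS]/bmx !add !sca -H01 -H12 -H20 /cross !rvE.
rewrite [in LHS]combE [in LHS](combE X q) !(bracketDl, bracketDr, bracketZl,
  bracketZr) !bracketxx.
rewrite (bracketC X`_1 X`_0) (bracketC X`_2 X`_1) (bracketC X`_0 X`_2).
rewrite !scaler0 !scalerN !scalerA !scalerBl.
rewrite (mulrC (p 0 0)) (mulrC (p 0 1)) (mulrC (p 0 2)).
rewrite (mulrC (p 0 0)) (mulrC (p 0 1)) (mulrC (p 0 2)).
by rewrite add0r !addr0 !addrA [LHS](ACl (4*6*5*2*1*3)).
Qed.

Variables (X Xt : 3.-tuple D).
Hypothesis iX : forall i j : 'I_3, form X`_i X`_j = 0.
Hypothesis iXt : forall i j : 'I_3, form Xt`_i Xt`_j = 0.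
Hypothesis dual : forall i j : 'I_3, form X`_i Xt`_j = (i == j)%:R.

Lemma form_comb p q : form (comb X p) (comb Xt q) = dot p q.
Proof.
rewrite !combE !(mformDl, mformDr, mformZl, mformZr).
rewrite (dual 0 0) (dual 0 1) (dual 0 2) (dual 1 0) (dual 1 1) (dual 1 2).
by rewrite (dual 2 0) (dual 2 1) (dual 2 2) /dot /=; ring.
Qed.

Lemma form_combX p q : form (comb X p) (comb X q) = 0.
Proof.
rewrite !combE !(mformDl, mformDr, mformZl, mformZr).
rewrite (iX 0 0) (iX 0 1) (iX 0 2) (iX 1 0) (iX 1 1) (iX 1 2).
by rewrite (iX 2 0) (iX 2 1) (iX 2 2); ring.
Qed.

Lemma form_combXt p q : form (comb Xt p) (comb Xt q) = 0.
Proof.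
rewrite !combE !(mformDl, mformDr, mformZl, mformZr).
rewrite (iXt 0 0) (iXt 0 1) (iXt 0 2) (iXt 1 0) (iXt 1 1) (iXt 1 2).
by rewrite (iXt 2 0) (iXt 2 1) (iXt 2 2); ring.
Qed.

Definition frame_map (u : vec) : D := comb X u.1 + comb Xt u.2.
Definition frame_inv (v : D) : vec :=
  (\row_(i < 3) form v Xt`_i, \row_(i < 3) form v X`_i).

Lemma form_frame u v : form (frame_map u) (frame_map v) = pairing u v.
Proof.
rewrite /frame_map mformDl (mformDr _ _ (comb X _)) (mformDr _ _ (comb Xt _)).
rewrite form_combX form_combXt form_comb add0r addr0.
by rewrite (mformC (comb Xt _)) form_comb /pairing (dotC u.2).
Qed.

Lemma frame_map_linear : linear frame_map.
Proof.
move=> k u v; rewrite /frame_map (comb_linear X) (comb_linear Xt) scalerDr.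
by rewrite !addrA [LHS](ACl (1*3*2*4)).
Qed.

Lemma frame_mapK : cancel frame_map frame_inv.
Proof.
move=> [x xi]; congr (_, _); apply/rowP => i; rewrite mxE.
- have -> : Xt`_i = frame_map (0, delta_mx 0 i).
    rewrite /frame_map /= !comb_sum big1; last by move=> j _; rewrite mxE scale0r.
    rewrite add0r (bigD1 i) //= big1; last first.
      by move=> j ji; rewrite mxE (negPf ji) scale0r.
    by rewrite mxE !eqxx scale1r addr0.
  rewrite form_frame /pairing /dot /=.
  by elim/I3P: i; rewrite !mxE /=; ring.
- have -> : X`_i = frame_map (delta_mx 0 i, 0).
    rewrite /frame_map /= !comb_sum addrC big1; last by move=> j _; rewrite mxE scale0r.
    rewrite add0r (bigD1 i) //= big1; last first.
      by move=> j ji; rewrite mxE (negPf ji) scale0r.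
    by rewrite mxE !eqxx scale1r addr0.
  rewrite form_frame /pairing /dot /=.
  by elim/I3P: i; rewrite !mxE /=; ring.
Qed.

End Bilinear.
End Frames.

Section Decompositions.
Variable R : realType.
Local Notation vec := ('rV[R]_3 * 'rV[R]_3)%type.
Implicit Types (c d : brackets3 R) (T : mtriple R).

Section Fixed.
Variable D : metric_algebra R.
Hypothesis lieD : lie_bracket D.
Hypothesis formD : invariant_form D.
Variables (X Xt : 3.-tuple D) (T : mtriple R).
Hypothesis iX : forall i j : 'I_3, form X`_i X`_j = 0.
Hypothesis iXt : forall i j : 'I_3, form Xt`_i Xt`_j = 0.
Hypothesis dual : forall i j : 'I_3, form X`_i Xt`_j = (i == j)%:R.
Hypothesis brX : has_brackets X T.1.
Hypothesis brXt : has_brackets Xt T.2.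
Local Notation F := (frame_map X Xt).

(** Only the brackets inside each factor are given. Invariance of the metric rotates every mixed
    term until the bracketed arguments lie in the same factor. *)
Lemma cartan_frame u v w : form (bracket (F u) (F v)) (F w) = cartan T u v w.
Proof.
rewrite /frame_map; case: u v w => [x xi] [y eta] [z zeta] /=.
have brG p q := bracket_comb lieD p q brX; have brGt p q := bracket_comb lieD p q brXt.
have cyc := form_cyc lieD formD.
have E1 p q r : form (bracket (comb X p) (comb X q)) (comb X r) = 0.
  by rewrite brG form_combX.
have E2 p q r : form (bracket (comb Xt p) (comb Xt q)) (comb Xt r) = 0.
  by rewrite brGt form_combXt.
have E3 p q r : form (bracket (comb X p) (comb X q)) (comb Xt r) =
    dot (bmx T.1 (cross p q)) r by rewrite brG form_comb.
have E4 p q r : form (bracket (comb Xt p) (comb Xt q)) (comb X r) =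
    dot (bmx T.2 (cross p q)) r by rewrite brGt mformC // form_comb // dotC.
rewrite !(bracketDl lieD, bracketDr lieD, mformDl formD, mformDr formD).
rewrite !E1 !E2 !E3 !E4.
rewrite -(cyc (comb X z) (comb X x) (comb Xt eta)) E3.
rewrite (cyc (comb Xt xi) (comb X y) (comb X z)) E3.
rewrite (cyc (comb X x) (comb Xt eta) (comb Xt zeta)) E4.
rewrite -(cyc (comb Xt zeta) (comb Xt xi) (comb X y)) E4.
rewrite /cartan /=; ring.
Qed.

Lemma frame_iso : cancel (frame_inv X Xt) F -> isomorphic (double_of T) D.
Proof.
move=> invK.
have FK : cancel F (frame_inv X Xt) by apply: frame_mapK.
pose G : {linear vec -> D} :=
  HB.pack F (GRing.isLinear.Build R vec D _ F (frame_map_linear X Xt)).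
exists (G : {linear double_of T -> D}); split.
- by exists (frame_inv X Xt).
- move=> u v; apply/eqP; rewrite -subr_eq0; apply/eqP.
  case: (formD) => _ _ _ nd; apply: nd => w.
  rewrite mformDl // mformNl // -(invK w).
  rewrite [X in _ - X]cartan_frame -form_bracketE formE.
  by rewrite [X in X - _]form_frame // subrr.
- by move=> u v; rewrite [LHS]form_frame // formE.
Qed.

Lemma comb_span (Y : 3.-tuple D) (v : D) : v \in <<Y>>%VS -> exists p, v = comb Y p.
Proof.
move=> vY; exists (\row_i coord Y i v); rewrite [LHS](coord_span vY) comb_sum.
by apply: eq_bigr => i _; rewrite mxE.
Qed.

Lemma mem_comb (Y : 3.-tuple D) p : comb Y p \in <<Y>>%VS.
Proof.
rewrite comb_sum; apply: memv_suml => i _; apply: memvZ; apply: memv_span.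
by apply/mem_nth; rewrite size_tuple ltn_ord.
Qed.

Lemma comb_eq0 (Y Yt : 3.-tuple D) p :
  (forall i j : 'I_3, form Y`_i Yt`_j = (i == j)%:R) -> comb Y p = 0 -> p = 0.
Proof.
move=> dY p0; have H q : dot p q = 0.
  rewrite -(form_comb formD dY) p0 mformC //. exact: mform0r.
exact: dot_nondeg.
Qed.

Lemma free_dual (Y Yt : 3.-tuple D) :
  (forall i j : 'I_3, form Y`_i Yt`_j = (i == j)%:R) -> free Y.
Proof.
move=> dY; apply/freeP => k k0 i.
have : comb Y (\row_i k i) = 0.
  by rewrite comb_sum -[RHS]k0; apply: eq_bigr => j _; rewrite mxE.
by move/(comb_eq0 dY)/rowP/(_ i); rewrite !mxE.
Qed.

Lemma dual_sym i j : form Xt`_(i : 'I_3) X`_(j : 'I_3) = (i == j)%:R.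
Proof. by rewrite mformC // dual eq_sym. Qed.

(** Duality makes both tuples free with disjoint spans, so dimension 6 forces the spans to fill [D].
    A vector of an isotropic space containing one span pairs to zero with that span, so its
    component in the other span vanishes: this is maximality. *)
Lemma frame_allows : \dim {:D} = 6%N -> allows_decomposition D T.
Proof.
move=> dim6.
have fX : free X := free_dual dual.
have fXt : free Xt := free_dual dual_sym.
have cap0 : (<<X>> :&: <<Xt>>)%VS = 0%VS.
  apply/eqP; rewrite -subv0; apply/subvP => v; rewrite memv_cap => /andP[vX vXt].
  have [p vp] := comb_span vX; have [q vq] := comb_span vXt.
  rewrite memv0 vp; suff -> : p = 0.
    by rewrite comb_sum big1 // => i _; rewrite mxE scale0r.
  have H r : dot p r = 0 by rewrite -(form_comb formD dual) -vp vq form_combXt.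
  exact: dot_nondeg.
have full : (<<X>> + <<Xt>>)%VS = fullv.
  apply/eqP; rewrite eqEdim subvf /= dimv_disjoint_sum // dim6.
  by move: fX fXt; rewrite /free !size_tuple => /eqP -> /eqP ->.
have dec v : exists p q, v = comb X p + comb Xt q.
  have : v \in (<<X>> + <<Xt>>)%VS by rewrite full memvf.
  case/memv_addP => x /comb_span[p ->] [y /comb_span[q ->] ->]; by exists p, q.
exists <<X>>%VS, <<Xt>>%VS, X, Xt; split=> //; last first.
  by split; rewrite /basis_of eqxx.
split=> //; split.
- by move=> _ _ /comb_span[p ->] /comb_span[q ->]; rewrite (bracket_comb lieD p q brX) mem_comb.
- by move=> _ _ /comb_span[p ->] /comb_span[q ->]; rewrite (bracket_comb lieD p q brXt) mem_comb.
- split; first by move=> _ _ /comb_span[p ->] /comb_span[q ->]; apply: form_combX.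
  move=> G' iso sub; apply/eqP; rewrite eqEsubv sub andbT; apply/subvP => v vG.
  have [p [q vE]] := dec v.
  suff q0 : q = 0 by rewrite vE q0 [comb Xt 0]comb_sum big1 ?addr0 ?mem_comb // => i _;
    rewrite mxE scale0r.
  have H r : dot q r = 0.
    rewrite dotC; have := iso _ _ (subvP sub _ (mem_comb X r)) vG.
    by rewrite vE mformDr // form_combX // add0r form_comb.
  exact: dot_nondeg.
- split; first by move=> _ _ /comb_span[p ->] /comb_span[q ->]; apply: form_combXt.
  move=> G' iso sub; apply/eqP; rewrite eqEsubv sub andbT; apply/subvP => v vG.
  have [p [q vE]] := dec v.
  suff p0 : p = 0 by rewrite vE p0 [comb X 0]comb_sum big1 ?add0r ?mem_comb // => i _;
    rewrite mxE scale0r.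
  have H r : dot p r = 0.
    have := iso _ _ vG (subvP sub _ (mem_comb Xt r)).
    by rewrite vE mformDl // form_combXt // addr0 form_comb.
  exact: dot_nondeg.
Qed.

End Fixed.
End Decompositions.

Section Transport.
Variable R : realType.
Local Notation vec := ('rV[R]_3 * 'rV[R]_3)%type.
Implicit Types (c d : brackets3 R) (T : mtriple R) (D : metric_algebra R).

Lemma lie_iso D D' : isomorphic D D' -> lie_bracket D -> lie_bracket D'.
Proof.
case=> f [[g fK gK] fB fF] lieD.
have brE x y : bracket x y = f (bracket (g x) (g y)) by rewrite fB !gK.
have glin k x y : g (k *: x + y) = k *: g x + g y.
  by apply: (can_inj fK); rewrite linearP !gK.
split.
- by move=> x k y z; rewrite !brE glin (bracketDr lieD) (bracketZr lieD) linearP.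
- by move=> x k y z; rewrite !brE glin (bracketDl lieD) (bracketZl lieD) linearP.
- by move=> x; rewrite brE (bracketxx lieD) linear0.
- move=> x y z; rewrite !brE !fK -!linearD.
  by case: lieD => _ _ _ ->; rewrite linear0.
Qed.

(** Invariance of the form is the antisymmetry of [cartan] in its last two arguments. *)
Lemma double_invariant T : invariant_form (double_of T).
Proof.
split.
- move=> u k v w; rewrite [LHS]formE [in RHS]formE [in RHS]formE.
  by rewrite /pairing /dot /= !mxE; ring.
- by move=> u v; rewrite [LHS]formE [RHS]formE /pairing addrC (dotC u.2) (dotC u.1).
- move=> u v w; rewrite form_bracketE [X in _ + X]formE.
  have -> : pairing u (bracket w v) = cartan T w v u.
    by rewrite -form_bracketE formE /pairing addrC (dotC u.2) (dotC u.1).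
  rewrite /cartan /= (crossC v.1 u.1) (crossC w.1 v.1) (crossC u.1 w.1).
  rewrite (crossC v.2 u.2) (crossC w.2 v.2) (crossC u.2 w.2).
  by rewrite !bmxN !dotNl; ring.
- move=> u H; apply: pairing_nondeg => v; rewrite -(H v).
  by rewrite [RHS]formE.
Qed.

Lemma dim_double T : \dim {:double_of T} = 6%N.
Proof. by rewrite dimvf. Qed.

(** Together with its converse [allows_iso], this turns statements on decompositions into statements
    on isomorphisms from [double_of T]. *)
Lemma iso_allows D T : lie_bracket D -> invariant_form D -> \dim {:D} = 6%N ->
  isomorphic (double_of T) D -> allows_decomposition D T.
Proof.
move=> lieD invD dimD [f [_ fB fF]].
pose e := fun i : 'I_3 => (delta_mx 0 i : 'rV[R]_3).
pose X : 3.-tuple D := [tuple f (e i, 0) | i < 3].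
pose Xt : 3.-tuple D := [tuple f (0, e i) | i < 3].
have XE (i : 'I_3) : X`_i = f (e i, 0) by rewrite -tnth_nth tnth_mktuple.
have XtE (i : 'I_3) : Xt`_i = f (0, e i) by rewrite -tnth_nth tnth_mktuple.
have sumX (p : 'rV[R]_3) : f (p, 0) = \sum_(k < 3) p 0 k *: X`_k.
  rewrite (eq_bigr (fun k => f (p 0 k *: (e k, 0)))); last first.
    by move=> k _; rewrite linearZ XE.
  rewrite -linear_sum; congr (f _); rewrite sum3.
  by congr (_, _); apply: rvP; rewrite /e /= !mxE /=; ring.
have sumXt (p : 'rV[R]_3) : f (0, p) = \sum_(k < 3) p 0 k *: Xt`_k.
  rewrite (eq_bigr (fun k => f (p 0 k *: (0, e k)))); last first.
    by move=> k _; rewrite linearZ XtE.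
  rewrite -linear_sum; congr (f _); rewrite sum3.
  by congr (_, _); apply: rvP; rewrite /e /= !mxE /=; ring.
have brG i j : bracket (f (e i, 0)) (f (e j, 0)) = f (bracket3 T.1 (e i) (e j), 0).
  rewrite -fB double_bracketE bracket3E /=.
  by rewrite !(cross0l, cross0r, bmxT0, bmx0, subr0, addr0).
have brGt i j : bracket (f (0, e i)) (f (0, e j)) = f (0, bracket3 T.2 (e i) (e j)).
  rewrite -fB double_bracketE bracket3E /=.
  by rewrite !(cross0l, cross0r, bmxT0, bmx0, subr0, addr0).
have b3 (c : brackets3 R) : [/\ bracket3 c (e 0) (e 1) = c.1.1,
    bracket3 c (e 1) (e 2) = c.1.2 & bracket3 c (e 2) (e 0) = c.2].
  by split; apply: rvP; rewrite /bracket3 !mxE /=; ring.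
apply: (@frame_allows _ _ lieD invD X Xt T) => //.
- by move=> i j; rewrite !XE fF formE /pairing /dot /= !mxE; ring.
- by move=> i j; rewrite !XtE fF formE /pairing /dot /= !mxE; ring.
- move=> i j; rewrite XE XtE fF formE /pairing /dot /=.
  by elim/I3P: i; elim/I3P: j; rewrite !mxE /=; ring.
- have [b0 b1 b2] := b3 T.1; split.
  + by rewrite (XE 0) (XE 1) brG b0 sumX.
  + by rewrite (XE 1) (XE 2) brG b1 sumX.
  + by rewrite (XE 2) (XE 0) brG b2 sumX.
- have [b0 b1 b2] := b3 T.2; split.
  + by rewrite (XtE 0) (XtE 1) brGt b0 sumXt.
  + by rewrite (XtE 1) (XtE 2) brGt b1 sumXt.
  + by rewrite (XtE 2) (XtE 0) brGt b2 sumXt.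
Qed.

Lemma allows_iso D T : lie_bracket D -> invariant_form D ->
  allows_decomposition D T -> isomorphic (double_of T) D.
Proof.
move=> lieD invD [G [Gt [X [Xt [[full _ _ [[iG _] [iGt _]]] [bX bXt] dual [brX brXt]]]]]].
have iX (i j : 'I_3) : form X`_i X`_j = 0.
  by apply: iG; rewrite -(span_basis bX) memv_span // mem_nth // size_tuple ltn_ord.
have iXt (i j : 'I_3) : form Xt`_i Xt`_j = 0.
  by apply: iGt; rewrite -(span_basis bXt) memv_span // mem_nth // size_tuple ltn_ord.
apply: (@frame_iso _ _ lieD invD X Xt T) => // v.
have : v \in (G + Gt)%VS by rewrite full memvf.
rewrite -(span_basis bX) -(span_basis bXt).
case/memv_addP => x /comb_span[p ->] [y /comb_span[q ->] ->].
rewrite (_ : comb X p + comb Xt q = frame_map X Xt (p, q)) //.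
by rewrite frame_mapK.
Qed.

End Transport.

(** * Dual bases in an abstract Manin triple *)

Section ExistsFrame.
Variable R : realType.
Variable D : metric_algebra R.
Hypothesis formD : invariant_form D.

Lemma form_suml (I : Type) (r : seq I) (F : I -> D) y :
  form (\sum_(i <- r) F i) y = \sum_(i <- r) form (F i) y.
Proof.
elim: r => [|i r IH]; first by rewrite !big_nil mformC // mform0r.
by rewrite !big_cons mformDl // IH.
Qed.

(** A left kernel vector of the Gram matrix gives an element of [G] orthogonal to [Gt]; being
    orthogonal to [G] as well, it is zero. *)
Lemma gram_free (G Gt : {vspace D}) n m (X : n.-tuple D) (Y : m.-tuple D) :
  (G + Gt)%VS = fullv -> isotropic G -> basis_of G X -> basis_of Gt Y ->
  row_free (\matrix_(i < n, j < m) form X`_i Y`_j).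
Proof.
move=> full iG bX bY; set M := \matrix_(_, _) _.
apply/row_freeP; suff : kermx M = 0.
  move=> k0; apply/row_freeP; rewrite -kermx_eq0 k0 //.
apply/row_matrixP => k; rewrite row0; set u := row k _.
have uM : u *m M = 0 by rewrite -row_mul mulmx_ker row0.
pose x := \sum_(i < n) u 0 i *: X`_i.
have XG i : (i < n)%N -> X`_i \in G.
  by move=> ltin; rewrite -(span_basis bX) memv_span // mem_nth // size_tuple.
have xG : x \in G by apply: memv_suml => i _; apply: memvZ; apply: XG.
have xY (j : 'I_m) : form x Y`_j = 0.
  have := congr1 (fun A : 'rV_m => A 0 j) uM; rewrite !mxE => <-.
  by rewrite /x form_suml; apply: eq_bigr => i _; rewrite mformZl // !mxE.
have x0 : x = 0.
  case: (formD) => _ _ _ nd; apply: nd => y.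
  have : y \in (G + Gt)%VS by rewrite full memvf.
  case/memv_addP => y1 y1G [y2 y2G ->]; rewrite mformDr // (iG _ _ xG y1G) add0r.
  rewrite (coord_basis bY y2G) mformC // form_suml big1 // => j _.
  by rewrite mformZl // mformC // xY mulr0.
apply/rowP => i; rewrite [RHS]mxE; have /freeP H := basis_free bX.
exact: (H (fun i => u 0 i) x0 i).
Qed.

Lemma manin_dim (G Gt : {vspace D}) :
  (G + Gt)%VS = fullv -> isotropic G -> (\dim G <= \dim Gt)%N.
Proof.
move=> full iG; have := gram_free full iG (vbasisP G) (vbasisP Gt).
by rewrite /row_free => /eqP {1}<-; apply: rank_leq_col.
Qed.

Lemma exists_decomposition (G Gt : {vspace D}) : \dim {:D} = 6%N ->
  manin_triple G Gt -> exists T, allows_decomposition D T.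
Proof.
move=> dimD [full cap [sG sGt] [[iG mG] [iGt mGt]]].
have dGGt : \dim G = \dim Gt.
  by apply/eqP; rewrite eqn_leq !manin_dim // addvC.
have dG : \dim G = 3%N.
  apply: double_inj; rewrite -[RHS]/6%N -addnn {2}dGGt -dimD -full.
  by rewrite dimv_disjoint_sum.
have tup (H : {vspace D}) : \dim H = 3%N -> exists X : 3.-tuple D, basis_of H X.
  by move=> <-; exists (vbasis H); apply: vbasisP.
have [X bX] := tup _ dG; have [Y bY] := tup Gt (etrans (esym dGGt) dG).
have Mfree := gram_free full iG bX bY; set M := \matrix_(_, _) _ in Mfree.
have Munit : M \in unitmx by rewrite -row_free_unit.
(* The inverse Gram matrix turns an arbitrary basis of [Gt] into the basis dual to [X]. *)
pose Xt : 3.-tuple D := [tuple \sum_(k < 3) invmx M k j *: Y`_k | j < 3].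
have XtE (j : 'I_3) : Xt`_j = \sum_(k < 3) invmx M k j *: Y`_k.
  by rewrite -tnth_nth tnth_mktuple.
have dual (i j : 'I_3) : form X`_i Xt`_j = (i == j)%:R.
  rewrite XtE mformC // form_suml.
  have := congr1 (fun A : 'M_3 => A i j) (mulmxV Munit); rewrite !mxE => <-.
  by apply: eq_bigr => k _; rewrite mformZl // mformC // mulrC !mxE.
have XtGt (j : 'I_3) : Xt`_j \in Gt.
  rewrite XtE; apply: memv_suml => k _; apply: memvZ.
  by rewrite -(span_basis bY) memv_span // mem_nth // size_tuple ltn_ord.
have dual' (i j : 'I_3) : form Xt`_i X`_j = (i == j)%:R.
  by rewrite mformC // dual eq_sym.
have bXt : basis_of Gt Xt.
  rewrite basisEfree (free_dual formD dual') size_tuple -dGGt dG leqnn andbT /=.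
  apply/span_subvP => v /(nthP 0)[j]; rewrite size_tuple card_ord => lt3 <-.
  by rewrite (XtGt (Ordinal lt3)).
have XG (j : 'I_3) : X`_j \in G.
  by rewrite -(span_basis bX) memv_span // mem_nth // size_tuple ltn_ord.
have coords (Z : 3.-tuple D) v : v \in <<Z>>%VS ->
    exists p : 'rV[R]_3, v = \sum_(k < 3) p 0 k *: Z`_k.
  by case/comb_span => p ->; exists p; rewrite comb_sum.
have cX v : v \in G -> exists p : 'rV[R]_3, v = \sum_(k < 3) p 0 k *: X`_k.
  by rewrite -(span_basis bX); apply: coords.
have cXt v : v \in Gt -> exists p : 'rV[R]_3, v = \sum_(k < 3) p 0 k *: Xt`_k.
  by rewrite -(span_basis bXt); apply: coords.
have [p1 E1] := cX _ (sG _ _ (XG 0) (XG 1)).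
have [p2 E2] := cX _ (sG _ _ (XG 1) (XG 2)).
have [p3 E3] := cX _ (sG _ _ (XG 2) (XG 0)).
have [q1 F1] := cXt _ (sGt _ _ (XtGt 0) (XtGt 1)).
have [q2 F2] := cXt _ (sGt _ _ (XtGt 1) (XtGt 2)).
have [q3 F3] := cXt _ (sGt _ _ (XtGt 2) (XtGt 0)).
by exists ((p1, p2, p3), (q1, q2, q3)), G, Gt, X, Xt; split.
Qed.

End ExistsFrame.

(** * The bialgebra equations *)

Section Bialgebra.
Variable R : realType.
Local Notation vec := ('rV[R]_3 * 'rV[R]_3)%type.
Implicit Types (S T : 'M[R]_3) (a b : 'rV[R]_3).

Lemma lie_double (t : mtriple R) :
  (forall u v w : double_of t, bracket u (bracket v w) + bracket v (bracket w u)
          + bracket w (bracket u v) = 0) -> lie_bracket (double_of t).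
Proof.
have AC (k : R) (A B C E F H : 'rV[R]_3) :
  k *: A + B + (k *: C + E) - (k *: F + H) = k *: (A + C - F) + (B + E - H).
  by apply: rvP; rewrite !mxE; ring.
move=> jac; split=> //.
- move=> [x xi] k [y eta] [z zeta]; rewrite !double_bracketE.
  congr (_, _); rewrite /= !(crossPl, crossPr, bmxTP, bmxP, crossPl, crossPr) AC //.
- move=> [x xi] k [y eta] [z zeta]; rewrite !double_bracketE.
  congr (_, _); rewrite /= !(crossPl, crossPr, bmxTP, bmxP, crossPl, crossPr) AC //.
- move=> [x xi]; rewrite double_bracketE.
  by congr (_, _); rewrite /= !crossxx bmx0 add0r subrr.
Qed.

End Bialgebra.

Section BialgebraEquations.
Variable R : realType.
Local Notation vec := ('rV[R]_3 * 'rV[R]_3)%type.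
Implicit Types (S T : 'M[R]_3) (a b x y z : 'rV[R]_3).

Lemma bmxT_brackets_of S a x : S^T = S -> bmxT (brackets_of S a) x = x *m S + cross x a.
Proof.
move=> Ss; apply: rvP; rewrite /bmxT /dot /cross !(mxE, rvE) !sum3 !(sym3E Ss); ring.
Qed.

(* The Jacobi identities of the double, in terms of the symmetric and vector parts. *)
Definition bialgebra S a T b : Prop :=
  [/\ a *m S = 0, b *m T = 0 & S *m T = (dot a b)%:M - b^T *m a].

Lemma bmx_rv S a p1 p2 p3 : S^T = S -> bmx (brackets_of S a) (rv p1 p2 p3) =
  rv (p1 * S 0 0 + p2 * (S 0 1 - a 0 2) + p3 * (S 0 2 + a 0 1))
     (p1 * (S 0 1 + a 0 2) + p2 * S 1 1 + p3 * (S 1 2 - a 0 0))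
     (p1 * (S 0 2 - a 0 1) + p2 * (S 1 2 + a 0 0) + p3 * S 2 2).
Proof.
move=> Ss; rewrite bmx_brackets_of; apply: rvP;
by rewrite rvE mxE rowE3 /cross !rvE ?(sym3E Ss); ring.
Qed.
Lemma bmxT_rv S a p1 p2 p3 : S^T = S -> bmxT (brackets_of S a) (rv p1 p2 p3) =
  rv (p1 * S 0 0 + p2 * (S 0 1 + a 0 2) + p3 * (S 0 2 - a 0 1))
     (p1 * (S 0 1 - a 0 2) + p2 * S 1 1 + p3 * (S 1 2 + a 0 0))
     (p1 * (S 0 2 + a 0 1) + p2 * (S 1 2 - a 0 0) + p3 * S 2 2).
Proof.
move=> Ss; rewrite bmxT_brackets_of //; apply: rvP;
by rewrite rvE mxE rowE3 /cross !rvE ?(sym3E Ss); ring.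
Qed.

(** On e_1, e_2, e_3 the Jacobi sum is [bmx] applied to the sum of the e_i x [bmx] e_i. The
    symmetric part contributes nothing to that sum and the vector part contributes 2a, whose image
    under [bmx] is 2aS. *)
Lemma jacobi_G S a T b : S^T = S -> lie_bracket (double_of (triple_of S a T b)) -> a *m S = 0.
Proof.
move=> Ss [_ _ _ jac].
have J x y z : bmx (brackets_of S a) (cross x (bmx (brackets_of S a) (cross y z))) +
   bmx (brackets_of S a) (cross y (bmx (brackets_of S a) (cross z x))) +
   bmx (brackets_of S a) (cross z (bmx (brackets_of S a) (cross x y))) = 0.
  have := congr1 fst (jac (x, 0) (y, 0) (z, 0)); rewrite !double_bracketE /=.
  by rewrite !(cross0l, cross0r, bmxT0, bmx0, subr0, addr0).
have := J (rv 1 0 0) (rv 0 1 0) (rv 0 0 1).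
rewrite !(cross_rv, bmx_rv _ _ _ _ Ss, add_rv) zero_rv => /rv_inj[E0 E1 E2].
by apply: rvP; rewrite rowE3 !rvE ?(sym3E Ss); [clear -E0|clear -E1|clear -E2]; lra.
Qed.

(** The first component of the Jacobi identity for two vectors of G and one of the dual. Below,
    [Qij] says that the off-diagonal entry (i, j) of S T + b^T a vanishes, and [Di] concerns its
    i-th diagonal entry. *)
Lemma jacobi_mixed S a T b : S^T = S -> T^T = T ->
  lie_bracket (double_of (triple_of S a T b)) -> S *m T = (dot a b)%:M - b^T *m a.
Proof.
move=> Ss Ts [_ _ _ jac].
have J x y z : bmx (brackets_of S a) (cross x (cross (bmxT (brackets_of T b) y) z)) +
    cross (bmxT (brackets_of T b) x) (cross y (bmxT (brackets_of S a) z)) -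
    bmx (brackets_of S a) (cross y (cross (bmxT (brackets_of T b) x) z)) -
    cross (bmxT (brackets_of T b) y) (cross x (bmxT (brackets_of S a) z)) -
    cross (bmxT (brackets_of T b) (bmx (brackets_of S a) (cross x y))) z = 0.
  have := congr1 fst (jac (x, 0) (y, 0) (0, z)); rewrite !double_bracketE /=.
  rewrite !(cross0l, cross0r, bmxT0, bmx0, subr0, addr0, sub0r, add0r).
  have cN (u v : 'rV[R]_3) : cross u (- v) = - cross u v.
    by apply: rvP; rewrite /cross !(mxE, rvE); ring.
  by rewrite !(bmxN, cN) opprD !addrA.
pose s := (cross_rv, bmx_rv _ _ _ _ Ss, bmxT_rv _ _ _ _ Ss, bmxT_rv _ _ _ _ Ts, add_rv, opp_rv).
have := J (rv 1 0 0) (rv 0 1 0) (rv 0 0 1).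
rewrite !s zero_rv => /rv_inj[Q21 Q20 _].
have {}Q21 : S 0 2 * T 0 1 + S 1 2 * T 1 1 + S 2 2 * T 1 2 + b 0 2 * a 0 1 = 0 by clear -Q21; lra.
have {}Q20 : S 0 2 * T 0 0 + S 1 2 * T 0 1 + S 2 2 * T 0 2 + b 0 2 * a 0 0 = 0 by clear -Q20; lra.
have := J (rv 0 1 0) (rv 0 0 1) (rv 1 0 0).
rewrite !s zero_rv => /rv_inj[_ Q02 Q01].
have {}Q02 : S 0 0 * T 0 2 + S 0 1 * T 1 2 + S 0 2 * T 2 2 + b 0 0 * a 0 2 = 0 by clear -Q02; lra.
have {}Q01 : S 0 0 * T 0 1 + S 0 1 * T 1 1 + S 0 2 * T 1 2 + b 0 0 * a 0 1 = 0 by clear -Q01; lra.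
have := J (rv 0 0 1) (rv 1 0 0) (rv 0 1 0).
rewrite !s zero_rv => /rv_inj[Q12 _ Q10].
have {}Q12 : S 0 1 * T 0 2 + S 1 1 * T 1 2 + S 1 2 * T 2 2 + b 0 1 * a 0 2 = 0 by clear -Q12; lra.
have {}Q10 : S 0 1 * T 0 0 + S 1 1 * T 0 1 + S 1 2 * T 0 2 + b 0 1 * a 0 0 = 0 by clear -Q10; lra.
have := J (rv 0 1 0) (rv 0 0 1) (rv 0 1 0).
rewrite !s zero_rv => /rv_inj[_ _ D0].
have {}D0 : 2 * (S 0 0 * T 0 0 + S 0 1 * T 0 1 + S 0 2 * T 0 2 + b 0 0 * a 0 0) =
  S 0 0 * T 0 0 + S 1 1 * T 1 1 + S 2 2 * T 2 2 + 2 * (S 0 1 * T 0 1 + S 0 2 * T 0 2 +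
    S 1 2 * T 1 2).
  by clear -D0; lra.
have := J (rv 0 0 1) (rv 1 0 0) (rv 1 0 0).
rewrite !s zero_rv => /rv_inj[_ _ D1].
have {}D1 : 2 * (S 0 1 * T 0 1 + S 1 1 * T 1 1 + S 1 2 * T 1 2 + b 0 1 * a 0 1) =
  S 0 0 * T 0 0 + S 1 1 * T 1 1 + S 2 2 * T 2 2 + 2 * (S 0 1 * T 0 1 + S 0 2 * T 0 2 +
    S 1 2 * T 1 2).
  by clear -D1; lra.
have := J (rv 1 0 0) (rv 0 1 0) (rv 1 0 0).
rewrite !s zero_rv => /rv_inj[_ D2 _].
have {}D2 : 2 * (S 0 2 * T 0 2 + S 1 2 * T 1 2 + S 2 2 * T 2 2 + b 0 2 * a 0 2) =
  S 0 0 * T 0 0 + S 1 1 * T 1 1 + S 2 2 * T 2 2 + 2 * (S 0 1 * T 0 1 + S 0 2 * T 0 2 +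
    S 1 2 * T 1 2).
  by clear -D2; lra.
(* Each diagonal equation equates twice a diagonal entry of S T + b^T a with tr (S T). Their sum
   reads 2 (tr (S T) + a.b) = 3 tr (S T), whence tr (S T) = 2 a.b. *)
have tr2 : S 0 0 * T 0 0 + S 1 1 * T 1 1 + S 2 2 * T 2 2 + 2 * (S 0 1 * T 0 1 + S 0 2 * T 0 2 +
  S 1 2 * T 1 2) = 2 * dot a b by rewrite /dot; clear -D0 D1 D2; lra.
rewrite tr2 in D0 D1 D2; rewrite /dot in D0 D1 D2.
apply/matrixP => i j; rewrite !mxE sum3 big_ord1 !mxE /dot.
by elim/I3P: i; elim/I3P: j; rewrite ?(sym3E Ss, sym3E Ts) /=;
  [clear -D0|clear -Q01|clear -Q02|clear -Q10|clear -D1|clear -Q12|clear -Q20|clear -Q21|clear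
    -D2]; lra.
Qed.

Lemma bialgebra_of_lie S a T b : S^T = S -> T^T = T ->
  lie_bracket (double_of (triple_of S a T b)) -> bialgebra S a T b.
Proof.
move=> Ss Ts lie; split; [exact: jacobi_G lie| |exact: jacobi_mixed lie].
have lie' := lie_iso (isomorphic_sym (dual_iso (triple_of S a T b))) lie.
rewrite [dual_mtriple _]/(triple_of T b S a) in lie'.
exact: jacobi_G lie'.
Qed.

End BialgebraEquations.

Section Matrices.
Variable R : realType.
Implicit Types (S T P Q : 'M[R]_3).

Definition mx3 (p q r p' q' r' p'' q'' r'' : R) : 'M[R]_3 :=
  locked (\matrix_(i, j) [:: rv p q r; rv p' q' r'; rv p'' q'' r'']`_i 0 j).

Lemma mx3E p q r p' q' r' p'' q'' r'' :
  let M := mx3 p q r p' q' r' p'' q'' r'' in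
  ((M 0 0 = p) * (M 0 1 = q) * (M 0 2 = r) * (M 1 0 = p') * (M 1 1 = q') * (M 1 2 = r')
   * (M 2 0 = p'') * (M 2 1 = q'') * (M 2 2 = r''))%type.
Proof. by rewrite /= /mx3 -lock; do !split; rewrite mxE /= rvE. Qed.

Lemma mx3P S T : S 0 0 = T 0 0 -> S 0 1 = T 0 1 -> S 0 2 = T 0 2 ->
  S 1 0 = T 1 0 -> S 1 1 = T 1 1 -> S 1 2 = T 1 2 ->
  S 2 0 = T 2 0 -> S 2 1 = T 2 1 -> S 2 2 = T 2 2 -> S = T.
Proof. by move=> *; apply/matrixP; apply: I3P; apply: I3P. Qed.

Lemma mx3_eta S : S = mx3 (S 0 0) (S 0 1) (S 0 2) (S 1 0) (S 1 1) (S 1 2) (S 2 0) (S 2 1) (S 2 2).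
Proof. by apply: mx3P; rewrite mx3E. Qed.

Lemma mul_mx3 a1 a2 a3 a4 a5 a6 a7 a8 a9 b1 b2 b3 b4 b5 b6 b7 b8 b9 :
  mx3 a1 a2 a3 a4 a5 a6 a7 a8 a9 *m mx3 b1 b2 b3 b4 b5 b6 b7 b8 b9 =
  mx3 (a1 * b1 + a2 * b4 + a3 * b7) (a1 * b2 + a2 * b5 + a3 * b8) (a1 * b3 + a2 * b6 + a3 * b9)
      (a4 * b1 + a5 * b4 + a6 * b7) (a4 * b2 + a5 * b5 + a6 * b8) (a4 * b3 + a5 * b6 + a6 * b9)
      (a7 * b1 + a8 * b4 + a9 * b7) (a7 * b2 + a8 * b5 + a9 * b8) (a7 * b3 + a8 * b6 + a9 * b9).
Proof. by apply: mx3P; rewrite mxE sum3 !mx3E. Qed.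

Lemma tr_mx3 a1 a2 a3 a4 a5 a6 a7 a8 a9 :
  (mx3 a1 a2 a3 a4 a5 a6 a7 a8 a9)^T = mx3 a1 a4 a7 a2 a5 a8 a3 a6 a9.
Proof. by apply: mx3P; rewrite mxE !mx3E. Qed.

Lemma scale_mx3 k a1 a2 a3 a4 a5 a6 a7 a8 a9 :
  k *: mx3 a1 a2 a3 a4 a5 a6 a7 a8 a9 =
  mx3 (k * a1) (k * a2) (k * a3) (k * a4) (k * a5) (k * a6) (k * a7) (k * a8) (k * a9).
Proof. by apply: mx3P; rewrite mxE !mx3E. Qed.

Lemma add_mx3 a1 a2 a3 a4 a5 a6 a7 a8 a9 b1 b2 b3 b4 b5 b6 b7 b8 b9 :
  mx3 a1 a2 a3 a4 a5 a6 a7 a8 a9 + mx3 b1 b2 b3 b4 b5 b6 b7 b8 b9 =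
  mx3 (a1 + b1) (a2 + b2) (a3 + b3) (a4 + b4) (a5 + b5) (a6 + b6) (a7 + b7) (a8 + b8) (a9 + b9).
Proof. by apply: mx3P; rewrite mxE !mx3E. Qed.

Lemma opp_mx3 a1 a2 a3 a4 a5 a6 a7 a8 a9 :
  - mx3 a1 a2 a3 a4 a5 a6 a7 a8 a9 =
  mx3 (- a1) (- a2) (- a3) (- a4) (- a5) (- a6) (- a7) (- a8) (- a9).
Proof. by apply: mx3P; rewrite mxE !mx3E. Qed.

Lemma scalar_mx3 (k : R) : k%:M = mx3 k 0 0 0 k 0 0 0 k.
Proof. by apply: mx3P; rewrite mxE !mx3E. Qed.

Lemma zero_mx3 : 0 = mx3 0 0 0 0 0 0 0 0 0.
Proof. by apply: mx3P; rewrite mxE !mx3E. Qed.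

Lemma rv_mx3 x1 x2 x3 b1 b2 b3 b4 b5 b6 b7 b8 b9 :
  rv x1 x2 x3 *m mx3 b1 b2 b3 b4 b5 b6 b7 b8 b9 =
  rv (x1 * b1 + x2 * b4 + x3 * b7) (x1 * b2 + x2 * b5 + x3 * b8) (x1 * b3 + x2 * b6 + x3 * b9).
Proof. by apply: rvP; rewrite rowE3 !(mx3E, rvE). Qed.

Lemma rank1_rv x1 x2 x3 y1 y2 y3 : (rv x1 x2 x3)^T *m rv y1 y2 y3 =
  mx3 (x1 * y1) (x1 * y2) (x1 * y3) (x2 * y1) (x2 * y2) (x2 * y3) (x3 * y1) (x3 * y2) (x3 * y3).
Proof. by apply: mx3P; rewrite mxE big_ord1 mxE !(mx3E, rvE). Qed.

Lemma dot_rv x1 x2 x3 y1 y2 y3 : dot (rv x1 x2 x3) (rv y1 y2 y3) =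
  x1 * y1 + x2 * y2 + x3 * y3 :> R.
Proof. by rewrite /dot !rvE. Qed.

Lemma det_mx3 a1 a2 a3 a4 a5 a6 a7 a8 a9 : det3 (mx3 a1 a2 a3 a4 a5 a6 a7 a8 a9) =
  (a2 * a6 - a3 * a5) * a7 + (a3 * a4 - a1 * a6) * a8 + (a1 * a5 - a2 * a4) * a9.
Proof. by rewrite /det3 /dot /cross !rvE ![row _ _ _ _]mxE !mx3E. Qed.

Definition mx3s := (mul_mx3, tr_mx3, scale_mx3, add_mx3, opp_mx3, rv_mx3, rank1_rv,
  dot_rv, det_mx3, scale_rv, add_rv, opp_rv).

Definition symmx p q r s t u := mx3 p q r q s t r t u.

Lemma symmx_tr p q r s t u : (symmx p q r s t u)^T = symmx p q r s t u.
Proof. by rewrite /symmx tr_mx3. Qed.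

Lemma brackets_of_symmx p q r s t u a1 a2 a3 :
  brackets_of (symmx p q r s t u) (rv a1 a2 a3) =
  (rv (r + a2) (t - a1) u, rv p (q + a3) (r - a2), rv (q - a3) s (t + a1)).
Proof.
rewrite /brackets_of; congr (_, _, _); apply: rvP; rewrite !(mxE, rvE) /symmx !mx3E ?addr0 //.
Qed.

Definition eqv (t t' : mtriple R) := isomorphic (double_of t) (double_of t').

Lemma eqv_refl t : eqv t t. Proof. exact: isomorphic_refl. Qed.
Lemma eqv_sym t t' : eqv t t' -> eqv t' t. Proof. exact: isomorphic_sym. Qed.
Lemma eqv_trans t2 t1 t3 : eqv t1 t2 -> eqv t2 t3 -> eqv t1 t3.
Proof. exact: isomorphic_trans. Qed.
Lemma eqv_dual t : eqv (dual_mtriple t) t. Proof. exact: dual_iso. Qed.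
Lemma eqv_dual2 t t' : eqv (dual_mtriple t) (dual_mtriple t') -> eqv t t'.
Proof.
move=> H; apply: eqv_trans (eqv_dual t'); apply: eqv_trans H.
exact: eqv_sym (eqv_dual t).
Qed.

Lemma eqv_GL P Q S a T b S' a' T' b' : Q *m P^T = 1%:M ->
  S' = det3 P *: (Q *m S *m Q^T) -> a' = a *m P^T ->
  T' = det3 Q *: (P *m T *m P^T) -> b' = b *m Q^T ->
  eqv (triple_of S a T b) (triple_of S' a' T' b').
Proof. by move=> QP -> -> -> ->; apply: eqv_sym; apply: GL_iso. Qed.

Lemma eqv_twist r S a T b T' b' : S^T = S -> T^T = T ->
  dot (r *m S) r + 2 * dot b r = 0 ->
  T' = T - (a^T *m r + r^T *m a) -> b' = b + r *m S ->
  eqv (triple_of S a T b) (triple_of S a T' b').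
Proof. by move=> Ss Ts cl -> ->; apply: eqv_sym; apply: twist_iso. Qed.

Definition diag s1 s2 s3 a1 a2 a3 t1 t2 t3 b1 b2 b3 : mtriple R :=
  triple_of (symmx s1 0 0 s2 0 s3) (rv a1 a2 a3) (symmx t1 0 0 t2 0 t3) (rv b1 b2 b3).

Lemma diag_scale l1 l2 l3 s1 s2 s3 a1 a2 a3 t1 t2 t3 b1 b2 b3 :
  l1 != 0 -> l2 != 0 -> l3 != 0 ->
  eqv (diag s1 s2 s3 a1 a2 a3 t1 t2 t3 b1 b2 b3)
      (diag (l2 * l3 / l1 * s1) (l1 * l3 / l2 * s2) (l1 * l2 / l3 * s3)
          (l1 * a1) (l2 * a2) (l3 * a3)
          (l1 / (l2 * l3) * t1) (l2 / (l1 * l3) * t2) (l3 / (l1 * l2) * t3)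
          (b1 / l1) (b2 / l2) (b3 / l3)).
Proof.
move=> n1 n2 n3; apply: (@eqv_GL (mx3 l1 0 0 0 l2 0 0 0 l3)
  (mx3 l1^-1 0 0 0 l2^-1 0 0 0 l3^-1)); rewrite /symmx !mx3s ?scalar_mx3.
- by congr mx3; field.
- by congr mx3; field; rewrite ?n1 ?n2 ?n3.
- by congr rv; ring.
- by congr mx3; field; rewrite ?n1 ?n2 ?n3.
- by congr rv; ring.
Qed.

Lemma diag_cyc s1 s2 s3 a1 a2 a3 t1 t2 t3 b1 b2 b3 :
  eqv (diag s1 s2 s3 a1 a2 a3 t1 t2 t3 b1 b2 b3)
      (diag s2 s3 s1 a2 a3 a1 t2 t3 t1 b2 b3 b1).
Proof.
apply: (@eqv_GL (mx3 0 1 0 0 0 1 1 0 0) (mx3 0 1 0 0 0 1 1 0 0));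
  rewrite /symmx !mx3s ?scalar_mx3;
 by congr (mx3 _ _ _ _ _ _ _ _ _) || congr (rv _ _ _); ring.
Qed.

Lemma diag_swap s1 s2 s3 a1 a2 a3 t1 t2 t3 b1 b2 b3 :
  eqv (diag s1 s2 s3 a1 a2 a3 t1 t2 t3 b1 b2 b3)
      (diag s1 s3 s2 (- a1) a3 a2 t1 t3 t2 (- b1) b3 b2).
Proof.
(* The first axis is reversed to make the swap a rotation; with determinant 1, the symmetric parts
   keep their signs. *)
apply: (@eqv_GL (mx3 (-1) 0 0 0 0 1 0 1 0) (mx3 (-1) 0 0 0 0 1 0 1 0));
  rewrite /symmx !mx3s ?scalar_mx3;
 by congr (mx3 _ _ _ _ _ _ _ _ _) || congr (rv _ _ _); ring.
Qed.

End Matrices.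

(** * Isomorphisms within the classes *)

Section Tables.
Variable R : realType.
Implicit Types (a b : R).

Ltac table :=
  rewrite /diag /triple_of !brackets_of_symmx; congr (_, _); congr (_, _, _); apply: rvP;
  rewrite !(mxE, rvE) /=.

(** This and the following equations translate the tables into symmetric and vector parts. Both
    symmetric parts are diagonal except in [mt6_6ii], [mt6_6iii], [mt3_3ii] and [mt3_3iii]. *)
Lemma mt9_1E : mt9_1 R = diag 1 1 1 0 0 0 0 0 0 0 0 0. Proof. by table; ring. Qed.
Lemma mt9_5E b : mt9_5 b = diag 1 1 1 0 0 0 0 0 0 b 0 0. Proof. by table; ring. Qed.
Lemma mt8_1E : mt8_1 R = diag 1 1 (-1) 0 0 0 0 0 0 0 0 0. Proof. by table; ring. Qed.
Lemma mt8_5iE b : mt8_5i b = diag 1 1 (-1) 0 0 0 0 0 0 b 0 0. Proof. by table; ring. Qed.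
Lemma mt8_5iiE b : mt8_5ii b = diag 1 1 (-1) 0 0 0 0 0 0 0 0 b. Proof. by table; ring. Qed.
Lemma mt8_5iiiE : mt8_5iii R = diag 1 1 (-1) 0 0 0 0 0 0 (-1) 0 1.
Proof. by table; ring. Qed.
Lemma mt7_1E a : mt7_1 a = diag 0 1 1 a 0 0 0 0 0 0 0 0. Proof. by table; ring. Qed.
Lemma mt7_2iE a : mt7_2i a = diag 0 1 1 a 0 0 1 0 0 0 0 0. Proof. by table; ring. Qed.
Lemma mt7_2iiE a : mt7_2ii a = diag 0 1 1 a 0 0 (-1) 0 0 0 0 0. Proof. by table; ring. Qed.
Lemma mt7_7E a b : mt7_7 a b = diag 0 1 1 a 0 0 0 b b (b / a) 0 0. Proof. by table; ring. Qed.
Lemma mt70_1E : mt70_1 R = diag 1 1 0 0 0 0 0 0 0 0 0 0. Proof. by table; ring. Qed.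
Lemma mt70_2iE : mt70_2i R = diag 1 1 0 0 0 0 0 0 1 0 0 0. Proof. by table; ring. Qed.
Lemma mt70_2iiE : mt70_2ii R = diag 1 1 0 0 0 0 0 0 (-1) 0 0 0. Proof. by table; ring. Qed.
Lemma mt70_4E b : mt70_4 b = diag 1 1 0 0 0 0 0 0 b b 0 0. Proof. by table; ring. Qed.
Lemma mt70_5iE : mt70_5i R = diag 1 1 0 0 0 0 0 0 0 1 0 0. Proof. by table; ring. Qed.
Lemma mt70_5iiE b : mt70_5ii b = diag 1 1 0 0 0 0 0 0 0 0 0 b. Proof. by table; ring. Qed.
Lemma mt6_1E a : mt6_1 a = diag 0 1 (-1) a 0 0 0 0 0 0 0 0. Proof. by table; ring. Qed.
Lemma mt6_2E a : mt6_2 a = diag 0 1 (-1) a 0 0 1 0 0 0 0 0. Proof. by table; ring. Qed.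
Lemma mt6_6iE a b : mt6_6i a b = diag 0 1 (-1) a 0 0 0 b (- b) (b / a) 0 0.
Proof. by table; ring. Qed.
Lemma mt6_6iiE a : a - 1 != 0 -> mt6_6ii a =
  triple_of (symmx 0 0 0 1 0 (-1)) (rv a 0 0)
      (symmx 0 (a / (a - 1)) (a / (a - 1)) 0 0 0) (rv 0 (- (a - 1)^-1) (a - 1)^-1).
Proof. by move=> a1; table; field. Qed.
Lemma mt6_6iiiE a : a + 1 != 0 -> mt6_6iii a =
  triple_of (symmx 0 0 0 1 0 (-1)) (rv a 0 0)
      (symmx 0 (- (a / (a + 1))) (a / (a + 1)) 0 0 0) (rv 0 (a + 1)^-1 (a + 1)^-1).
Proof. by move=> a1; table; field. Qed.
Lemma mt60_1E : mt60_1 R = diag 1 (-1) 0 0 0 0 0 0 0 0 0 0. Proof. by table; ring. Qed.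
Lemma mt60_2E : mt60_2 R = diag 1 (-1) 0 0 0 0 0 0 1 0 0 0. Proof. by table; ring. Qed.
Lemma mt60_4iE b : mt60_4i b = diag 1 (-1) 0 0 0 0 0 0 b b 0 0. Proof. by table; ring. Qed.
Lemma mt60_4iiE : mt60_4ii R = diag 1 (-1) 0 0 0 0 0 0 1 (-1) (-1) 0.
Proof. by table; ring. Qed.
Lemma mt60_5iE : mt60_5i R = diag 1 (-1) 0 0 0 0 0 0 0 1 0 0. Proof. by table; ring. Qed.
Lemma mt60_5iiE : mt60_5ii R = diag 1 (-1) 0 0 0 0 0 0 0 (-1) (-1) 0.
Proof. by table; ring. Qed.
Lemma mt60_5iiiE b : mt60_5iii b = diag 1 (-1) 0 0 0 0 0 0 0 0 0 (- b).
Proof. by table; ring. Qed.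
Lemma mt5_1E : mt5_1 R = diag 0 0 0 1 0 0 0 0 0 0 0 0. Proof. by table; ring. Qed.
Lemma mt5_2iE : mt5_2i R = diag 0 0 0 1 0 0 1 0 0 0 0 0. Proof. by table; ring. Qed.
Lemma mt5_2iiE : mt5_2ii R = diag 0 0 0 1 0 0 0 0 1 0 0 0. Proof. by table; ring. Qed.
Lemma mt4_1E : mt4_1 R = diag 0 0 1 1 0 0 0 0 0 0 0 0. Proof. by table; ring. Qed.
Lemma mt4_2iE : mt4_2i R = diag 0 0 1 1 0 0 1 0 0 0 0 0. Proof. by table; ring. Qed.
Lemma mt4_2iiE : mt4_2ii R = diag 0 0 1 1 0 0 (-1) 0 0 0 0 0. Proof. by table; ring. Qed.
Lemma mt4_2iiiE b : mt4_2iii b = diag 0 0 1 1 0 0 0 b 0 0 0 0. Proof. by table; ring. Qed.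
Lemma mt3_1E : mt3_1 R = diag 0 1 (-1) 1 0 0 0 0 0 0 0 0. Proof. by table; ring. Qed.
Lemma mt3_2E : mt3_2 R = diag 0 1 (-1) 1 0 0 1 0 0 0 0 0. Proof. by table; ring. Qed.
Lemma mt3_3iE b : mt3_3i b = diag 0 1 (-1) 1 0 0 0 b (- b) b 0 0. Proof. by table; ring. Qed.
Lemma mt3_3iiE : mt3_3ii R =
  triple_of (symmx 0 0 0 1 0 (-1)) (rv 1 0 0) (symmx 0 2^-1 2^-1 0 0 0) (rv 0 (- 2^-1) 2^-1).
Proof. by table; field. Qed.
Lemma mt3_3iiiE : mt3_3iii R =
  triple_of (symmx 0 0 0 1 0 (-1)) (rv 1 0 0) (symmx 0 (- 2^-1) 2^-1 0 0 0) (rv 0 2^-1 2^-1).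
Proof. by table; field. Qed.
Lemma mt2_1E : mt2_1 R = diag 1 0 0 0 0 0 0 0 0 0 0 0. Proof. by table; ring. Qed.
Lemma mt2_2iE : mt2_2i R = diag 1 0 0 0 0 0 0 0 1 0 0 0. Proof. by table; ring. Qed.
Lemma mt2_2iiE : mt2_2ii R = diag 1 0 0 0 0 0 0 0 (-1) 0 0 0. Proof. by table; ring. Qed.
Lemma mt1_1E : mt1_1 R = diag 0 0 0 0 0 0 0 0 0 0 0 0. Proof. by table; ring. Qed.

End Tables.

(** * One normal form for each class *)

Section NormalForms.
Variable R : realType.
Implicit Types (a b : R).

Definition semi (al s2 s3 t : R) : mtriple R := diag 0 s2 s3 al 0 0 t 0 0 0 0 0.
(** Solves s2 t2 = s3 t3 = al be, the remaining bialgebra equations when both vectors lie on the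
    first axis: on the plane T is k al times the adjugate of S, and be is k times its determinant.
    Being polynomial, it also covers al = 0 (classes 1 and 2) and s2 = 0 (class 7). *)
Definition twin (al s2 s3 k : R) : mtriple R :=
  diag 0 s2 s3 al 0 0 0 (k * al * s3) (k * al * s2) (k * s2 * s3) 0 0.

Definition canon (c : dclass R) : mtriple R :=
  match c with
  | Class1 b => twin 0 1 1 b
  | Class2 b => twin 0 1 (-1) b
  | Class3 a b => twin a 1 1 (b / a)
  | Class4 a b => twin a 1 (-1) (- (b / a))
  | Class5 => mt9_1 R
  | Class6 => mt5_2ii R
  | Class7 b => twin 1 0 1 b
  | Class8 b => twin 1 1 (-1) (- b)
  | Class9 a | Class14 a => semi a 1 1 0
  | Class10 a => semi a 1 (-1) 0
  | Class11 => semi 1 0 0 0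
  | Class12 => semi 1 0 1 0
  | Class13 => semi 1 1 (-1) 0
  | Class15 => semi 0 1 1 0
  | Class16 => semi 0 1 1 1
  | Class17 => semi 0 1 1 (-1)
  | Class18 => semi 1 1 1 0
  | Class19 => semi 0 1 0 0
  | Class20 => semi 0 1 0 1
  | Class21 => semi 0 1 0 (-1)
  | Class22 => semi 0 0 0 0
  end.

Lemma eqv_eq (t t' : mtriple R) : t = t' -> eqv t t'.
Proof. by move=> ->; apply: eqv_refl. Qed.

Lemma dual_diag s1 s2 s3 a1 a2 a3 t1 t2 t3 b1 b2 b3 :
  dual_mtriple (diag s1 s2 s3 a1 a2 a3 t1 t2 t3 b1 b2 b3) =
  diag t1 t2 t3 b1 b2 b3 s1 s2 s3 a1 a2 a3 :> mtriple R.
Proof. by []. Qed.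

Lemma diag_cyc2 (s1 s2 s3 a1 a2 a3 t1 t2 t3 b1 b2 b3 : R) :
  eqv (diag s1 s2 s3 a1 a2 a3 t1 t2 t3 b1 b2 b3)
      (diag s3 s1 s2 a3 a1 a2 t3 t1 t2 b3 b1 b2).
Proof. exact: eqv_trans (diag_cyc _ _ _ _ _ _ _ _ _ _ _ _) (diag_cyc _ _ _ _ _ _ _ _ _ _ _ _).
  Qed.

(** Twisting along the axis of [a] alters only the corner entry of T there: the corner of S is zero,
    so [b] does not move, and [be = 0] makes the twist admissible. *)
Lemma diag_twist1 (s2 s3 al t1 t2 t3 be t1' : R) : al != 0 -> be = 0 ->
  eqv (diag 0 s2 s3 al 0 0 t1 t2 t3 be 0 0) (diag 0 s2 s3 al 0 0 t1' t2 t3 be 0 0).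
Proof.
move=> n0 ->; apply: (@eqv_twist _ (rv ((t1 - t1') / (2 * al)) 0 0)); rewrite ?symmx_tr //.
- by rewrite /symmx !mx3s; ring.
- by rewrite /symmx !mx3s; congr mx3; field.
- by rewrite /symmx !mx3s; congr rv; ring.
Qed.

Lemma semi_twist al s2 s3 t : al != 0 -> eqv (semi al s2 s3 t) (semi al s2 s3 0).
Proof. by move=> n0; apply: diag_twist1. Qed.

(** Exchanging the factors and rescaling the first axis by 1/b brings S back to diag(0, 1, 1) and
    turns [a] into 1/a. *)
Lemma class3_dual a b : a != 0 -> b != 0 -> eqv (mt7_7 a^-1 b) (mt7_7 a b).
Proof.
move=> a0 b0; apply: eqv_trans (eqv_dual _); rewrite !mt7_7E dual_diag.
have n0 : b^-1 != 0 by rewrite invr_eq0.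
apply: eqv_sym; apply: eqv_trans (diag_scale _ _ _ _ _ _ _ _ _ _ _ _ n0 (oner_neq0 R)
  (oner_neq0 R)) _.
apply: eqv_eq; congr diag; field; rewrite ?a0 ?b0 //.
Qed.

Lemma class4_dual a b : a != 0 -> b != 0 -> eqv (mt6_6i a^-1 b) (mt6_6i a b).
Proof.
move=> a0 b0; apply: eqv_trans (eqv_dual _); rewrite !mt6_6iE dual_diag.
have n0 : b^-1 != 0 by rewrite invr_eq0.
apply: eqv_sym; apply: eqv_trans (diag_scale _ _ _ _ _ _ _ _ _ _ _ _ n0 (oner_neq0 R)
  (oner_neq0 R)) _.
apply: eqv_eq; congr diag; field; rewrite ?a0 ?b0 //.
Qed.

Lemma diag_twist_dual (a1 a2 a3 t1 t2 t3 r : R) : a1 != 0 -> a2 = 0 -> a3 = 0 ->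
  eqv (diag 0 0 0 a1 a2 a3 t1 t2 t3 0 0 0) (diag 0 0 0 a1 0 0 r t2 t3 0 0 0).
Proof. by move=> n0 -> ->; apply: diag_twist1. Qed.

(** In the dual triples the vector lies on one axis and the other algebra has the symmetric part (1,
    1, 1), (1, 1, -1) or (1, 1, 0), with the last sign on the axis of the vector in the second case.
    [diag_twist1] clears the entry on that axis, which erases the difference between Bianchi 9, 8
    and 7_0. *)
Lemma class1_eqv b t : b != 0 -> t \in [:: mt9_5 b; mt8_5ii b; mt70_5ii b] ->
  eqv t (twin 0 1 1 b).
Proof.
move=> b0 tin; apply: eqv_dual2.
have -> : dual_mtriple (twin 0 1 1 b) = diag 0 0 0 b 0 0 0 1 1 0 0 0.
  by rewrite dual_diag; congr diag; ring.
move: tin; rewrite !inE => /or3P[]/eqP->.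
- by rewrite mt9_5E dual_diag; apply: diag_twist_dual.
- rewrite mt8_5iiE dual_diag; apply: eqv_trans (diag_cyc2 _ _ _ _ _ _ _ _ _ _ _ _) _.
  exact: diag_twist_dual.
- rewrite mt70_5iiE dual_diag; apply: eqv_trans (diag_cyc2 _ _ _ _ _ _ _ _ _ _ _ _) _.
  exact: eqv_refl.
Qed.

Lemma diag_scale_eq l1 l2 l3 s1 s2 s3 a1 a2 a3 t1 t2 t3 b1 b2 b3
  s1' s2' s3' a1' a2' a3' t1' t2' t3' b1' b2' b3' :
  l1 != 0 -> l2 != 0 -> l3 != 0 ->
  s1' = l2 * l3 / l1 * s1 -> s2' = l1 * l3 / l2 * s2 -> s3' = l1 * l2 / l3 * s3 ->
  a1' = l1 * a1 -> a2' = l2 * a2 -> a3' = l3 * a3 ->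
  t1' = l1 / (l2 * l3) * t1 -> t2' = l2 / (l1 * l3) * t2 -> t3' = l3 / (l1 * l2) * t3 ->
  b1' = b1 / l1 -> b2' = b2 / l2 -> b3' = b3 / l3 ->
  eqv (diag s1 s2 s3 a1 a2 a3 t1 t2 t3 b1 b2 b3)
      (diag s1' s2' s3' a1' a2' a3' t1' t2' t3' b1' b2' b3') :> Prop.
Proof. by move=> n1 n2 n3 -> -> -> -> -> -> -> -> -> -> -> ->; apply: (@diag_scale R). Qed.

Lemma class2_eqv b t : b != 0 -> t \in [:: mt8_5i b; mt60_5iii b] ->
  eqv t (twin 0 1 (-1) b).
Proof.
move=> b0 tin; apply: eqv_dual2.
have -> : dual_mtriple (twin 0 1 (-1) b) = diag 0 0 0 (- b) 0 0 0 1 (-1) 0 0 0.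
  by rewrite dual_diag; congr diag; ring.
move: tin; rewrite !inE => /orP[]/eqP->.
- rewrite mt8_5iE dual_diag; apply: eqv_trans (diag_twist_dual _ _ _ 0 b0 erefl erefl) _.
  apply: eqv_trans (diag_swap _ _ _ _ _ _ _ _ _ _ _ _) _.
  by apply: (@diag_scale_eq 1 (-1) 1); rewrite ?oppr_eq0 ?oner_neq0 //; field.
- rewrite mt60_5iiiE dual_diag; apply: eqv_trans (diag_cyc2 _ _ _ _ _ _ _ _ _ _ _ _) _.
  apply: eqv_trans (diag_swap _ _ _ _ _ _ _ _ _ _ _ _) _.
  by apply: (@diag_scale_eq (-1) 1 1); rewrite ?oppr_eq0 ?oner_neq0 //; field.
Qed.

End NormalForms.

Section EquivalencesInClasses.
Variable R : realType.
Implicit Types (a b : R).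

Lemma class3_eqv a b t : a != 0 -> b != 0 -> t \in [:: mt7_7 a b; mt7_7 a^-1 b] ->
  eqv t (twin a 1 1 (b / a)).
Proof.
move=> a0 b0; have E : mt7_7 a b = twin a 1 1 (b / a).
  by rewrite mt7_7E /twin; congr diag; field.
rewrite !inE -E => /orP[]/eqP->; [exact: eqv_refl|exact: class3_dual].
Qed.

Lemma class4_eqv a b t : a != 0 -> b != 0 -> t \in [:: mt6_6i a b; mt6_6i a^-1 b] ->
  eqv t (twin a 1 (-1) (- (b / a))).
Proof.
move=> a0 b0; have E : mt6_6i a b = twin a 1 (-1) (- (b / a)).
  by rewrite mt6_6iE /twin; congr diag; field.
rewrite !inE -E => /orP[]/eqP->; [exact: eqv_refl|exact: class4_dual].
Qed.

Lemma neqr10 : 1 != 0 :> R. Proof. exact: oner_neq0. Qed.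
Lemma neqrN10 : -1 != 0 :> R. Proof. by rewrite oppr_eq0 oner_neq0. Qed.

Lemma class6_8_5iii : eqv (mt8_5iii R) (mt5_2ii R).
Proof.
rewrite mt8_5iiiE mt5_2iiE; apply: eqv_trans (eqv_sym (eqv_dual _)) _; rewrite dual_diag.
apply: (@eqv_trans _ (triple_of (symmx 0 0 0 0 0 0) (rv (-1) 0 1) (symmx 0 0 0 1 0 0) (rv 0 0
  0))).
  (* As a quadratic form, a^T r + r^T a is twice the product of the linear forms [a] and [r]. This
     [r] makes it x_1^2 - x_3^2, which leaves only the middle entry of diag(1, 1, -1). *)
  apply: (@eqv_twist _ (rv (- 2^-1) 0 (- 2^-1))); rewrite ?symmx_tr //; rewrite /symmx !mx3s.
  - by ring.
  - by congr mx3; field.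
  - by congr rv; ring.
(* The rows of the first matrix send the vector (-1, 0, 1) to the first axis and move the remaining
   entry of T to the third. *)
apply: (@eqv_GL _ (mx3 (-1) 0 0 1 0 1 0 1 0) (mx3 (-1) 0 1 0 0 1 0 1 0));
  rewrite /symmx !mx3s ?scalar_mx3;
  by congr (mx3 _ _ _ _ _ _ _ _ _) || congr (rv _ _ _); ring.
Qed.

Lemma class6_eqv t :
  t \in [:: mt8_1 R; mt8_5iii R; mt70_5i R; mt60_5i R; mt5_2ii R] ->
  eqv t (mt5_2ii R).
Proof.
rewrite !inE => /or4P[/eqP->|/eqP->|/eqP->|/orP[]/eqP->].
- apply: eqv_trans class6_8_5iii; rewrite mt8_1E mt8_5iiiE.
  (* A null vector of diag(1, 1, -1): the twist is admissible and creates the vector r S = (-1, 0,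
     1). *)
  apply: (@eqv_twist _ (rv (-1) 0 (-1))); rewrite ?symmx_tr //; rewrite /symmx !mx3s.
  + by ring.
  + by congr mx3; ring.
  + by congr rv; ring.
- exact: class6_8_5iii.
- rewrite mt70_5iE mt5_2iiE; apply: eqv_trans (eqv_sym (eqv_dual _)) _; rewrite dual_diag.
  apply: eqv_trans (diag_twist_dual _ _ _ 0 neqr10 erefl erefl) _.
  apply: eqv_trans (diag_swap _ _ _ _ _ _ _ _ _ _ _ _) _.
  by apply: (@diag_scale_eq _ (-1) (-1) 1); rewrite ?neqrN10 ?neqr10 //; field.
- rewrite mt60_5iE mt5_2iiE; apply: eqv_trans (eqv_sym (eqv_dual _)) _; rewrite dual_diag.
  apply: eqv_trans (diag_twist_dual _ _ _ 0 neqr10 erefl erefl) _.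
  apply: eqv_trans (diag_swap _ _ _ _ _ _ _ _ _ _ _ _) _.
  by apply: (@diag_scale_eq _ (-1) 1 1); rewrite ?neqrN10 ?neqr10 //; field.
- exact: eqv_refl.
Qed.

(** In the duals the twist clears the first entry of T and keeps the second, 1 for 7_0 and -1 for
    6_0. Rescaling multiplies it by the parameter, hence the opposite sign of the parameter for
    6_0. *)
Lemma class7_eqv b t : b != 0 -> t \in [:: mt70_4 b; mt4_2iii b; mt60_4i (- b)] ->
  eqv t (twin 1 0 1 b).
Proof.
move=> b0; have -> : twin 1 0 1 b = diag 0 0 1 1 0 0 0 b 0 0 0 0.
  by rewrite /twin; congr diag; ring.
rewrite !inE => /or3P[]/eqP->.
- rewrite mt70_4E; apply: eqv_trans (eqv_sym (eqv_dual _)) _; rewrite dual_diag.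
  apply: eqv_trans (diag_twist1 _ _ _ _ _ 0 b0 erefl) _.
  by apply: (@diag_scale_eq _ b^-1 1 1); rewrite ?invr_eq0 ?b0 ?neqr10 //; field.
- by rewrite mt4_2iiiE; apply: eqv_refl.
- have nb0 : - b != 0 by rewrite oppr_eq0.
  rewrite mt60_4iE; apply: eqv_trans (eqv_sym (eqv_dual _)) _; rewrite dual_diag.
  apply: eqv_trans (diag_twist1 _ _ _ _ _ 0 nb0 erefl) _.
  by apply: (@diag_scale_eq _ (- b)^-1 1 1); rewrite ?invr_eq0 ?nb0 ?neqr10 //; field.
Qed.

Lemma class8_eqv b t : t \in [:: mt3_3i b] -> eqv t (twin 1 1 (-1) (- b)).
Proof.
rewrite inE => /eqP->; apply: eqv_eq; rewrite mt3_3iE /twin; congr diag; ring.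
Qed.

Lemma bianchi7_eqv a t : a != 0 -> t \in [:: mt7_1 a; mt7_2i a; mt7_2ii a] ->
  eqv t (semi a 1 1 0).
Proof.
move=> a0; rewrite !inE => /or3P[]/eqP->.
- by rewrite mt7_1E; apply: eqv_refl.
- by rewrite mt7_2iE; apply: semi_twist.
- by rewrite mt7_2iiE; apply: semi_twist.
Qed.

(** The form diag(1, -1) on the plane has two null lines; twisting along one or the other removes
    the dual brackets of [mt6_6ii], respectively [mt6_6iii]. *)
Lemma class10_eqv a t : 1 < a -> t \in [:: mt6_1 a; mt6_2 a; mt6_6ii a; mt6_6iii a] ->
  eqv t (semi a 1 (-1) 0).
Proof.
move=> a1; have a0 : a != 0 by rewrite gt_eqF // (lt_trans _ a1) // ltr01.
have am : a - 1 != 0 by rewrite subr_eq0 gt_eqF.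
have ap : a + 1 != 0 by rewrite gt_eqF // addr_gt0 // ?(lt_trans _ a1) // ltr01.
rewrite !inE => /or4P[]/eqP->.
- by rewrite mt6_1E; apply: eqv_refl.
- by rewrite mt6_2E; apply: semi_twist.
- rewrite mt6_6iiE //; apply: (@eqv_twist _ (rv 0 (a - 1)^-1 (a - 1)^-1));
  rewrite ?symmx_tr //; rewrite /symmx !mx3s.
  + by ring.
  + by congr mx3; field.
  + by congr rv; ring.
- rewrite mt6_6iiiE //; apply: (@eqv_twist _ (rv 0 (- (a + 1)^-1) (a + 1)^-1));
  rewrite ?symmx_tr //; rewrite /symmx !mx3s.
  + by ring.
  + by congr mx3; field.
  + by congr rv; ring.
Qed.

Lemma null_vector_GL (s : R) :
  eqv (triple_of (symmx 0 0 0 0 0 s) (rv (-1) (-1) 0) (symmx 0 0 0 0 0 0) (rv 0 0 0))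
      (diag 0 0 s 1 0 0 0 0 0 0 0 0).
Proof.
apply: (@eqv_GL _ (mx3 (-1) 0 0 1 (-1) 0 0 0 1) (mx3 (-1) (-1) 0 0 (-1) 0 0 0 1));
  rewrite /symmx !mx3s ?scalar_mx3;
  by congr (mx3 _ _ _ _ _ _ _ _ _) || congr (rv _ _ _); ring.
Qed.

(** After the exchange, the vector (-1, -1, 0) is a linear factor of x_1^2 - x_2^2. Twisting by half
    the other factor, up to sign, cancels that part of the form. *)
Lemma null_vector_dual (s : R) :
  eqv (diag 1 (-1) 0 0 0 0 0 0 s (-1) (-1) 0) (diag 0 0 s 1 0 0 0 0 0 0 0 0).
Proof.
apply: eqv_trans (eqv_sym (eqv_dual _)) _; rewrite dual_diag.
apply: eqv_trans (null_vector_GL s).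
apply: (@eqv_twist _ (rv (- 2^-1) 2^-1 0)); rewrite ?symmx_tr //; rewrite /symmx !mx3s.
- by ring.
- by congr mx3; field.
- by congr rv; ring.
Qed.

(** Twisting along a null vector of diag(1, -1, 0) creates a vector in the dual algebra and leaves T
    as it is, since a = 0. This makes the exchange useful for a unimodular triple. *)
Lemma null_vector_twist (s : R) :
  eqv (diag 1 (-1) 0 0 0 0 0 0 s 0 0 0) (diag 1 (-1) 0 0 0 0 0 0 s (-1) (-1) 0).
Proof.
apply: (@eqv_twist _ (rv (-1) 1 0)); rewrite ?symmx_tr //; rewrite /symmx !mx3s.
- by ring.
- by congr mx3; ring.
- by congr rv; ring.
Qed.

Lemma class11_eqv t : t \in [:: mt60_1 R; mt60_5ii R; mt5_1 R; mt5_2i R] ->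
  eqv t (semi 1 0 0 0).
Proof.
rewrite !inE => /or4P[]/eqP->.
- by rewrite mt60_1E; apply: eqv_trans (null_vector_twist 0) (null_vector_dual 0).
- by rewrite mt60_5iiE; apply: null_vector_dual.
- by rewrite mt5_1E; apply: eqv_refl.
- by rewrite mt5_2iE; apply: semi_twist; rewrite neqr10.
Qed.

Lemma class12_eqv t : t \in [:: mt60_2 R; mt60_4ii R; mt4_1 R; mt4_2i R; mt4_2ii R] ->
  eqv t (semi 1 0 1 0).
Proof.
rewrite !inE => /or4P[/eqP->|/eqP->|/eqP->|/orP[]/eqP->].
- by rewrite mt60_2E; apply: eqv_trans (null_vector_twist 1) (null_vector_dual 1).
- by rewrite mt60_4iiE; apply: null_vector_dual.
- by rewrite mt4_1E; apply: eqv_refl.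
- by rewrite mt4_2iE; apply: semi_twist; rewrite neqr10.
- by rewrite mt4_2iiE; apply: semi_twist; rewrite neqr10.
Qed.

Lemma class13_eqv t : t \in [:: mt3_1 R; mt3_2 R; mt3_3ii R; mt3_3iii R] ->
  eqv t (semi 1 1 (-1) 0).
Proof.
rewrite !inE => /or4P[]/eqP->.
- by rewrite mt3_1E; apply: eqv_refl.
- by rewrite mt3_2E; apply: semi_twist; rewrite neqr10.
- rewrite mt3_3iiE; apply: (@eqv_twist _ (rv 0 2^-1 2^-1)); rewrite ?symmx_tr //;
  rewrite /symmx !mx3s.
  + by ring.
  + by congr mx3; ring.
  + by congr rv; ring.
- rewrite mt3_3iiiE; apply: (@eqv_twist _ (rv 0 (- 2^-1) 2^-1)); rewrite ?symmx_tr //;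
  rewrite /symmx !mx3s.
  + by ring.
  + by congr mx3; ring.
  + by congr rv; ring.
Qed.

Lemma eqv70 (t : R) : eqv (diag 1 1 0 0 0 0 0 0 t 0 0 0) (semi 0 1 1 t).
Proof. exact: diag_cyc2. Qed.

Lemma eqv2 (t : R) : eqv (diag 1 0 0 0 0 0 0 0 t 0 0 0) (semi 0 1 0 t).
Proof. exact: diag_cyc2. Qed.

Lemma canon_eqv (c : dclass R) t : in_range c -> t \in class_triples c ->
  eqv t (canon c).
Proof.
case: c => /=.
- by move=> b b0; apply: class1_eqv; rewrite gt_eqF.
- by move=> b b0; apply: class2_eqv; rewrite gt_eqF.
- move=> a b [a1 /eqP b0]; apply: class3_eqv => //.
  by rewrite gt_eqF // (lt_le_trans ltr01 a1).
- move=> a b [a1 /eqP b0]; apply: class4_eqv => //.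
  by rewrite gt_eqF // (lt_trans ltr01 a1).
- by move=> _; rewrite inE => /eqP->; apply: eqv_refl.
- by move=> _; apply: class6_eqv.
- by move=> b /eqP b0; apply: class7_eqv.
- by move=> b _; apply: class8_eqv.
- move=> a a1; apply: bianchi7_eqv; by rewrite gt_eqF // (lt_trans ltr01 a1).
- by move=> a; apply: class10_eqv.
- by move=> _; apply: class11_eqv.
- by move=> _; apply: class12_eqv.
- by move=> _; apply: class13_eqv.
- by move=> a [a0 _]; apply: bianchi7_eqv; rewrite gt_eqF.
- by move=> _; rewrite inE => /eqP->; rewrite mt70_1E; apply: eqv70.
- by move=> _; rewrite inE => /eqP->; rewrite mt70_2iE; apply: eqv70.
- by move=> _; rewrite inE => /eqP->; rewrite mt70_2iiE; apply: eqv70.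
- by move=> _; apply: bianchi7_eqv; rewrite neqr10.
- by move=> _; rewrite inE => /eqP->; rewrite mt2_1E; apply: eqv2.
- by move=> _; rewrite inE => /eqP->; rewrite mt2_2iE; apply: eqv2.
- by move=> _; rewrite inE => /eqP->; rewrite mt2_2iiE; apply: eqv2.
- by move=> _; rewrite inE => /eqP->; rewrite mt1_1E; apply: eqv_refl.
Qed.

End EquivalencesInClasses.

Lemma mem_second (E : eqType) (x y : E) s : y \in [:: x, y & s].
Proof. by rewrite !inE eqxx orbT. Qed.
Lemma mem_third (E : eqType) (x y z : E) s : z \in [:: x, y, z & s].
Proof. by rewrite !inE eqxx !orbT. Qed.
Lemma mem_fifth (E : eqType) (x y z u v : E) s : v \in [:: x, y, z, u, v & s].
Proof. by rewrite !inE eqxx !orbT. Qed.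

(** * Every double is classified *)

Section NonunimodularNormalForms.
Variable R : realType.
Implicit Types (a b : R).

Definition classified (t : mtriple R) : Prop :=
  exists2 c : dclass R, in_range c & exists2 t', t' \in class_triples c & eqv t' t.

Lemma classified_eqv t t' : eqv t t' -> classified t -> classified t'.
Proof.
move=> tt' [c cr [t0 t0c e]]; exists c; first exact: cr.
exists t0; [exact: t0c|exact: eqv_trans e tt'].
Qed.

Lemma classified_dual t : classified t -> classified (dual_mtriple t).
Proof. exact: classified_eqv (eqv_sym (eqv_dual t)). Qed.

Lemma in_classified (c : dclass R) t : in_range c -> t \in class_triples c -> classified t.
Proof. by move=> cr tc; exists c => //; exists t => //; apply: eqv_refl. Qed.

(** The dual algebra of [mt6_6ii a] is of type 6_{1/a}. Exchanging the factors of that triple and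
    twisting away the other symmetric part leaves 6_{1/a} with an abelian dual. This brings a < 1
    into the range of class 10. *)
Lemma mt6_1_inv a : 1 < a -> eqv (mt6_1 a) (mt6_1 a^-1).
Proof.
move=> a1; have a0 : a != 0 by rewrite gt_eqF // (lt_trans _ a1) // ltr01.
have am : a - 1 != 0 by rewrite subr_eq0 gt_eqF.
have e1 := class10_eqv a1 (t := mt6_6ii a); have e2 := class10_eqv a1 (t := mt6_1 a).
apply: (@eqv_trans _ (mt6_6ii a)).
  have m1 : mt6_1 a \in [:: mt6_1 a; mt6_2 a; mt6_6ii a; mt6_6iii a] by rewrite !inE eqxx.
  have m2 : mt6_6ii a \in [:: mt6_1 a; mt6_2 a; mt6_6ii a; mt6_6iii a].
    by exact: mem_third.
  exact: eqv_trans (e2 m1) (eqv_sym (e1 m2)).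
apply: eqv_trans (eqv_sym (eqv_dual _)) _; rewrite mt6_6iiE // mt6_1E.
apply: (@eqv_trans _ (triple_of (symmx 0 (a / (a - 1)) (a / (a - 1)) 0 0 0)
    (rv 0 (- (a - 1)^-1) (a - 1)^-1) (symmx 0 0 0 0 0 0) (rv 0 0 0))).
  (* The vector is proportional to x_3 - x_2 and [r] to x_2 + x_3; the factors are matched so that
     the product cancels x_2^2 - x_3^2. *)
  apply: (@eqv_twist _ (rv 0 (- ((a - 1) / 2)) (- ((a - 1) / 2)))); rewrite ?symmx_tr //;
    rewrite /symmx !mx3s.
  - by ring.
  - by congr mx3; field.
  - by congr rv; field.
apply: (@eqv_trans _ (diag 0 (-1) 1 a^-1 0 0 0 0 0 0 0 0)).
  (* The vector is sent to (1/a, 0, 0) and the remaining symmetric part, a multiple of x_1 (x_2 +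
     x_3), to diag(0, -1, 1). *)
  apply: (@eqv_GL _ (mx3 0 (- ((a - 1) / (2 * a))) ((a - 1) / (2 * a)) 2^-1 4^-1 4^-1 2^-1 (-
    4^-1) (- 4^-1))
     (mx3 0 (- (a / (a - 1))) (a / (a - 1)) 1 1 1 1 (-1) (-1)));
  rewrite /symmx !mx3s ?scalar_mx3.
  - by congr (mx3 _ _ _ _ _ _ _ _ _); field; rewrite ?a0 ?am.
  - by congr (mx3 _ _ _ _ _ _ _ _ _); field; rewrite ?a0 ?am.
  - by congr (rv _ _ _); field; rewrite ?a0 ?am.
  - by congr (mx3 _ _ _ _ _ _ _ _ _); field; rewrite ?a0 ?am.
  - by congr (rv _ _ _); field; rewrite ?a0 ?am.
apply: eqv_trans (diag_swap _ _ _ _ _ _ _ _ _ _ _ _) _.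
by apply: (@diag_scale_eq _ (-1) (-1) 1); rewrite ?neqrN10 ?neqr10 //; field.
Qed.

(** The position reached after alignment, twist and diagonalization: both vectors on the first axis,
    both forms diagonal on the complementary plane. *)
Definition axial (al s2 s3 be t2 t3 : R) := diag 0 s2 s3 al 0 0 0 t2 t3 be 0 0.

Lemma axial_scale l r al s2 s3 be t2 t3 : l != 0 -> r != 0 ->
  eqv (axial al s2 s3 be t2 t3)
      (axial (l * al) (l * s2 / r) (l * r * s3) (be / l) (r * t2 / l) (t3 / (r * l))).
Proof.
move=> l0 r0; apply: (@diag_scale_eq _ l r 1); rewrite ?neqr10 //; field;
by rewrite ?l0 ?r0.
Qed.

Lemma axial_swap al s2 s3 be t2 t3 :
  eqv (axial al s2 s3 be t2 t3) (axial al s3 s2 be t3 t2).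
Proof.
apply: eqv_trans (diag_swap _ _ _ _ _ _ _ _ _ _ _ _) _.
by apply: (@diag_scale_eq _ (-1) (-1) 1); rewrite ?neqrN10 ?neqr10 //; field.
Qed.

Lemma classified_axial_pos a b : 0 < a -> classified (axial a 1 1 (b / a) b b).
Proof.
move=> a0; have an : a != 0 by rewrite gt_eqF.
have [->|b0] := eqVneq b 0.
  have E : axial a 1 1 (0 / a) 0 0 = mt7_1 a by rewrite mt7_1E /axial mul0r.
  rewrite E; have [lt1|lt1|->] := ltgtP a 1.
  - by apply: (@in_classified (Class14 a)); rewrite ?inE ?eqxx.
  - by apply: (@in_classified (Class9 a)); rewrite ?inE ?eqxx.
  - by apply: (@in_classified (Class18 R)); rewrite ?inE ?eqxx.
have E : axial a 1 1 (b / a) b b = mt7_7 a b by rewrite mt7_7E.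
rewrite E; have [le1|lt1] := leP 1 a.
  by apply: (@in_classified (Class3 a b)); rewrite ?inE ?eqxx //; split=> //; apply/eqP.
apply: (@in_classified (Class3 a^-1 b)); last by rewrite !inE invrK eqxx orbT.
by split; [rewrite invf_ge1 // ltW|apply/eqP].
Qed.

(** At a = 1 the algebra 6_a becomes Bianchi 3, which gives classes 13 and 8. Below 1 the parameter
    is inverted, by [mt6_1_inv] if b = 0 and by the second triple of class 4 otherwise. *)
Lemma classified_axial_neg a b : 0 < a -> classified (axial a 1 (-1) (b / a) b (- b)).
Proof.
move=> a0; have an : a != 0 by rewrite gt_eqF.
have [->|b0] := eqVneq b 0.
  have E : axial a 1 (-1) (0 / a) 0 (- 0) = mt6_1 a by rewrite mt6_1E /axial mul0r oppr0.
  rewrite E; have [lt1|lt1|->] := ltgtP a 1.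
  - have ai : 1 < a^-1 by rewrite invf_gt1.
    apply: (@classified_eqv (mt6_1 a^-1)); first by have := mt6_1_inv ai; rewrite invrK.
    by apply: (@in_classified (Class10 a^-1)); rewrite ?inE ?eqxx.
  - by apply: (@in_classified (Class10 a)); rewrite ?inE ?eqxx.
  - rewrite (_ : mt6_1 1 = mt3_1 R); last by rewrite mt6_1E mt3_1E.
    by apply: (@in_classified (Class13 R)); rewrite ?inE ?eqxx.
have E : axial a 1 (-1) (b / a) b (- b) = mt6_6i a b by rewrite mt6_6iE.
rewrite E; have [lt1|lt1|a1] := ltgtP a 1.
- apply: (@in_classified (Class4 a^-1 b)); last by rewrite !inE invrK eqxx orbT.
  by split; [rewrite invf_gt1|apply/eqP].
- by apply: (@in_classified (Class4 a b)); rewrite ?inE ?eqxx //; split=> //; apply/eqP.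
- rewrite (_ : mt6_6i a b = mt3_3i b); last by rewrite mt6_6iE mt3_3iE a1 divr1.
  by apply: (@in_classified (Class8 b)); rewrite ?inE ?eqxx //; apply/eqP.
Qed.

Lemma exists_sqrt (x : R) : x != 0 -> exists2 r, 0 < r & r ^+ 2 = `|x|.
Proof.
move=> x0; exists (Num.sqrt `|x|); first by rewrite sqrtr_gt0 normr_gt0.
by rewrite sqr_sqrtr.
Qed.

(** The sign of [l] is chosen to make the rescaled vector positive, as the parameter ranges
    demand. *)
Lemma exists_signed_sqrt (x al : R) : x != 0 -> al != 0 ->
  exists l, [/\ l != 0, l ^+ 2 = `|x| & 0 < l * al].
Proof.
move=> x0 al0; have [r r0 rx] := exists_sqrt x0.
have [lt0|lt0|al00] := ltgtP al 0.
- exists (- r); rewrite oppr_eq0 gt_eqF // sqrrN; split=> //.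
  by rewrite mulNr oppr_gt0 pmulr_rlt0.
- by exists r; rewrite gt_eqF //; split=> //; apply: mulr_gt0.
- by rewrite al00 eqxx in al0.
Qed.

Lemma dual_positive b : 0 < b -> classified (diag 0 0 0 b 0 0 0 1 1 0 0 0).
Proof.
move=> b0; have bn : b != 0 by rewrite gt_eqF.
have c1 : classified (mt70_5ii b).
  apply: (@in_classified (Class1 b)); first exact: b0.
  exact: mem_third.
have e : eqv (mt70_5ii b) (twin 0 1 1 b).
  by apply: class1_eqv; first exact: bn; exact: mem_third.
have := classified_dual (classified_eqv e c1); rewrite dual_diag.
by congr classified; congr diag; ring.
Qed.

Lemma dual_negative b : 0 < b -> classified (diag 0 0 0 b 0 0 0 1 (-1) 0 0 0).
Proof.
move=> b0; have bn : b != 0 by rewrite gt_eqF.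
have c1 : classified (mt60_5iii b).
  apply: (@in_classified (Class2 b)); first exact: b0.
  exact: mem_second.
have e : eqv (mt60_5iii b) (twin 0 1 (-1) b).
  by apply: class2_eqv; first exact: bn; exact: mem_second.
have := classified_dual (classified_eqv e c1); rewrite dual_diag => c2.
(* The normal form of class 2 has vector part -b in its dual; reversing two axes changes that sign
   and keeps T. *)
have -> : diag 0 0 0 b 0 0 0 1 (-1) 0 0 0 = axial (-1 * (0 * (-1) * b * 0 + b * 1 * -1))
    (-1 * 0 / -1) (-1 * -1 * 0) (0 / -1) (-1 * 1 / -1) (-1 / (-1 * -1)).
  by rewrite /axial; congr diag; field; rewrite ?neqrN10.
apply: classified_eqv (axial_scale _ _ _ _ _ _ (neqrN10 R) (neqrN10 R)) _.
by move: c2; congr classified; rewrite /axial; congr diag; ring.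
Qed.

(** If s2 and s3 vanish, the first algebra is Bianchi 5 and the rank and sign of T decide between
    classes 11, 6, 1 and 2. If one vanishes it is Bianchi 4, with classes 12 and 7. If none does,
    the sign of s2 s3 leads to the 7 or 6 families. *)
Lemma classified_axial al s2 s3 be t2 t3 : al != 0 -> s2 * t2 = al * be -> s3 * t3 = al * be ->
  classified (axial al s2 s3 be t2 t3).
Proof.
move=> al0.
have half s t t' : s != 0 -> s * t' = al * be -> 0 * t = al * be ->
    classified (axial al 0 s be t t').
  move=> s0 E1; rewrite mul0r => E2.
  have be0 : be = 0 by apply: (mulfI al0); rewrite -E2 mulr0.
  have t0 : t' = 0 by apply: (mulfI s0); rewrite E1 -E2 mulr0.
  have r0 : al / s != 0 by rewrite mulf_neq0 // invr_eq0.
  have l0 : al^-1 != 0 by rewrite invr_eq0.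
  apply: classified_eqv (eqv_sym (axial_scale _ _ _ _ _ _ l0 r0)) _.
  have -> : axial (al^-1 * al) (al^-1 * 0 / (al / s)) (al^-1 * (al / s) * s) (be / al^-1)
     (al / s * t / al^-1) (t' / (al / s * al^-1)) = mt4_2iii (al ^+ 2 * t / s).
    by rewrite mt4_2iiiE /axial be0 t0; congr diag; field; rewrite ?s0 ?al0.
  have [->|b0] := eqVneq (al ^+ 2 * t / s) 0.
    rewrite (_ : mt4_2iii 0 = mt4_1 R); last by rewrite mt4_2iiiE mt4_1E.
    by apply: (@in_classified (Class12 R)); last exact: mem_third.
  apply: (@in_classified (Class7 (al ^+ 2 * t / s))); first exact/eqP.
  exact: mem_second.
have [->|s20] := eqVneq s2 0; have [->|s30] := eqVneq s3 0; move=> E2 E3.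
- rewrite mul0r in E2.
  have be0 : be = 0 by apply: (mulfI al0); rewrite -E2 mulr0.
  have one t : classified (axial al 0 0 be 0 t).
    have l0 : al^-1 != 0 by rewrite invr_eq0.
    have [->|t0] := eqVneq t 0.
      apply: classified_eqv (eqv_sym (axial_scale _ _ _ _ _ _ l0 (neqr10 R))) _.
      set t1 := axial _ _ _ _ _ _; have -> : t1 = mt5_1 R.
        by rewrite mt5_1E /t1 /axial be0; congr diag; field; rewrite ?al0.
      by apply: (@in_classified (Class11 R)); last exact: mem_third.
    have r0 : al * t != 0 by rewrite mulf_neq0.
    apply: classified_eqv (eqv_sym (axial_scale _ _ _ _ _ _ l0 r0)) _.
    set t1 := axial _ _ _ _ _ _; have -> : t1 = mt5_2ii R.
      by rewrite mt5_2iiE /t1 /axial be0; congr diag; field; rewrite ?al0 ?t0.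
    by apply: (@in_classified (Class6 R)); last exact: mem_fifth.
  have [->|t20] := eqVneq t2 0; first exact: one.
  have [->|t30] := eqVneq t3 0; first exact: classified_eqv (axial_swap _ _ _ _ _ _) (one _).
  (* With l^2 = |t2 t3| and r = l / t2, rescaling sends t2 to 1 and t3 to the sign of t2 t3. *)
  have [l [l0 lE lal]] := exists_signed_sqrt (mulf_neq0 t20 t30) al0.
  have r0 : l / t2 != 0 by rewrite mulf_neq0 // invr_eq0.
  apply: classified_eqv (eqv_sym (axial_scale _ _ _ _ _ _ l0 r0)) _.
  have fin e (b := l * al) : t2 * t3 = e * l ^+ 2 ->
     axial (l * al) (l * 0 / (l / t2)) (l * (l / t2) * 0) (be / l) (l / t2 * t2 / l)
        (t3 / (l / t2 * l)) = diag 0 0 0 b 0 0 0 1 e 0 0 0.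
    move=> te; rewrite /axial be0 /b; congr diag; try by field; rewrite ?l0 ?t20.
    have -> : e = t2 * t3 / l ^+ 2 by rewrite te mulfK // expf_neq0.
    by field; rewrite ?l0 ?t20.
  have [tt|tt] := leP 0 (t2 * t3).
    rewrite (fin 1); last by rewrite lE ger0_norm // mul1r.
    exact: dual_positive.
  rewrite (fin (-1)); last by rewrite lE ltr0_norm // mulN1r opprK.
  exact: dual_negative.
- by apply: half s30 E3 _; rewrite -E2.
- apply: classified_eqv (axial_swap _ _ _ _ _ _) _.
  by apply: half s20 E2 _; rewrite -E3.
have s23 : (s2 * s3)^-1 != 0 by rewrite invr_eq0 mulf_neq0.
(* With l^2 = 1 / |s2 s3| and r = l s2, rescaling sends s2 to 1 and s3 to the sign of s2 s3; T is
   then determined by the equations. *)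
have [l [l0 lE lal]] := exists_signed_sqrt s23 al0.
have r0 : l * s2 != 0 by rewrite mulf_neq0.
apply: classified_eqv (eqv_sym (axial_scale _ _ _ _ _ _ l0 r0)) _.
set b := al * be in E2 E3.
have -> : be / l = b / (l * al) by rewrite /b; field; rewrite l0 al0.
have -> : l * s2 / (l * s2) = 1 by rewrite divff.
have -> : l * s2 * t2 / l = b by rewrite -E2; field.
have fin e : l ^+ 2 = e / (s2 * s3) -> e * e = 1 ->
    (l * (l * s2) * s3 = e) * (t3 / (l * s2 * l) = e * b).
  move=> le e2; have e0 : e != 0.
    by apply/eqP => e0; move: e2; rewrite e0 mul0r => /eqP; rewrite eq_sym oner_eq0.
  have E1 : l * (l * s2) * s3 = e.
    have -> : l * (l * s2) * s3 = l ^+ 2 * (s2 * s3) by ring.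
    by rewrite le mulfVK ?mulf_neq0.
  split=> //; rewrite -E3 -[in RHS]E1.
  have e2' : (l * (l * s2) * s3) * (l * (l * s2) * s3) = 1 by rewrite E1.
  have -> : t3 / (l * s2 * l) = ((l * (l * s2) * s3) * (l * (l * s2) * s3)) * (t3 / (l * s2 * l)).
    by rewrite e2' mul1r.
  by field; rewrite l0 s20.
have [tt|tt] := leP 0 (s2 * s3)^-1.
  have [] := fin 1; rewrite ?mul1r //; first by rewrite lE ger0_norm.
  by move=> -> ->; apply: classified_axial_pos.
have [] := fin (-1); rewrite ?mulrNN ?mulN1r ?mul1r //; first by rewrite lE ltr0_norm.
by move=> -> ->; apply: classified_axial_neg.
Qed.

End NonunimodularNormalForms.

(** * Reduction to axial position when a vector part is nonzero *)

Section GeneralCase.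
Variable R : realType.
Implicit Types (S T P Q : 'M[R]_3).

Lemma GL_sym P Q S a T b : Q *m P^T = 1%:M -> S^T = S -> T^T = T ->
  exists S' T' b', [/\ S'^T = S',
    T'^T = T' & eqv (triple_of S a T b) (triple_of S' (a *m P^T) T' b')].
Proof.
move=> QP Ss Ts; exists (det3 P *: (Q *m S *m Q^T)), (det3 Q *: (P *m T *m P^T)), (b *m Q^T).
split; last by apply: eqv_sym; apply: GL_iso.
- by rewrite linearZ /= !trmx_mul trmxK Ss mulmxA.
- by rewrite linearZ /= !trmx_mul trmxK Ts mulmxA.
Qed.

(** A cyclic permutation brings a nonzero coordinate to the front, and a shear clears the other
    two. *)
Lemma align S (a : 'rV[R]_3) T b : a != 0 -> S^T = S -> T^T = T ->
  exists S' T' b' (al : R), [/\ S'^T = S', T'^T = T', al != 0 &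
    eqv (triple_of S a T b) (triple_of S' (rv al 0 0) T' b')].
Proof.
have first S0 (x y z : R) T0 b0 : x != 0 -> S0^T = S0 -> T0^T = T0 ->
  exists S' T' b' (al : R), [/\ S'^T = S', T'^T = T', al != 0 &
    eqv (triple_of S0 (rv x y z) T0 b0) (triple_of S' (rv al 0 0) T' b')].
  move=> x0 Ss Ts.
  have QP : mx3 1 (y / x) (z / x) 0 1 0 0 0 1 *m (mx3 1 0 0 (- (y / x)) 1 0 (- (z / x)) 0 1)^T
    = 1%:M.
    by rewrite !mx3s scalar_mx3; congr mx3; ring.
  have [S' [T' [b' [Ss' Ts' e]]]] := GL_sym (rv x y z) b0 QP Ss Ts.
  have E : rv x y z *m (mx3 1 0 0 (- (y / x)) 1 0 (- (z / x)) 0 1)^T = rv x 0 0.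
    by rewrite !mx3s; congr rv; field.
  rewrite E in e.
  by exists S', T', b', x; split; [exact: Ss'|exact: Ts'|exact: x0|exact: e].
have cyc S0 (x y z : R) T0 b0 : S0^T = S0 -> T0^T = T0 ->
  exists S' T' b', [/\ S'^T = S', T'^T = T' &
    eqv (triple_of S0 (rv x y z) T0 b0) (triple_of S' (rv y z x) T' b')].
  move=> Ss Ts; have QP : mx3 0 1 0 0 0 1 1 0 0 *m (mx3 0 1 0 0 0 1 1 0 0)^T = 1%:M :> 'M[R]_3.
    by rewrite !mx3s scalar_mx3; congr mx3; ring.
  have [S' [T' [b' [Ss' Ts' e]]]] := GL_sym (rv x y z) b0 QP Ss Ts.
  have E : rv x y z *m (mx3 0 1 0 0 0 1 1 0 0)^T = rv y z x.
    by rewrite !mx3s; congr rv; ring.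
  rewrite E in e.
  by exists S', T', b'; split; [exact: Ss'|exact: Ts'|exact: e].
rewrite (rv_eta a) => a0 Ss Ts.
have [x0|x0] := eqVneq (a 0 0) 0; last exact: first.
have [S1 [T1 [b1 [Ss1 Ts1 e1]]]] := cyc S (a 0 0) (a 0 1) (a 0 2) T b Ss Ts.
have [y0|y0] := eqVneq (a 0 1) 0; last first.
  have [S2 [T2 [b2 [al [Ss2 Ts2 al0 e2]]]]] := first _ _ (a 0 2) (a 0 0) _ b1 y0 Ss1 Ts1.
  by exists S2, T2, b2, al; split; [exact: Ss2|exact: Ts2|exact: al0|exact: eqv_trans e1 e2].
have [S2 [T2 [b2 [Ss2 Ts2 e2]]]] := cyc _ (a 0 1) (a 0 2) (a 0 0) _ b1 Ss1 Ts1.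
have z0 : a 0 2 != 0.
  by apply: contraNneq a0 => z0; rewrite x0 y0 z0 -zero_rv.
have [S3 [T3 [b3 [al [Ss3 Ts3 al0 e3]]]]] := first _ _ (a 0 0) (a 0 1) _ b2 z0 Ss2 Ts2.
exists S3, T3, b3, al; split; [exact: Ss3|exact: Ts3|exact: al0|].
exact: eqv_trans e1 (eqv_trans e2 e3).
Qed.

Lemma symmx_eta S : S^T = S -> S = symmx (S 0 0) (S 0 1) (S 0 2) (S 1 1) (S 1 2) (S 2 2).
Proof. by move=> Ss; rewrite {1}(mx3_eta S) !(sym3E Ss). Qed.

Lemma mx3_inj (p1 p2 p3 p4 p5 p6 p7 p8 p9 q1 q2 q3 q4 q5 q6 q7 q8 q9 : R) :
  mx3 p1 p2 p3 p4 p5 p6 p7 p8 p9 = mx3 q1 q2 q3 q4 q5 q6 q7 q8 q9 ->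
  [/\ [/\ p1 = q1, p2 = q2 & p3 = q3], [/\ p4 = q4, p5 = q5 & p6 = q6]
    & [/\ p7 = q7, p8 = q8 & p9 = q9]].
Proof.
move=> E; have H i j := congr1 (fun M : 'M[R]_3 => M i j) E.
split; split; [have := H 0 0|have := H 0 1|have := H 0 2|have := H 1 0|have := H 1 1|
  have := H 1 2|have := H 2 0|have := H 2 1|have := H 2 2]; by rewrite !mx3E.
Qed.

Definition lie_triple S a T b := lie_bracket (double_of (triple_of S a T b)).

(** (x, y) and (z, w) are an orthogonal basis for the binary form with matrix (p q; q r): complete a
    square, or, if p = r = 0, take the sum and difference of the axes. *)
Lemma diagonalize2 (p q r : R) : exists x y z w,
  x * w - y * z != 0 /\ x * z * p + (x * w + y * z) * q + y * w * r = 0.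
Proof.
have [p0|p0] := eqVneq p 0; last first.
  exists 1, 0, (- (q / p)), 1; split; first by rewrite mulr1 mul0r subr0 oner_neq0.
  by field.
have [r0|r0] := eqVneq r 0; last first.
  exists 1, (- (q / r)), 0, 1; split; first by rewrite mulr1 mulr0 subr0 oner_neq0.
  by field.
exists 1, 1, 1, (-1); split; last by rewrite p0 r0; ring.
by apply/eqP => E; lra.
Qed.

(* A change of basis of the plane spanned by X_2 and X_3: the form in S is transformed
   by congruence and the one in T by the inverse one, so that diagonalizing one of them
   suffices as soon as their product is scalar. *)
Lemma block_move (x y z w s p q r a t u v k b : R) : x * w - y * z != 0 ->
  let d := x * w - y * z in
  eqv (triple_of (symmx s 0 0 p q r) (rv a 0 0) (symmx t 0 0 u v k) (rv b 0 0))
      (triple_of (symmx (s / d) 0 0 ((x * x * p + 2 * x * y * q + y * y * r) / d)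
              ((x * z * p + (x * w + y * z) * q + y * w * r) / d)
              ((z * z * p + 2 * z * w * q + w * w * r) / d)) (rv a 0 0)
           (symmx (t * d) 0 0 ((w * w * u - 2 * w * z * v + z * z * k) / d)
              ((- w * y * u + (x * w + y * z) * v - x * z * k) / d)
              ((y * y * u - 2 * x * y * v + x * x * k) / d)) (rv b 0 0)).
Proof.
move=> d0 d; apply: (@eqv_GL _ (mx3 1 0 0 0 (w / d) (- (z / d)) 0 (- (y / d)) (x / d))
   (mx3 1 0 0 0 x y 0 z w)); rewrite /symmx !mx3s ?scalar_mx3.
- by congr mx3; rewrite /d; field.
- by congr mx3; rewrite /d; field.
- by congr rv; rewrite /d; field.
- by congr mx3; rewrite /d; field.
- by congr rv; rewrite /d; field.
Qed.

(** If the form of S on the plane is nonzero, diagonalize it: the scalar product with T then forces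
    T to be diagonal. If it is zero, the basis is free to diagonalize T. *)
Lemma classified_block (p q r al u v w be : R) : al != 0 ->
  lie_triple (symmx 0 0 0 p q r) (rv al 0 0) (symmx 0 0 0 u v w) (rv be 0 0) ->
  classified (triple_of (symmx 0 0 0 p q r) (rv al 0 0) (symmx 0 0 0 u v w) (rv be 0 0)).
Proof.
move=> al0.
have fin p' r' u' v' w' : (p' == 0) && (r' == 0) ==> (v' == 0) ->
   lie_triple (symmx 0 0 0 p' 0 r') (rv al 0 0) (symmx 0 0 0 u' v' w') (rv be 0 0) ->
   classified (triple_of (symmx 0 0 0 p' 0 r') (rv al 0 0) (symmx 0 0 0 u' v' w') (rv be 0 0)).
  move=> pr lie; have [_ _] := bialgebra_of_lie (symmx_tr _ _ _ _ _ _) (symmx_tr _ _ _ _ _ _) lie.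
  rewrite /symmx !(mx3s, scalar_mx3) => /mx3_inj [_ [_ E1 E2] [_ E3 E4]].
  have v0 : v' = 0.
    have [p0|p0] := eqVneq p' 0; have [r0|r0] := eqVneq r' 0.
    - by apply/eqP; move: pr; rewrite p0 r0 !eqxx.
    - by apply: (mulfI r0); move: E3 => /=; rewrite mulr0; lra.
    - by apply: (mulfI p0); move: E2 => /=; rewrite mulr0; lra.
    - by apply: (mulfI p0); move: E2 => /=; rewrite mulr0; lra.
  rewrite v0 in lie *; apply: (classified_axial al0); first by clear -E1; lra.
  by clear -E4; lra.
move=> lie.
have go p0 q0 r0 u0 v0 w0 x y z t : x * t - y * z != 0 ->
   lie_triple (symmx 0 0 0 p0 q0 r0) (rv al 0 0) (symmx 0 0 0 u0 v0 w0) (rv be 0 0) ->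
   x * z * p0 + (x * t + y * z) * q0 + y * t * r0 = 0 ->
   (x * x * p0 + 2 * x * y * q0 + y * y * r0 = 0 ->
    z * z * p0 + 2 * z * t * q0 + t * t * r0 = 0 ->
    - t * y * u0 + (x * t + y * z) * v0 - x * z * w0 = 0) ->
   classified (triple_of (symmx 0 0 0 p0 q0 r0) (rv al 0 0) (symmx 0 0 0 u0 v0 w0) (rv be 0 0)).
  move=> d0 lie0 E Ev.
  have e := block_move 0 p0 q0 r0 al 0 u0 v0 w0 be d0.
  rewrite /= E !mul0r in e.
  apply: classified_eqv (eqv_sym e) _; apply: fin; last exact: lie_iso e lie0.
  have di : (x * t - y * z)^-1 != 0 by rewrite invr_eq0.
  apply/implyP; rewrite !mulf_eq0 (negPf di) !orbF => /andP[/eqP E1 /eqP E2].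
  by rewrite Ev.
have [/eqP|pqr] := boolP ((p == 0) && (q == 0) && (r == 0)).
  move=> /eqP/andP[/andP[/eqP p0 /eqP q0] /eqP r0].
  have [x [y [z [t [d0 E]]]]] := diagonalize2 u v w.
  (* T transforms by the inverse transpose, so the basis found for T is passed to [go] in its
     cofactor form. *)
  rewrite p0 q0 r0 in lie *; have d1 : t * x - (- z) * (- y) != 0.
    by move: d0; congr (_ != 0); ring.
  apply: (go _ _ _ _ _ _ _ _ _ _ d1) => //; first by ring.
  by move=> _ _; rewrite -[RHS]E; ring.
have [x [y [z [t [d0 E]]]]] := diagonalize2 p q r.
apply: (go _ _ _ _ _ _ _ _ _ _ d0) => // E1 E2.
case/negP: pqr.
(* undo the congruence *)
pose d := x * t - y * z.
have P0 : d ^+ 2 * p = 0.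
  rewrite (_ : _ * p = t * t * (x * x * p + 2 * x * y * q + y * y * r)
    - 2 * t * y * (x * z * p + (x * t + y * z) * q + y * t * r)
    + y * y * (z * z * p + 2 * z * t * q + t * t * r)); last by rewrite /d; ring.
  by rewrite E E1 E2; ring.
have Q0 : d ^+ 2 * q = 0.
  rewrite (_ : _ * q = - t * z * (x * x * p + 2 * x * y * q + y * y * r)
    + (x * t + y * z) * (x * z * p + (x * t + y * z) * q + y * t * r)
    - x * y * (z * z * p + 2 * z * t * q + t * t * r)); last by rewrite /d; ring.
  by rewrite E E1 E2; ring.
have R0 : d ^+ 2 * r = 0.
  rewrite (_ : _ * r = z * z * (x * x * p + 2 * x * y * q + y * y * r)
    - 2 * z * x * (x * z * p + (x * t + y * z) * q + y * t * r)
    + x * x * (z * z * p + 2 * z * t * q + t * t * r)); last by rewrite /d; ring.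
  by rewrite E E1 E2; ring.
have dd : d ^+ 2 != 0 by rewrite expf_neq0.
have p0 : p = 0 by apply: (mulfI dd); rewrite P0 mulr0.
have q0 : q = 0 by apply: (mulfI dd); rewrite Q0 mulr0.
have r0 : r = 0 by apply: (mulfI dd); rewrite R0 mulr0.
by rewrite p0 q0 r0 eqxx.
Qed.

(** Once [a] is on the first axis, a S = 0 clears the first row of S, and the first column of the
    equation for S T expresses [b2] and [b3] through T. *)
Lemma classified_nonunimodular S a T b : a != 0 -> S^T = S -> T^T = T ->
  lie_triple S a T b -> classified (triple_of S a T b).
Proof.
move=> a0 Ss Ts lie0.
have [S1 [T1 [b1 [al [Ss1 Ts1 al0 e1]]]]] := align b a0 Ss Ts.
have lie1 := lie_iso e1 lie0; apply: classified_eqv (eqv_sym e1) _.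
have [B1 B2 B3] := bialgebra_of_lie Ss1 Ts1 lie1.
move: B1 B2 B3 lie1; rewrite (symmx_eta Ss1) (symmx_eta Ts1) (rv_eta b1).
move: (S1 0 0) (S1 0 1) (S1 0 2) (S1 1 1) (S1 1 2) (S1 2 2) => s1 s2 s3 p q r.
move: (T1 0 0) (T1 0 1) (T1 0 2) (T1 1 1) (T1 1 2) (T1 2 2) => t1 t2 t3 u v w.
move: (b1 0 0) (b1 0 1) (b1 0 2) => be b2 b3.
rewrite /symmx !(mx3s, scalar_mx3) zero_rv -!/(symmx _ _ _ _ _ _).
move=> /rv_inj[B1 B2 B3] /rv_inj[C1 C2 C3] /mx3_inj [_ [E1 _ _] [E2 _ _]] lie1.
have z s : al * s + 0 * 0 + 0 * 0 = 0 -> s = 0 by move=> E; apply: (mulfI al0); lra.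
have s10 : s1 = 0 by apply: (mulfI al0); lra.
have s20 : s2 = 0 by apply: (mulfI al0); lra.
have s30 : s3 = 0 by apply: (mulfI al0); lra.
rewrite s10 s20 s30 in E1 E2 lie1 *.
have e2 : eqv (triple_of (symmx 0 0 0 p q r) (rv al 0 0) (symmx t1 t2 t3 u v w) (rv be b2 b3))
   (triple_of (symmx 0 0 0 p q r) (rv al 0 0) (symmx 0 0 0 u v w) (rv be 0 0)).
  have b2E : b2 = - ((p * t2 + q * t3) / al).
    apply: (mulfI al0); have -> : al * - ((p * t2 + q * t3) / al) = - (p * t2 + q * t3) by field.
    by clear -E1; lra.
  have b3E : b3 = - ((q * t2 + r * t3) / al).
    apply: (mulfI al0); have -> : al * - ((q * t2 + r * t3) / al) = - (q * t2 + r * t3) by field.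
    by clear -E2; lra.
  have C0 : (be * t1 + b2 * t2 + b3 * t3) / al = 0 by rewrite C1 mul0r.
  (* This [r] is solved from the first row of T, with a half because the corner is hit twice. The
     expressions for [b2] and [b3] are exactly what r S cancels, and the admissibility condition
     becomes the first coordinate of b T = 0 divided by [al]. *)
  apply: (@eqv_twist _ (rv (t1 / (2 * al)) (t2 / al) (t3 / al))); rewrite ?symmx_tr //;
    rewrite /symmx !mx3s.
  - by rewrite -[RHS]C0 b2E b3E; field.
  - by congr mx3; field.
  - by rewrite b2E b3E; congr rv; field.
apply: classified_eqv (eqv_sym e2) _; apply: classified_block; first exact: al0.
exact: lie_iso e2 lie1.
Qed.

End GeneralCase.

(** * Unimodular triples with diagonal symmetric parts *)

Section UnimodularDiagonal.
Variable R : realType.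

Definition unimod (s1 s2 s3 t1 t2 t3 : R) := diag s1 s2 s3 0 0 0 t1 t2 t3 0 0 0.

Lemma unimod_scale l1 l2 l3 s1 s2 s3 t1 t2 t3 s1' s2' s3' t1' t2' t3' :
  l1 != 0 -> l2 != 0 -> l3 != 0 ->
  s1' = l2 * l3 / l1 * s1 -> s2' = l1 * l3 / l2 * s2 -> s3' = l1 * l2 / l3 * s3 ->
  t1' = l1 / (l2 * l3) * t1 -> t2' = l2 / (l1 * l3) * t2 -> t3' = l3 / (l1 * l2) * t3 ->
  classified (unimod s1' s2' s3' t1' t2' t3') -> classified (unimod s1 s2 s3 t1 t2 t3).
Proof.
move=> n1 n2 n3 E1 E2 E3 E4 E5 E6; apply: classified_eqv; apply: eqv_sym.
by apply: (@diag_scale_eq _ l1 l2 l3); rewrite // ?mulr0 ?mul0r.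
Qed.

Lemma unimod_cyc s1 s2 s3 t1 t2 t3 :
  classified (unimod s2 s3 s1 t2 t3 t1) -> classified (unimod s1 s2 s3 t1 t2 t3).
Proof. by apply: classified_eqv; apply: eqv_sym; apply: diag_cyc. Qed.

Lemma unimod_swap s1 s2 s3 t1 t2 t3 :
  classified (unimod s1 s3 s2 t1 t3 t2) -> classified (unimod s1 s2 s3 t1 t2 t3).
Proof.
apply: classified_eqv; apply: eqv_sym; apply: eqv_trans (diag_swap _ _ _ _ _ _ _ _ _ _ _ _) _.
by rewrite oppr0; apply: eqv_refl.
Qed.

Lemma unimod_dual s1 s2 s3 t1 t2 t3 :
  classified (unimod t1 t2 t3 s1 s2 s3) -> classified (unimod s1 s2 s3 t1 t2 t3).
Proof. by move/classified_dual; rewrite dual_diag. Qed.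

(** A square root of |x|, stated without absolute value; the undetermined sign is later split by
    [root4_1] or [root2_1]. *)
Lemma exists_root4 (x : R) : x != 0 -> exists2 l, l != 0 & l ^+ 4 = x ^+ 2.
Proof.
move=> /exists_sqrt[l l0 lE]; exists l; first by rewrite gt_eqF.
by rewrite (exprM l 2 2) lE real_normK ?num_real.
Qed.

Lemma root4_1 (x : R) : x ^+ 4 = 1 -> x = 1 \/ x = -1.
Proof.
rewrite (exprM x 2 2) => /eqP; rewrite sqrf_eq1 => /orP[|/eqP x2].
  by rewrite sqrf_eq1 => /orP[]/eqP; [left|right].
by have := sqr_ge0 x; rewrite x2 oppr_ge0 leNgt ltr01.
Qed.

Lemma root2_1 (x : R) : x ^+ 2 = 1 -> x = 1 \/ x = -1.
Proof. by move=> /eqP; rewrite sqrf_eq1 => /orP[]/eqP; [left|right]. Qed.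

Lemma unimod_definite : classified (unimod 1 1 1 0 0 0).
Proof.
rewrite (_ : unimod _ _ _ _ _ _ = mt9_1 R); last by rewrite mt9_1E.
by apply: (@in_classified _ (Class5 R)); last exact: mem_head.
Qed.

Lemma unimod_indefinite : classified (unimod 1 1 (-1) 0 0 0).
Proof.
rewrite (_ : unimod _ _ _ _ _ _ = mt8_1 R); last by rewrite mt8_1E.
by apply: (@in_classified _ (Class6 R)); last exact: mem_head.
Qed.

Lemma unimod_rank3 s1 s2 s3 : s1 != 0 -> s2 != 0 -> s3 != 0 -> classified (unimod s1 s2 s3 0 0 0).
Proof.
move=> n1 n2 n3.
(* Each l_i is the inverse square root of |s_j s_k|, for which all three rescaled entries have
   absolute value 1. *)
have [l1 l10 E1] : exists2 l, l != 0 & l ^+ 4 = ((s2 * s3)^-1) ^+ 2.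
  by apply: exists_root4; rewrite invr_eq0 mulf_neq0.
have [l2 l20 E2] : exists2 l, l != 0 & l ^+ 4 = ((s1 * s3)^-1) ^+ 2.
  by apply: exists_root4; rewrite invr_eq0 mulf_neq0.
have [l3 l30 E3] : exists2 l, l != 0 & l ^+ 4 = ((s1 * s2)^-1) ^+ 2.
  by apply: exists_root4; rewrite invr_eq0 mulf_neq0.
have H1 : (l2 * l3 / l1 * s1) ^+ 4 = 1.
  by rewrite !exprMn exprVn E1 E2 E3; field; rewrite ?n1 ?n2 ?n3.
have H2 : (l1 * l3 / l2 * s2) ^+ 4 = 1.
  by rewrite !exprMn exprVn E1 E2 E3; field; rewrite ?n1 ?n2 ?n3.
have H3 : (l1 * l2 / l3 * s3) ^+ 4 = 1.
  by rewrite !exprMn exprVn E1 E2 E3; field; rewrite ?n1 ?n2 ?n3.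
apply: (unimod_scale l10 l20 l30 erefl erefl erefl erefl erefl erefl); rewrite !mulr0.
have flip x y z : classified (unimod (- x) (- y) (- z) 0 0 0) -> classified (unimod x y z 0 0 0).
  have neqrN10 := neqrN10 R.
  by apply: (unimod_scale neqrN10 neqrN10 neqrN10); field.
have [->|->] := root4_1 H1; have [->|->] := root4_1 H2; have [->|->] := root4_1 H3.
- exact: unimod_definite.
- exact: unimod_indefinite.
- by apply: unimod_swap; apply: unimod_indefinite.
- by apply: flip; rewrite !opprK; apply: unimod_cyc; apply: unimod_indefinite.
- by apply: unimod_cyc; apply: unimod_indefinite.
- by apply: flip; rewrite !opprK; apply: unimod_swap; apply: unimod_indefinite.
- by apply: flip; rewrite !opprK; apply: unimod_indefinite.
- by apply: flip; rewrite !opprK; apply: unimod_definite.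
Qed.

Lemma unimod_rank2_table t : t = 0 \/ t = 1 \/ t = -1 ->
  classified (unimod 1 1 0 0 0 t) /\ classified (unimod 1 (-1) 0 0 0 t).
Proof.
have c1 : classified (unimod 1 (-1) 0 0 0 1).
  rewrite (_ : unimod _ _ _ _ _ _ = mt60_2 R); last by rewrite mt60_2E.
  by apply: (@in_classified _ (Class12 R)); last exact: mem_head.
case=> [->|[->|->]]; split.
- rewrite (_ : unimod _ _ _ _ _ _ = mt70_1 R); last by rewrite mt70_1E.
  by apply: (@in_classified _ (Class15 R)); last exact: mem_head.
- rewrite (_ : unimod _ _ _ _ _ _ = mt60_1 R); last by rewrite mt60_1E.
  by apply: (@in_classified _ (Class11 R)); last exact: mem_head.
- rewrite (_ : unimod _ _ _ _ _ _ = mt70_2i R); last by rewrite mt70_2iE.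
  by apply: (@in_classified _ (Class16 R)); last exact: mem_head.
- exact: c1.
- rewrite (_ : unimod _ _ _ _ _ _ = mt70_2ii R); last by rewrite mt70_2iiE.
  by apply: (@in_classified _ (Class17 R)); last exact: mem_head.
(* Interchanging the two axes turns diag(1, -1, 0) into its opposite, so the sign of t is irrelevant
   here, unlike for diag(1, 1, 0). *)
- apply: unimod_cyc; apply: unimod_swap.
  by apply: (unimod_scale (neqr10 R) (neqr10 R) (neqrN10 R) _ _ _ _ _ _ c1); field.
Qed.

Lemma unimod_rank2 s1 s2 t3 : s1 != 0 -> s2 != 0 -> classified (unimod s1 s2 0 0 0 t3).
Proof.
move=> s10 s20.
have [l3 l30 E3] : exists2 l, l != 0 & l ^+ 4 = ((s1 * s2)^-1) ^+ 2.
  by apply: exists_root4; rewrite invr_eq0 mulf_neq0.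
have [l1 l10 E1] : exists2 l, l != 0 & t3 != 0 -> l ^+ 4 = (l3 ^+ 2 * s1 * t3) ^+ 2.
  have [->|t0] := eqVneq t3 0; first by exists 1 => //; apply: oner_neq0.
  have [|l l0 lE] := @exists_root4 (l3 ^+ 2 * s1 * t3); last by exists l.
  by rewrite !mulf_neq0 // expf_neq0.
(* [l2] sends s1 to 1 and [l3] then sends s2 to a sign, which leaves [l1] to normalize t3. *)
pose l2 := l1 / (l3 * s1).
have l20 : l2 != 0 by rewrite mulf_neq0 // invr_eq0 mulf_neq0.
have H2 : (l3 ^+ 2 * s1 * s2) ^+ 2 = 1.
  rewrite (_ : _ ^+ 2 = l3 ^+ 4 * (s1 * s2) ^+ 2); last by ring.
  by rewrite E3; field; rewrite s10 s20.
have H3 : let t := l3 ^+ 2 * s1 * t3 / l1 ^+ 2 in t = 0 \/ t = 1 \/ t = -1.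
  move=> t; have [t0|t0] := eqVneq t3 0; [left|right].
    by rewrite /t t0 mulr0 mul0r.
  apply: root2_1; rewrite /t expr_div_n -(E1 t0) -(exprM l1 2 2) divff //.
  by rewrite expf_neq0.
have [c1 c2] := unimod_rank2_table H3.
have F : l1 * l3 / l2 * s2 = l3 ^+ 2 * s1 * s2.
  by rewrite /l2; field; rewrite ?l10 ?l30 ?s10.
have [h|h] := root2_1 H2.
- apply: (unimod_scale l10 l20 l30 _ _ _ _ _ _ c1); rewrite ?F ?h // /l2; field;
  by rewrite ?l10 ?l30 ?s10.
- apply: (unimod_scale l10 l20 l30 _ _ _ _ _ _ c2); rewrite ?F ?h // /l2; field;
  by rewrite ?l10 ?l30 ?s10.
Qed.

Lemma unimod_rank1 s1 t3 : s1 != 0 -> classified (unimod s1 0 0 0 0 t3).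
Proof.
move=> s10; have [->|t0] := eqVneq t3 0.
  have i0 : s1^-1 != 0 by rewrite invr_eq0.
  have c : classified (unimod 1 0 0 0 0 0).
    rewrite (_ : unimod _ _ _ _ _ _ = mt2_1 R); last by rewrite mt2_1E.
    by apply: (@in_classified _ (Class19 R)); last exact: mem_head.
  by apply: (unimod_scale (neqr10 R) i0 (neqr10 R) _ _ _ _ _ _ c); field.
have [l3 l30 E3] : exists2 l, l != 0 & l ^+ 4 = ((s1 * t3)^-1) ^+ 2.
  by apply: exists_root4; rewrite invr_eq0 mulf_neq0.
have l20 : (l3 * s1)^-1 != 0 by rewrite invr_eq0 mulf_neq0.
have H : (l3 ^+ 2 * s1 * t3) ^+ 2 = 1.
  rewrite (_ : _ ^+ 2 = l3 ^+ 4 * (s1 * t3) ^+ 2); last by ring.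
  by rewrite E3; field; rewrite s10 t0.
have F : l3 / (1 * (l3 * s1)^-1) * t3 = l3 ^+ 2 * s1 * t3.
  by field; rewrite ?l30 ?s10.
have c1 : classified (unimod 1 0 0 0 0 1).
  rewrite (_ : unimod _ _ _ _ _ _ = mt2_2i R); last by rewrite mt2_2iE.
  by apply: (@in_classified _ (Class20 R)); last exact: mem_head.
have c2 : classified (unimod 1 0 0 0 0 (-1)).
  rewrite (_ : unimod _ _ _ _ _ _ = mt2_2ii R); last by rewrite mt2_2iiE.
  by apply: (@in_classified _ (Class21 R)); last exact: mem_head.
have [h|h] := root2_1 H.
- apply: (unimod_scale (neqr10 R) l20 l30 _ _ _ _ _ _ c1); rewrite ?F ?h //; field;
  by rewrite ?l30 ?s10.
- apply: (unimod_scale (neqr10 R) l20 l30 _ _ _ _ _ _ c2); rewrite ?F ?h //; field;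
  by rewrite ?l30 ?s10.
Qed.

Lemma unimod_rank1' s1 t2 t3 : s1 != 0 -> classified (unimod s1 0 0 0 t2 t3).
Proof.
move=> s10; have [->|t20] := eqVneq t2 0; first exact: unimod_rank1.
have [->|t30] := eqVneq t3 0; first by apply: unimod_swap; apply: unimod_rank1.
by apply: unimod_dual; apply: unimod_cyc; apply: unimod_rank2.
Qed.

Lemma unimod_rank0 : classified (unimod 0 0 0 0 0 0).
Proof.
rewrite (_ : unimod _ _ _ _ _ _ = mt1_1 R); last by rewrite mt1_1E.
by apply: (@in_classified _ (Class22 R)); last exact: mem_head.
Qed.

Lemma classified_unimod s1 s2 s3 t1 t2 t3 : s1 * t1 = 0 -> s2 * t2 = 0 -> s3 * t3 = 0 ->
  classified (unimod s1 s2 s3 t1 t2 t3).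
Proof.
have z (s t : R) : s != 0 -> s * t = 0 -> t = 0.
  by move=> s0 /eqP; rewrite mulf_eq0 (negPf s0) => /eqP.
have [->|s10] := eqVneq s1 0; have [->|s20] := eqVneq s2 0;
  have [->|s30] := eqVneq s3 0; move=> E1 E2 E3;
  try rewrite (z _ _ s10 E1); try rewrite (z _ _ s20 E2); try rewrite (z _ _ s30 E3).
- apply: unimod_dual.
  have [->|t10] := eqVneq t1 0; have [->|t20] := eqVneq t2 0; have [->|t30] := eqVneq t3 0.
  + exact: unimod_rank0.
  + by do 2!apply: unimod_cyc; apply: unimod_rank1.
  + by apply: unimod_cyc; apply: unimod_rank1.
  + by apply: unimod_cyc; apply: unimod_rank2.
  + exact: unimod_rank1.
  + by do 2!apply: unimod_cyc; apply: unimod_rank2.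
  + exact: unimod_rank2.
  + exact: unimod_rank3.
- by do 2!apply: unimod_cyc; apply: unimod_rank1'.
- by apply: unimod_cyc; apply: unimod_rank1'.
- by apply: unimod_cyc; apply: unimod_rank2.
- exact: unimod_rank1'.
- by do 2!apply: unimod_cyc; apply: unimod_rank2.
- exact: unimod_rank2.
- exact: unimod_rank3.
Qed.

End UnimodularDiagonal.

(** * Diagonalization of unimodular triples *)

Section UnimodularCase.
Variable R : realType.
Implicit Types (S T P Q : 'M[R]_3).

(** Quantifying over [T] lets a basis be chosen for [S] alone, without following what happens to
    [T]. *)
Definition unimodular_good S := forall T, T^T = T ->
  lie_triple S (rv 0 0 0) T (rv 0 0 0) -> classified (triple_of S (rv 0 0 0) T (rv 0 0 0)).

Lemma good_GL P Q S : Q *m P^T = 1%:M -> S^T = S ->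
  unimodular_good (det3 P *: (Q *m S *m Q^T)) -> unimodular_good S.
Proof.
move=> QP Ss good T Ts lie.
have e : eqv (triple_of S (rv 0 0 0) T (rv 0 0 0))
    (triple_of (det3 P *: (Q *m S *m Q^T)) (rv 0 0 0) (det3 Q *: (P *m T *m P^T)) (rv 0 0 0)).
  by apply: (@eqv_GL _ P Q) => //; rewrite -zero_rv mul0mx.
apply: classified_eqv (eqv_sym e) _; apply: good; last exact: lie_iso e lie.
by rewrite linearZ /= !trmx_mul trmxK Ts mulmxA.
Qed.

(** S T = 0 clears the first row of T. An off-diagonal entry left in T forces s2 = s3 = 0, and then
    the plane can be changed freely to diagonalize T. *)
Lemma good_diag (s1 s2 s3 : R) : s1 != 0 -> unimodular_good (symmx s1 0 0 s2 0 s3).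
Proof.
move=> s10 T Ts lie; have [_ _] := bialgebra_of_lie (symmx_tr _ _ _ _ _ _) Ts lie.
move: lie; rewrite (symmx_eta Ts).
move: (T 0 0) (T 0 1) (T 0 2) (T 1 1) (T 1 2) (T 2 2) => t1 t2 t3 u v w lie.
rewrite /symmx !(mx3s, scalar_mx3) => /mx3_inj [[E1 E2 E3] [_ E4 E5] [_ E6 E7]].
have t10 : t1 = 0 by apply: (mulfI s10); clear -E1; lra.
have t20 : t2 = 0 by apply: (mulfI s10); clear -E2; lra.
have t30 : t3 = 0 by apply: (mulfI s10); clear -E3; lra.
rewrite t10 t20 t30 -!/(symmx _ _ _ _ _ _).
have [v0|v0] := eqVneq v 0.
  rewrite v0; apply: classified_unimod; first by rewrite mulr0.
    by clear -E4; lra.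
  by clear -E7; lra.
have s20 : s2 = 0 by apply: (mulIf v0); clear -E5; lra.
have s30 : s3 = 0 by apply: (mulIf v0); clear -E6; lra.
have [x [y [z [t [d0 E]]]]] := diagonalize2 u v w.
have d1 : t * x - (- z) * (- y) != 0 by move: d0; congr (_ != 0); ring.
have e := block_move s1 0 0 0 0 0 u v w 0 d1.
rewrite s20 s30; apply: classified_eqv (eqv_sym e) _.
rewrite (_ : - x * - z * u + (t * x + - z * - y) * v - t * - y * w = 0); last first.
  by rewrite -[RHS]E; ring.
by rewrite !(mulr0, mul0r, addr0); apply: classified_unimod; rewrite ?mul0r ?mulr0.
Qed.

(** Completing the square splits off the pivot; the remaining binary form is handled by
    [diagonalize2]. *)
Lemma good_pivot (p q r s t u : R) : p != 0 -> unimodular_good (symmx p q r s t u).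
Proof.
move=> p0.
have blk s' t' u' : unimodular_good (symmx p 0 0 s' t' u').
  have [x [y [z [w [d0 E]]]]] := diagonalize2 s' t' u'; set d := x * w - y * z in d0.
  have QP : mx3 1 0 0 0 x y 0 z w *m (mx3 1 0 0 0 (w / d) (- (z / d)) 0 (- (y / d)) (x / d))^T
    = 1%:M.
    by rewrite !(mx3s, scalar_mx3); congr mx3; rewrite /d; field.
  apply: (good_GL QP); first exact: symmx_tr.
  have := @good_diag (p / d) ((x * x * s' + 2 * x * y * t' + y * y * u') / d)
    ((z * z * s' + 2 * z * w * t' + w * w * u') / d).
  rewrite mulf_neq0 ?invr_eq0 // => /(_ isT); congr unimodular_good.
  have E2 : (x * z * s' + (x * w + y * z) * t' + y * w * u') / d = 0 by rewrite E mul0r.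
  rewrite /symmx !mx3s; congr mx3; try (by rewrite /d; field);
  by rewrite -[LHS]E2 /d; field.
have QP : mx3 1 0 0 (- (q / p)) 1 0 (- (r / p)) 0 1 *m (mx3 1 (q / p) (r / p) 0 1 0 0 0 1)^T =
  1%:M.
  by rewrite !(mx3s, scalar_mx3); congr mx3; ring.
apply: (good_GL QP); first exact: symmx_tr.
have := blk (s - q ^+ 2 / p) (t - q * r / p) (u - r ^+ 2 / p).
by congr unimodular_good; rewrite /symmx !mx3s; congr mx3; field.
Qed.

Lemma good_cyc (p q r s t u : R) : unimodular_good (symmx s t q u r p) ->
  unimodular_good (symmx p q r s t u).
Proof.
have QP : mx3 0 1 0 0 0 1 1 0 0 *m (mx3 0 1 0 0 0 1 1 0 0)^T = 1%:M :> 'M[R]_3.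
  by rewrite !(mx3s, scalar_mx3); congr mx3; ring.
move=> g; apply: (good_GL QP); first exact: symmx_tr.
by move: g; congr unimodular_good; rewrite /symmx !mx3s; congr mx3; ring.
Qed.

(** Replacing e_1 by e_1 + e_2 creates the pivot 2q. *)
Lemma good_offdiag (q r t : R) : q != 0 -> unimodular_good (symmx 0 q r 0 t 0).
Proof.
move=> q0; have QP : mx3 1 1 0 0 1 0 0 0 1 *m (mx3 1 0 0 (-1) 1 0 0 0 1)^T = 1%:M :> 'M[R]_3.
  by rewrite !(mx3s, scalar_mx3); congr mx3; ring.
apply: (good_GL QP); first exact: symmx_tr.
have q2 : 2 * q != 0 by rewrite mulf_neq0 // pnatr_eq0.
have := @good_pivot (2 * q) q (r + t) 0 t 0 q2.
by congr unimodular_good; rewrite /symmx !mx3s; congr mx3; ring.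
Qed.

Lemma good_nonzero S : S^T = S -> S != 0 -> unimodular_good S.
Proof.
move=> Ss; rewrite (symmx_eta Ss).
move: (S 0 0) (S 0 1) (S 0 2) (S 1 1) (S 1 2) (S 2 2) => p q r s t u.
have [->|p0] := eqVneq p 0; last by move=> _; apply: good_pivot.
have [->|s0] := eqVneq s 0; last by move=> _; apply: good_cyc; apply: good_pivot.
have [->|u0] := eqVneq u 0; last by move=> _; do 2!apply: good_cyc; apply: good_pivot.
have [->|q0] := eqVneq q 0; last by move=> _; apply: good_offdiag.
have [->|t0] := eqVneq t 0; last by move=> _; apply: good_cyc; apply: good_offdiag.
have [->|r0] := eqVneq r 0; last by move=> _; do 2!apply: good_cyc; apply: good_offdiag.
by rewrite /symmx -zero_mx3 eqxx.
Qed.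

Lemma classified_lie (t : mtriple R) : lie_bracket (double_of t) -> classified t.
Proof.
have [S [a [T [b [Ss Ts ->]]]]] := triple_of_eta t => lie.
have lie' : lie_triple T b S a := lie_iso (isomorphic_sym (dual_iso (triple_of S a T b))) lie.
have back : classified (triple_of T b S a) -> classified (triple_of S a T b).
  exact: classified_dual.
have [a0|a0] := eqVneq a 0; last exact: (classified_nonunimodular a0 Ss Ts lie).
have [b0|b0] := eqVneq b 0; last exact: back (classified_nonunimodular b0 Ts Ss lie').
rewrite a0 b0 zero_rv in lie lie' back *.
have [S0|S0] := eqVneq S 0; last exact: (good_nonzero Ss S0 Ts lie).
have [T0|T0] := eqVneq T 0; last exact: back (good_nonzero Ts T0 Ss lie').
by rewrite S0 T0 zero_mx3; apply: unimod_rank0.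
Qed.

Lemma drinfeld_classified (D : metric_algebra R) : drinfeld_double6 D ->
  exists2 c : dclass R, in_range c & belongs_to D c.
Proof.
move=> [[lieD formD [G [Gt mGt]]] dimD].
have [T allT] := exists_decomposition formD dimD mGt.
have e := allows_iso lieD formD allT.
have lieT := lie_iso (isomorphic_sym e) lieD.
have [c cr [t tc te]] := classified_lie lieT.
exists c => //; exists t => //.
apply: iso_allows => //; exact: isomorphic_trans te e.
Qed.

End UnimodularCase.

(** * Jacobi identities of the normal forms *)

Section CanonicalLie.
Variable R : realType.

Lemma jacobi_pairs (T : mtriple R) (u v w : double_of T) (u1 v1 w1 u2 v2 w2 : 'rV[R]_3) :
  u = (u1, u2) -> v = (v1, v2) -> w = (w1, w2) ->
  u1 + v1 + w1 = 0 -> u2 + v2 + w2 = 0 -> u + v + w = 0.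
Proof. by move=> -> -> -> E1 E2; congr (_, _). Qed.

Lemma diag_bracket (s1 s2 s3 al t1 t2 t3 be x1 x2 x3 p1 p2 p3 y1 y2 y3 q1 q2 q3 : R) :
  @bracket R (double_of (diag s1 s2 s3 al 0 0 t1 t2 t3 be 0 0))
    (rv x1 x2 x3, rv p1 p2 p3) (rv y1 y2 y3, rv q1 q2 q3) =
  (rv ((x2 * y3 - x3 * y2) * s1 + (t2 * x2 + be * x3) * q3 - (t3 * x3 - be * x2) * q2
        - ((t2 * y2 + be * y3) * p3 - (t3 * y3 - be * y2) * p2))
      ((x3 * y1 - x1 * y3) * s2 - (x1 * y2 - x2 * y1) * al +
        (t3 * x3 - be * x2) * q1 - t1 * x1 * q3
        - ((t3 * y3 - be * y2) * p1 - t1 * y1 * p3))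
      ((x3 * y1 - x1 * y3) * al + (x1 * y2 - x2 * y1) * s3 + t1 * x1 * q2 - (t2 * x2 +
        be * x3) * q1
        - (t1 * y1 * p2 - (t2 * y2 + be * y3) * p1)),
   rv ((p2 * q3 - p3 * q2) * t1 + x2 * (s3 * q3 - al * q2) - x3 * (s2 * q2 + al * q3)
        - (y2 * (s3 * p3 - al * p2) - y3 * (s2 * p2 + al * p3)))
      ((p3 * q1 - p1 * q3) * t2 - (p1 * q2 - p2 * q1) * be +
        x3 * (s1 * q1) - x1 * (s3 * q3 - al * q2)
        - (y3 * (s1 * p1) - y1 * (s3 * p3 - al * p2)))
      ((p3 * q1 - p1 * q3) * be + (p1 * q2 - p2 * q1) * t3 + x1 * (s2 * q2 +
        al * q3) - x2 * (s1 * q1)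
        - (y1 * (s2 * p2 + al * p3) - y2 * (s1 * p1)))).
Proof.
rewrite double_bracketE /=.
rewrite !(cross_rv, bmx_rv _ _ _ _ (symmx_tr _ _ _ _ _ _),
  bmxT_rv _ _ _ _ (symmx_tr _ _ _ _ _ _)).
rewrite /symmx !(mx3E, rvE) !(cross_rv, add_rv, opp_rv).
by congr (rv _ _ _, rv _ _ _); ring.
Qed.

Lemma lie_diag (s1 s2 s3 al t1 t2 t3 be : R) :
  (forall x1 x2 x3 p1 p2 p3 y1 y2 y3 q1 q2 q3 z1 z2 z3 r1 r2 r3 : R,
    let D := double_of (diag s1 s2 s3 al 0 0 t1 t2 t3 be 0 0) in
    let u : D := (rv x1 x2 x3, rv p1 p2 p3) in
    let v : D := (rv y1 y2 y3, rv q1 q2 q3) in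
    let w : D := (rv z1 z2 z3, rv r1 r2 r3) in
    bracket u (bracket v w) + bracket v (bracket w u) + bracket w (bracket u v) = 0) ->
  lie_bracket (double_of (diag s1 s2 s3 al 0 0 t1 t2 t3 be 0 0)).
Proof.
move=> H; apply: lie_double => -[x xi] [y eta] [z zeta].
rewrite (rv_eta x) (rv_eta xi) (rv_eta y) (rv_eta eta) (rv_eta z) (rv_eta zeta).
exact: H.
Qed.

Lemma lie_semi al s2 s3 t : lie_bracket (double_of (semi al s2 s3 t : mtriple R)).
Proof.
apply: lie_diag => x1 x2 x3 p1 p2 p3 y1 y2 y3 q1 q2 q3 z1 z2 z3 r1 r2 r3 D u v w.
by apply: jacobi_pairs; rewrite /u /v /w ?diag_bracket ?add_rv ?zero_rv //; congr rv; ring.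
Qed.

Lemma lie_twin al s2 s3 k : lie_bracket (double_of (twin al s2 s3 k : mtriple R)).
Proof.
apply: lie_diag => x1 x2 x3 p1 p2 p3 y1 y2 y3 q1 q2 q3 z1 z2 z3 r1 r2 r3 D u v w.
by apply: jacobi_pairs; rewrite /u /v /w ?diag_bracket ?add_rv ?zero_rv //; congr rv; ring.
Qed.

Lemma lie_mt9_1 : lie_bracket (double_of (mt9_1 R)).
Proof.
rewrite mt9_1E; apply: lie_diag => x1 x2 x3 p1 p2 p3 y1 y2 y3 q1 q2 q3 z1 z2 z3 r1 r2 r3 D u v w.
by apply: jacobi_pairs; rewrite /u /v /w ?diag_bracket ?add_rv ?zero_rv //; congr rv; ring.
Qed.

Lemma lie_mt5_2ii : lie_bracket (double_of (mt5_2ii R)).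
Proof.
rewrite mt5_2iiE; apply: lie_diag => x1 x2 x3 p1 p2 p3 y1 y2 y3 q1 q2 q3 z1 z2 z3 r1 r2 r3 D u
  v w.
by apply: jacobi_pairs; rewrite /u /v /w ?diag_bracket ?add_rv ?zero_rv //; congr rv; ring.
Qed.

Lemma lie_canon (c : dclass R) : lie_bracket (double_of (canon c)).
Proof.
case: c => [b|b|a b|a b| | |b|b|a|a| | | |a| | | | | | | |] /=;
  [apply: lie_twin|apply: lie_twin|apply: lie_twin|apply: lie_twin|apply: lie_mt9_1|
   apply: lie_mt5_2ii|apply: lie_twin|apply: lie_twin|apply: lie_semi ..].
Qed.

End CanonicalLie.

(** * Doubles of different classes *)

Section Invariants.
Variable R : realType.
Local Notation vec := ('rV[R]_3 * 'rV[R]_3)%type.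
Local Notation pairing := (@pairing R).
Implicit Types (t : mtriple R) (u v w x y z : vec).

Definition lie_br t u v : vec := @bracket R (double_of t) u v.

Definition bilin (B : vec -> vec -> R) := forall k u v w,
  B (k *: u + v) w = k * B u w + B v w /\ B w (k *: u + v) = k * B w u + B w v.

(** A basis of the double in which [opp_base] indexes the dual basis for the pairing. *)
Definition base (p : bool * 'I_3) : vec :=
  if p.1 then (delta_mx 0 p.2, 0) else (0, delta_mx 0 p.2).
Definition opp_base (p : bool * 'I_3) : bool * 'I_3 := (~~ p.1, p.2).

(** The contraction of [B] with the inverse metric, that is, the trace of the operator which the
    metric associates with [B]. *)
Definition metric_trace (B : vec -> vec -> R) : R := \sum_p B (base p) (base (opp_base p)).

Lemma pairing_bilin : bilin pairing.
Proof. by move=> k u v w; split; rewrite /pairing /dot /= !mxE; ring. Qed.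

Lemma base_expand v : v = \sum_p pairing v (base (opp_base p)) *: base p.
Proof.
rewrite -(pair_bigA _ (fun b i => pairing v (base (opp_base (b, i))) *: base (b, i))) /=.
rewrite big_bool /= !sum3.
rewrite /base /= /pairing /dot /=.
case: v => x xi; congr (_, _); apply: rvP; rewrite !mxE /=; ring.
Qed.

Lemma parseval u v : pairing u v = \sum_p pairing u (base p) * pairing v (base (opp_base p)).
Proof.
rewrite -(pair_bigA _ (fun b i => pairing u (base (b, i)) * pairing v (base (opp_base (b,
  i))))) /=.
rewrite big_bool /= !sum3 /base /= /pairing /dot /= !mxE /=; ring.
Qed.

Lemma pairingC u v : pairing u v = pairing v u.
Proof. by rewrite /pairing addrC (dotC u.2) (dotC u.1). Qed.

Lemma bilin_suml B (I : finType) (F : I -> vec) w : bilin B ->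
  B (\sum_i F i) w = \sum_i B (F i) w.
Proof.
move=> Bb; have B0 : B 0 w = 0.
  by have [H _] := Bb (-1) 0 0 w; rewrite scaler0 addr0 in H; rewrite H; ring.
have BD u v : B (u + v) w = B u w + B v w.
  by have [H _] := Bb 1 u v w; rewrite scale1r mul1r in H.
elim/big_ind2: _ => // x1 x2 y1 y2 <- <-; exact: BD.
Qed.

Lemma bilin_sumr B (I : finType) (F : I -> vec) w : bilin B ->
  B w (\sum_i F i) = \sum_i B w (F i).
Proof.
move=> Bb; apply: (@bilin_suml (fun u v => B v u)) => k u v z.
by have [H1 H2] := Bb k u v z.
Qed.

Lemma bilinZl B k u w : bilin B -> B (k *: u) w = k * B u w.
Proof.
move=> Bb; have [H _] := Bb k u 0 w; have [H0 _] := Bb (-1) 0 0 w.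
have B0 : B 0 w = 0 by rewrite scaler0 addr0 in H0; rewrite H0; ring.
by rewrite addr0 B0 addr0 in H.
Qed.

Lemma bilinZr B k u w : bilin B -> B w (k *: u) = k * B w u.
Proof.
move=> Bb; apply: (@bilinZl (fun u v => B v u)) => l x y z.
by have [H1 H2] := Bb l x y z.
Qed.

Lemma metric_trace_isometry (f g : vec -> vec) B : bilin B -> cancel g f ->
  (forall u v, pairing (f u) (f v) = pairing u v) ->
  metric_trace (fun u v => B (f u) (f v)) = metric_trace B.
Proof.
move=> Bb gK fF.
have adj u v : pairing (f u) v = pairing u (g v) by rewrite -{1}(gK v) fF.
pose c p q := pairing (f (base p)) (base (opp_base q)).
have E p p' : B (f (base p)) (f (base p')) =
   \sum_q \sum_r (c p q * c p' r) * B (base q) (base r).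
  rewrite {1}(base_expand (f (base p))) bilin_suml //; apply: eq_bigr => q _.
  rewrite bilinZl // {1}(base_expand (f (base p'))) bilin_sumr // mulr_sumr.
  by apply: eq_bigr => r _; rewrite bilinZr // mulrA.
rewrite /metric_trace (eq_bigr _ (fun p _ => E p (opp_base p))) exchange_big /=.
apply: eq_bigr => q _; rewrite exchange_big /=.
have S r : \sum_p c p q * c (opp_base p) r = pairing (base (opp_base q)) (base (opp_base r)).
  rewrite -[RHS](_ : pairing (g (base (opp_base q))) (g (base (opp_base r))) = _).
    rewrite parseval; apply: eq_bigr => p _; rewrite /c !adj.
    by rewrite pairingC (pairingC (base (opp_base p))).
  by rewrite -fF !gK.
rewrite (eq_bigr (fun r => pairing (base (opp_base q)) (base (opp_base r)) * B (base q) (base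
  r))).
  rewrite {2}(base_expand (base (opp_base q))) bilin_sumr //.
  by apply: eq_bigr => r _; rewrite bilinZr.
by move=> r _; rewrite -mulr_suml S.
Qed.

(* By invariance of the metric, the trace of ad x ad y, and then that of (ad x)^4. *)
Definition killing t x y : R := - metric_trace (fun u v => pairing (lie_br t x u) (lie_br t y v)).
Definition quartic_trace t x : R :=
  metric_trace (fun u v => pairing (lie_br t x (lie_br t x u)) (lie_br t x (lie_br t x v))).
Definition killing_trace t : R := metric_trace (killing t).
Definition killing2_trace t : R := metric_trace (fun u v => metric_trace (fun x y => killing t
  u x * killing t v y)).

Lemma lie_br_linear t k x y z : lie_br t (k *: x + y) z = k *: lie_br t x z + lie_br t y z.
Proof.
rewrite /lie_br !double_bracketE.
have AC (A B C E F H : 'rV[R]_3) :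
  k *: A + B + (k *: C + E) - (k *: F + H) = k *: (A + C - F) + (B + E - H).
  by apply: rvP; rewrite !mxE; ring.
by congr (_, _); rewrite /= !(crossPl, crossPr, bmxTP, bmxP, crossPl, crossPr) AC.
Qed.

Lemma lie_brC t x y : lie_br t x y = - lie_br t y x.
Proof.
have N (p q p' q' : 'rV[R]_3) : p = - p' -> q = - q' -> (p, q) = - (p', q') :> vec.
  by move=> -> ->.
rewrite /lie_br !double_bracketE; apply: N.
  by rewrite (crossC x.1) bmxN; apply: rvP; rewrite !mxE; ring.
by rewrite (crossC x.2) bmxN; apply: rvP; rewrite !mxE; ring.
Qed.

Lemma lie_br_linearr t k x y z : lie_br t z (k *: x + y) = k *: lie_br t z x + lie_br t z y.
Proof. by rewrite lie_brC lie_br_linear opprD -scalerN -!(lie_brC t). Qed.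

Lemma killing_bilin t : bilin (killing t).
Proof.
move=> k u v w; split; rewrite /killing /metric_trace mulrN -opprD; congr (- _);
  rewrite mulr_sumr -big_split; apply: eq_bigr => p _ /=; rewrite lie_br_linear.
- by have [-> _] := pairing_bilin k (lie_br t u (base p)) (lie_br t v (base p)) (lie_br t w
  (base (opp_base p))).
- by have [_ ->] := pairing_bilin k (lie_br t u (base (opp_base p))) (lie_br t v (base
  (opp_base p))) (lie_br t w (base p)).
Qed.

Section Iso.
Variables (t t' : mtriple R) (f g : vec -> vec).
Hypothesis gK : cancel g f.
Hypothesis fF : forall u v, pairing (f u) (f v) = pairing u v.
Hypothesis fB : forall u v, f (lie_br t u v) = lie_br t' (f u) (f v).

Lemma killing_iso x y : killing t' (f x) (f y) = killing t x y.
Proof.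
have Bb : bilin (fun u v => pairing (lie_br t' (f x) u) (lie_br t' (f y) v)).
  move=> k u v w; rewrite !lie_br_linearr.
  have [H1 _] := pairing_bilin k (lie_br t' (f x) u) (lie_br t' (f x) v) (lie_br t' (f y) w).
  by have [_ H2] := pairing_bilin k (lie_br t' (f y) u) (lie_br t' (f y) v) (lie_br t' (f x) w).
rewrite /killing -(metric_trace_isometry Bb gK fF).
by congr (- _); apply: eq_bigr => p _; rewrite -!fB fF.
Qed.

Lemma quartic_trace_iso x : quartic_trace t' (f x) = quartic_trace t x.
Proof.
pose a := lie_br t' (f x).
have Bb : bilin (fun u v => pairing (a (a u)) (a (a v))).
  move=> k u v w; rewrite /a !lie_br_linearr -/a.
  by have [H1 H2] := pairing_bilin k (a (a u)) (a (a v)) (a (a w)).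
rewrite /quartic_trace -(metric_trace_isometry Bb gK fF).
by apply: eq_bigr => p _; rewrite /a -!fB fF.
Qed.

Lemma killing_trace_iso : killing_trace t' = killing_trace t.
Proof.
rewrite /killing_trace -(metric_trace_isometry (killing_bilin t') gK fF).
by apply: eq_bigr => p _; rewrite killing_iso.
Qed.

Lemma killing2_trace_iso : killing2_trace t' = killing2_trace t.
Proof.
have kb := killing_bilin t'.
have B1 u v : bilin (fun x y => killing t' u x * killing t' v y).
  move=> k x y z; have [_ E1] := kb k x y u; have [_ E2] := kb k x y v.
  by rewrite E1 E2; split; ring.
have B2 : bilin (fun u v => metric_trace (fun x y => killing t' u x * killing t' v y)).
  move=> k u v w; rewrite /metric_trace !mulr_sumr -!big_split; split; apply: eq_bigr => p _ /=.
    by have [-> _] := kb k u v (base p); rewrite mulrDl mulrA.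
  by have [-> _] := kb k u v (base (opp_base p)); rewrite mulrDr mulrCA.
rewrite /killing2_trace -(metric_trace_isometry B2 gK fF); apply: eq_bigr => p _.
rewrite -(metric_trace_isometry (B1 _ _) gK fF).
by apply: eq_bigr => q _; rewrite !killing_iso.
Qed.

End Iso.
End Invariants.

(** * Values of the invariants on the normal forms *)

Section FamilyInvariants.
Variable R : realType.
Local Notation vec := ('rV[R]_3 * 'rV[R]_3)%type.
Implicit Types (u v : vec).

Definition vc (x1 x2 x3 p1 p2 p3 : R) : vec := (rv x1 x2 x3, rv p1 p2 p3).

Lemma vc_eta u : u = vc (u.1 0 0) (u.1 0 1) (u.1 0 2) (u.2 0 0) (u.2 0 1) (u.2 0 2).
Proof. by case: u => x xi; rewrite /vc -!rv_eta. Qed.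

Lemma metric_traceE (B : vec -> vec -> R) : metric_trace B =
  B (vc 1 0 0 0 0 0) (vc 0 0 0 1 0 0) + B (vc 0 1 0 0 0 0) (vc 0 0 0 0 1 0) +
  B (vc 0 0 1 0 0 0) (vc 0 0 0 0 0 1) + (B (vc 0 0 0 1 0 0) (vc 1 0 0 0 0 0) +
  B (vc 0 0 0 0 1 0) (vc 0 1 0 0 0 0) + B (vc 0 0 0 0 0 1) (vc 0 0 1 0 0 0)).
Proof.
rewrite /metric_trace -(pair_bigA _ (fun b i => B (base R (b, i)) (base R (opp_base (b, i))))) /=.
rewrite big_bool /= !sum3 /base /= /vc.
have d0 : delta_mx 0 0 = rv 1 0 0 :> 'rV[R]_3 by apply: rvP; rewrite !(mxE, rvE).
have d1 : delta_mx 0 1 = rv 0 1 0 :> 'rV[R]_3 by apply: rvP; rewrite !(mxE, rvE).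
have d2 : delta_mx 0 2 = rv 0 0 1 :> 'rV[R]_3 by apply: rvP; rewrite !(mxE, rvE).
by rewrite d0 d1 d2 zero_rv.
Qed.

Lemma pairing_vc x1 x2 x3 p1 p2 p3 y1 y2 y3 q1 q2 q3 :
  pairing (vc x1 x2 x3 p1 p2 p3) (vc y1 y2 y3 q1 q2 q3) =
  x1 * q1 + x2 * q2 + x3 * q3 + (p1 * y1 + p2 * y2 + p3 * y3).
Proof. by rewrite /pairing /= !dot_rv. Qed.

Definition lie_br_diag (s1 s2 s3 al t1 t2 t3 be x1 x2 x3 p1 p2 p3 y1 y2 y3 q1 q2 q3 : R) :
  lie_br (diag s1 s2 s3 al 0 0 t1 t2 t3 be 0 0) (vc x1 x2 x3 p1 p2 p3) (vc y1 y2 y3 q1 q2 q3) =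
  vc _ _ _ _ _ _ := diag_bracket s1 s2 s3 al t1 t2 t3 be x1 x2 x3 p1 p2 p3 y1 y2 y3 q1 q2 q3.

Lemma killing_semi al s2 s3 t x1 x2 x3 p1 p2 p3 y1 y2 y3 q1 q2 q3 :
  killing (semi al s2 s3 t) (vc x1 x2 x3 p1 p2 p3) (vc y1 y2 y3 q1 q2 q3) =
  4 * (al ^+ 2 - s2 * s3) * x1 * y1.
Proof. rewrite /killing metric_traceE !lie_br_diag !pairing_vc; ring. Qed.

Lemma killing_twin al s2 s3 k x1 x2 x3 p1 p2 p3 y1 y2 y3 q1 q2 q3 :
  killing (twin al s2 s3 k) (vc x1 x2 x3 p1 p2 p3) (vc y1 y2 y3 q1 q2 q3) =
  4 * (al ^+ 2 - s2 * s3) * (x1 * y1 + k * s2 * (p2 * y3 + x3 * q2) -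
     k * s3 * (p3 * y2 + x2 * q3) - k ^+ 2 * s2 * s3 * p1 * q1) -
  8 * al * k * s2 * s3 * (p1 * y1 + p2 * y2 + p3 * y3 + x1 * q1 + x2 * q2 + x3 * q3).
Proof. rewrite /killing metric_traceE !lie_br_diag !pairing_vc; ring. Qed.

Lemma killing_mt9_1 x1 x2 x3 p1 p2 p3 y1 y2 y3 q1 q2 q3 :
  killing (mt9_1 R) (vc x1 x2 x3 p1 p2 p3) (vc y1 y2 y3 q1 q2 q3) =
  - 4 * (x1 * y1 + x2 * y2 + x3 * y3).
Proof. rewrite mt9_1E /killing metric_traceE !lie_br_diag !pairing_vc; ring. Qed.

Lemma killing_mt5_2ii x1 x2 x3 p1 p2 p3 y1 y2 y3 q1 q2 q3 :
  killing (mt5_2ii R) (vc x1 x2 x3 p1 p2 p3) (vc y1 y2 y3 q1 q2 q3) =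
  4 * (x1 * y1 + p2 * y3 + x3 * q2).
Proof. rewrite mt5_2iiE /killing metric_traceE !lie_br_diag !pairing_vc; ring. Qed.

(** The eigenvalues of ad u, besides 0 twice, are +-x_1 (al +- w) with w^2 = -s2 s3; [killing_semi]
    is their second power sum and this is their fourth. *)
Lemma quartic_trace_semi al s2 s3 t x1 x2 x3 p1 p2 p3 :
  quartic_trace (semi al s2 s3 t) (vc x1 x2 x3 p1 p2 p3) =
  4 * (al ^+ 4 - 6 * al ^+ 2 * (s2 * s3) + (s2 * s3) ^+ 2) * x1 ^+ 4.
Proof. rewrite /quartic_trace metric_traceE !lie_br_diag !pairing_vc; ring. Qed.

Lemma killing_trace_semi al s2 s3 t : killing_trace (semi al s2 s3 t : mtriple R) = 0.
Proof. rewrite /killing_trace metric_traceE !killing_semi; ring. Qed.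
Lemma killing_trace_twin al s2 s3 k : killing_trace (twin al s2 s3 k : mtriple R) =
  - 48 * al * k * s2 * s3.
Proof. rewrite /killing_trace metric_traceE !killing_twin; ring. Qed.
Lemma killing_trace_mt9_1 : killing_trace (mt9_1 R) = 0.
Proof. rewrite /killing_trace metric_traceE !killing_mt9_1; ring. Qed.
Lemma killing_trace_mt5_2ii : killing_trace (mt5_2ii R) = 0.
Proof. rewrite /killing_trace metric_traceE !killing_mt5_2ii; ring. Qed.

Lemma killing2_trace_semi al s2 s3 t : killing2_trace (semi al s2 s3 t : mtriple R) = 0.
Proof. rewrite /killing2_trace !metric_traceE !killing_semi; ring. Qed.
Lemma killing2_trace_twin al s2 s3 k : killing2_trace (twin al s2 s3 k : mtriple R) =
  - 96 * k ^+ 2 * (s2 * s3) * (al ^+ 4 - 6 * al ^+ 2 * (s2 * s3) + (s2 * s3) ^+ 2).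
Proof. rewrite /killing2_trace !metric_traceE !killing_twin; ring. Qed.
Lemma killing2_trace_mt9_1 : killing2_trace (mt9_1 R) = 0.
Proof. rewrite /killing2_trace !metric_traceE !killing_mt9_1; ring. Qed.
Lemma killing2_trace_mt5_2ii : killing2_trace (mt5_2ii R) = 0.
Proof. rewrite /killing2_trace !metric_traceE !killing_mt5_2ii; ring. Qed.

End FamilyInvariants.

Section JordanInvariants.
Variable R : realType.
Local Notation vec := ('rV[R]_3 * 'rV[R]_3)%type.
Implicit Types (u v : vec) (t : mtriple R).

(* The second term cancels the semisimple part of [ad u], so that
   in classes 15 to 17 the form is semidefinite with the sign of the nilpotent part. *)
Definition jordan_form t u v : R :=
  pairing (lie_br t u (lie_br t u v)) (lie_br t u (lie_br t u v))
  + killing t u u / 4 * pairing (lie_br t u v) (lie_br t u v).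

Lemma jordan_form70 (t : R) x1 x2 x3 p1 p2 p3 y1 y2 y3 q1 q2 q3 :
  jordan_form (semi 0 1 1 t) (vc x1 x2 x3 p1 p2 p3) (vc y1 y2 y3 q1 q2 q3) =
  2 * t * x1 ^+ 2 * ((p2 * y1 - q2 * x1) ^+ 2 + (p3 * y1 - q3 * x1) ^+ 2).
Proof. by rewrite /jordan_form killing_semi !lie_br_diag !pairing_vc; field. Qed.

Lemma jordan_form_5_1 (x1 x2 x3 p1 p2 p3 y1 y2 y3 q1 q2 q3 : R) :
  jordan_form (semi 1 0 0 0) (vc x1 x2 x3 p1 p2 p3) (vc y1 y2 y3 q1 q2 q3) = 0.
Proof. by rewrite /jordan_form killing_semi !lie_br_diag !pairing_vc; field. Qed.

(** The Jordan block of ad X_1 in Bianchi 4 survives in the form, which vanishes identically for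
    Bianchi 5: this separates class 12 from class 11. *)
Lemma jordan_form_4_1 : jordan_form (semi 1 0 1 0) (vc 1 0 0 0 0 0) (vc 0 1 0 0 0 1) = - 4.
Proof. by rewrite /jordan_form killing_semi !lie_br_diag !pairing_vc; field. Qed.

(** Lengths of brackets are semidefinite with the sign of t, which separates classes 19 to 21. *)
Lemma square_nil (t : R) x1 x2 x3 p1 p2 p3 y1 y2 y3 q1 q2 q3 :
  let u := lie_br (semi 0 1 0 t) (vc x1 x2 x3 p1 p2 p3) (vc y1 y2 y3 q1 q2 q3) in
  pairing u u = 2 * t * (p2 * y1 - q2 * x1) ^+ 2.
Proof. rewrite /= !lie_br_diag !pairing_vc; ring. Qed.

(* A cubic identity for ad u modulo the metric and the Killing operator, whose coefficient m
   separates the doubles of class 7. *)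
Definition cubic_relation t (m : R) := forall u v w : vec,
  pairing (lie_br t u (lie_br t u (lie_br t u v))) w =
  killing t u u / 4 * pairing (lie_br t u v) w
  + (pairing u u / 4 + m * killing t u u) * killing t (lie_br t u v) w.

End JordanInvariants.

Section Distinct.
Variable R : realType.
Local Notation vec := ('rV[R]_3 * 'rV[R]_3)%type.
Implicit Types (t : mtriple R) (u v w : vec) (c : dclass R).
Local Notation pairing := (@pairing R).

Lemma eqv_data t t' : eqv t t' -> exists f g : vec -> vec,
  [/\ cancel f g, cancel g f, forall u v, pairing (f u) (f v) = pairing u v
    & forall u v, f (lie_br t u v) = lie_br t' (f u) (f v)].
Proof.
case=> f [[g fK gK] fB fF]; exists f, g; split; [exact: fK|exact: gK| |exact: fB].
by move=> u v; have := fF u v; rewrite [LHS]formE [RHS]formE.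
Qed.

Lemma killing_trace_eqv t t' : eqv t t' -> killing_trace t = killing_trace t'.
Proof. by case/eqv_data => f [g [fK gK fF fB]]; rewrite -(killing_trace_iso gK fF fB). Qed.

Lemma killing2_trace_eqv t t' : eqv t t' -> killing2_trace t = killing2_trace t'.
Proof. by case/eqv_data => f [g [fK gK fF fB]]; rewrite -(killing2_trace_iso gK fF fB). Qed.

Definition rank1 t := forall u v, killing t u v ^+ 2 = killing t u u * killing t v v.
Definition positive t := exists u, 0 < killing t u u.

Lemma rank1_eqv t t' : eqv t t' -> rank1 t' -> rank1 t.
Proof.
by case/eqv_data => f [g [fK gK fF fB]] H u v; rewrite -!(killing_iso gK fF fB).
Qed.

Lemma positive_eqv t t' : eqv t t' -> positive t -> positive t'.
Proof.
by case/eqv_data => f [g [fK gK fF fB]] [u H]; exists (f u); rewrite (killing_iso gK fF fB).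
Qed.

Lemma cubic_eqv t t' m : eqv t t' -> cubic_relation t' m -> cubic_relation t m.
Proof.
case/eqv_data => f [g [fK gK fF fB]] H u v w.
have := H (f u) (f v) (f w).
by rewrite -!fB !fF !(killing_iso gK fF fB).
Qed.

Lemma killing_axial (s t x1 x2 x3 p1 p2 p3 y1 y2 y3 q1 q2 q3 : R) :
  killing (axial 1 0 s 0 t 0) (vc x1 x2 x3 p1 p2 p3) (vc y1 y2 y3 q1 q2 q3) =
  4 * (x1 * y1 - t * (p3 * y2 + x2 * q3)).
Proof. rewrite /killing metric_traceE !lie_br_diag !pairing_vc; ring. Qed.

(** Class 7 is the case of third entry 1 and t = b, hence m = 1 / (8 b); class 6 is the case of
    third entry 0, hence m = 0. *)
Lemma cubic_axial (t m : R) : cubic_relation (axial 1 0 (8 * t * m) 0 t 0) m.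
Proof.
move=> u v w; rewrite (vc_eta u) (vc_eta v) (vc_eta w) !killing_axial !lie_br_diag
  killing_axial !pairing_vc.
by field.
Qed.

Lemma cubic_mt5_2ii : cubic_relation (mt5_2ii R) 0.
Proof.
apply: (@cubic_eqv _ (@axial R 1 0 (8 * 1 * 0) 0 1 0)); last exact: cubic_axial.
by rewrite mulr0 mt5_2iiE; apply: (@axial_swap R).
Qed.

Lemma cubic_twin (b : R) : b != 0 -> cubic_relation (twin 1 0 1 b) (8 * b)^-1.
Proof.
move=> b0; suff -> : twin 1 0 1 b = @axial R 1 0 (8 * b * (8 * b)^-1) 0 b 0 by apply: cubic_axial.
by rewrite /twin /axial; congr diag; field.
Qed.

Lemma jordan_eqv t t' : eqv t t' -> exists f : vec -> vec,
  forall u v, jordan_form t u v = jordan_form t' (f u) (f v).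
Proof.
case/eqv_data => f [g [fK gK fF fB]]; exists f => u v.
by rewrite /jordan_form -!fB !fF !(killing_iso gK fF fB).
Qed.

Lemma square_eqv t t' : eqv t t' -> exists f : vec -> vec,
  forall u v, pairing (lie_br t u v) (lie_br t u v) =
    pairing (lie_br t' (f u) (f v)) (lie_br t' (f u) (f v)).
Proof.
by case/eqv_data => f [g [fK gK fF fB]]; exists f => u v; rewrite -!fB !fF.
Qed.

(** [y] is the first coordinate of the image of X_1. The Killing form scales by y^2 and gives [k];
    the fourth power trace scales by y^4 and, after subtracting k^2 and dividing, gives [d]. *)
Lemma semi_eqv al s2 s3 (t : R) al' s2' s3' (t' : R) :
  eqv (semi al s2 s3 t) (semi al' s2' s3' t') -> exists y,
  let k := al ^+ 2 - s2 * s3 in let k' := al' ^+ 2 - s2' * s3' in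
  let d := - (al ^+ 2 * (s2 * s3)) in let d' := - (al' ^+ 2 * (s2' * s3')) in
  k = k' * y ^+ 2 /\ d = d' * y ^+ 4.
Proof.
case/eqv_data => f [g [fK gK fF fB]].
have := killing_iso gK fF fB (vc 1 0 0 0 0 0) (vc 1 0 0 0 0 0).
have := quartic_trace_iso gK fF fB (vc 1 0 0 0 0 0).
rewrite (vc_eta (f _)); move: ((f _).1 0 0) ((f _).1 0 1) ((f _).1 0 2) ((f _).2 0 0) ((f _).2
  0 1) ((f _).2 0 2).
move=> y y2 y3 q1 q2 q3; rewrite !killing_semi !quartic_trace_semi => E4 E2; exists y => /=.
have K : al ^+ 2 - s2 * s3 = (al' ^+ 2 - s2' * s3') * y ^+ 2.
  have -> : al ^+ 2 - s2 * s3 = 4 * (al ^+ 2 - s2 * s3) * 1 * 1 / 4 by field.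
  by rewrite -E2; field.
split=> //.
have Q : al ^+ 4 - 6 * al ^+ 2 * (s2 * s3) + (s2 * s3) ^+ 2 =
   (al' ^+ 4 - 6 * al' ^+ 2 * (s2' * s3') + (s2' * s3') ^+ 2) * y ^+ 4.
  have -> : al ^+ 4 - 6 * al ^+ 2 * (s2 * s3) + (s2 * s3) ^+ 2 =
    4 * (al ^+ 4 - 6 * al ^+ 2 * (s2 * s3) + (s2 * s3) ^+ 2) * 1 ^+ 4 / 4 by field.
  by rewrite -E4; field.
have -> : - (al ^+ 2 * (s2 * s3)) = ((al ^+ 4 - 6 * al ^+ 2 * (s2 * s3) + (s2 * s3) ^+ 2)
   - (al ^+ 2 - s2 * s3) ^+ 2) / 4 by field.
by rewrite Q K; field.
Qed.

(* 0: nonzero trace invariants; 2: Killing form of rank at most 1. *)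
Definition kind c : nat :=
  match c with
  | Class1 _ | Class2 _ | Class3 _ _ | Class4 _ _ | Class8 _ => 0
  | Class5 | Class6 | Class7 _ => 1
  | _ => 2
  end.

Definition killing_trace_table c : R := match c with Class3 _ b | Class4 _ b | Class8 b => - 48
  * b | _ => 0 end.
(** In classes 3, 4 and 8 a sixth of the squared trace is split off: the remainder is nonpositive
    for class 3 and positive for classes 4 and 8. *)
Definition killing2_trace_table c : R :=
  match c with
  | Class1 b => - 96 * b ^+ 2
  | Class2 b => 96 * b ^+ 2
  | Class3 a b => killing_trace_table c ^+ 2 / 6 - 96 * (b / a) ^+ 2 * (a ^+ 2 - 1) ^+ 2
  | Class4 a b => killing_trace_table c ^+ 2 / 6 + 96 * (b / a) ^+ 2 * (a ^+ 2 + 1) ^+ 2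
  | Class8 b => killing_trace_table c ^+ 2 / 6 + 384 * b ^+ 2
  | _ => 0
  end.

Lemma killing_trace_canon c : in_range c -> killing_trace (canon c) = killing_trace_table c.
Proof.
case: c => [b|b|a b|a b| | |b|b|a|a| | | |a| | | | | | | |] /=;
  rewrite ?killing_trace_semi ?killing_trace_twin ?killing_trace_mt9_1 ?killing_trace_mt5_2ii
    //; try by move=> _; ring.
- move=> [a1 _]; have a0 : a != 0 by rewrite gt_eqF // (lt_le_trans ltr01 a1).
  by field.
- move=> [a1 _]; have a0 : a != 0 by rewrite gt_eqF // (lt_trans ltr01 a1).
  by field.
Qed.

Lemma killing2_trace_canon c : in_range c -> killing2_trace (canon c) = killing2_trace_table c.
Proof.
case: c => [b|b|a b|a b| | |b|b|a|a| | | |a| | | | | | | |] /=;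
  rewrite ?killing2_trace_semi ?killing2_trace_twin ?killing2_trace_mt9_1
    ?killing2_trace_mt5_2ii //; try by move=> _; field.
- move=> [a1 _]; have a0 : a != 0 by rewrite gt_eqF // (lt_le_trans ltr01 a1).
  by field.
- move=> [a1 _]; have a0 : a != 0 by rewrite gt_eqF // (lt_trans ltr01 a1).
  by field.
Qed.

Lemma rank1_semi al s2 s3 (t : R) : rank1 (semi al s2 s3 t).
Proof. by move=> u v; rewrite (vc_eta u) (vc_eta v) !killing_semi; ring. Qed.

Lemma not_rank1 c : in_range c -> kind c = 1 -> ~ rank1 (canon c).
Proof.
case: c => //= [_ _ H|_ _ H|b /eqP b0 _ H].
- by have := H (vc 1 0 0 0 0 0) (vc 0 1 0 0 0 0); rewrite !killing_mt9_1; lra.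
- by have := H (vc 0 0 0 0 1 0) (vc 0 0 1 0 0 0); rewrite !killing_mt5_2ii; lra.
- have := H (vc 0 0 0 0 0 1) (vc 0 1 0 0 0 0); rewrite !killing_twin => E.
  have /eqP : (4 * b) ^+ 2 = 0 by move: E; rewrite !(mulr0, mul0r); lra.
  by rewrite sqrf_eq0 mulf_eq0 pnatr_eq0 /= (negPf b0).
Qed.

Lemma rank1_kind c : kind c = 2 -> rank1 (canon c).
Proof. by case: c => //= *; apply: rank1_semi. Qed.

Lemma tables_kind c : in_range c -> killing_trace_table c = 0 -> killing2_trace_table c = 0 ->
  kind c <> 0.
Proof.
have sq (b : R) : b != 0 -> 0 < b ^+ 2 by move=> b0; rewrite exprn_even_gt0.
case: c => //= [b b0|b b0|a b [a1 /eqP b0]|a b [a1 /eqP b0]|b /eqP b0] E1 E2 _.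
- have := sq b; rewrite gt_eqF // => /(_ isT); lra.
- have := sq b; rewrite gt_eqF // => /(_ isT); lra.
- by case/eqP: b0; lra.
- by case/eqP: b0; lra.
- by case/eqP: b0; lra.
Qed.

Lemma tables_zero c : kind c <> 0 -> killing_trace_table c = 0 /\ killing2_trace_table c = 0.
Proof. by case: c. Qed.

Lemma kind_eqv c c' : in_range c -> in_range c' -> eqv (canon c) (canon c') -> kind c = kind c'.
Proof.
(* An inequality suffices, because isomorphism is symmetric: vanishing traces exclude kind 0, and a
   Killing form of rank at most 1 excludes kind 1. *)
have half d d' : in_range d -> in_range d' -> eqv (canon d) (canon d') -> (kind d <= kind d')%N.
  move=> rd rd' e; have E1 := killing_trace_eqv e; have E2 := killing2_trace_eqv e.
  rewrite !killing_trace_canon // in E1; rewrite !killing2_trace_canon // in E2.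
  case kE : (kind d') => [|[|k]].
  - suff : ~ kind d <> 0%N by case: (kind d) => // n; case.
    by move=> /tables_zero[z1 z2]; apply: (tables_kind rd') => //; rewrite -?E1 -?E2.
  - case kE' : (kind d) => [|[|[|k]]] //.
      by case: (not_rank1 rd' kE); apply: rank1_eqv (isomorphic_sym e) _; apply: rank1_kind.
    by case: d kE' {rd e E1 E2}.
  - have -> : k = 0%N by case: d' kE {rd' e E1 E2} => //= *; congruence.
    by case: d {rd e E1 E2}.
move=> r r' e; apply/eqP; rewrite eqn_leq !half //; exact: isomorphic_sym.
Qed.

End Distinct.

(** * Classes separated by the Killing traces and the cubic identity *)

Section Injectivity.
Variable R : realType.
Local Notation vec := ('rV[R]_3 * 'rV[R]_3)%type.
Implicit Types (t : mtriple R) (u v w : vec) (c : dclass R).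
Local Notation pairing := (@pairing R).

Lemma eq_sqr_pos (x y : R) : 0 < x -> 0 < y -> x ^+ 2 = y ^+ 2 -> x = y.
Proof.
move=> x0 y0 /eqP; rewrite eqf_sqr => /orP[/eqP//|/eqP E].
by move: x0; rewrite E oppr_gt0 ltNge ltW.
Qed.

(** The quotient is (a - 1/a)^2, and a - 1/a is nonnegative and increasing for a >= 1. *)
Lemma minus_inverse_inj (a a' : R) : 1 <= a -> 1 <= a' ->
  (a ^+ 2 - 1) ^+ 2 / a ^+ 2 = (a' ^+ 2 - 1) ^+ 2 / a' ^+ 2 -> a = a'.
Proof.
move=> a1 a1' E; have a0 : 0 < a := lt_le_trans ltr01 a1.
have a0' : 0 < a' := lt_le_trans ltr01 a1'.
have n : a != 0 by rewrite gt_eqF.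
have n' : a' != 0 by rewrite gt_eqF.
have E2 : ((a ^+ 2 - 1) * a') ^+ 2 = ((a' ^+ 2 - 1) * a) ^+ 2.
  rewrite (_ : _ ^+ 2 = (a ^+ 2 - 1) ^+ 2 / a ^+ 2 * (a * a') ^+ 2); last by field.
  by rewrite E; field.
have p x y : 1 <= x -> 0 < y -> 0 <= (x ^+ 2 - 1) * y.
  by move=> x1 y0; apply: mulr_ge0; [rewrite subr_ge0 exprn_ege1|exact: ltW].
have /eqP : (a ^+ 2 - 1) * a' = (a' ^+ 2 - 1) * a.
  by apply/eqP; rewrite -(eqrXn2 (n := 2)) // ?p //; apply/eqP.
rewrite -subr_eq0 (_ : _ - _ = (a - a') * (a * a' + 1)); last by ring.
rewrite mulf_eq0 => /orP[|/eqP]; first by rewrite subr_eq0 => /eqP.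
by move=> H; have := mulr_gt0 a0 a0'; lra.
Qed.

(** (a + 1/a)^2 and (a - 1/a)^2 differ by 4. *)
Lemma plus_inverse_inj (a a' : R) : 1 < a -> 1 < a' ->
  (a ^+ 2 + 1) ^+ 2 / a ^+ 2 = (a' ^+ 2 + 1) ^+ 2 / a' ^+ 2 -> a = a'.
Proof.
move=> a1 a1' E; have a0 : 0 < a := lt_trans ltr01 a1.
have a0' : 0 < a' := lt_trans ltr01 a1'.
apply: minus_inverse_inj; [exact: ltW|exact: ltW|].
have n : a != 0 by rewrite gt_eqF.
have n' : a' != 0 by rewrite gt_eqF.
have S (x : R) : x != 0 -> (x ^+ 2 - 1) ^+ 2 / x ^+ 2 = (x ^+ 2 + 1) ^+ 2 / x ^+ 2 - 4.
  by move=> x0; field.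
by rewrite !S // E.
Qed.

(** The first trace vanishes in classes 1 and 2 only, where the second gives the sign and b^2.
    Otherwise the first gives b, and the remainder of the second, divided by b^2, is governed by (a
    - 1/a)^2: it enters class 3 with a minus sign, and class 4 increased by 4, which exceeds the
    value 4 of class 8. *)
Lemma kind0_inj c c' : in_range c -> in_range c' -> kind c = 0 -> kind c' = 0 ->
  killing_trace_table c = killing_trace_table c' ->
    killing2_trace_table c = killing2_trace_table c' -> c = c'.
Proof.
have sq (b : R) : b != 0 -> 0 < b ^+ 2 by move=> b0; rewrite exprn_even_gt0.
have d3 (a b : R) : a != 0 -> 96 * (b / a) ^+ 2 * (a ^+ 2 - 1) ^+ 2 =
    96 * (b ^+ 2 * ((a ^+ 2 - 1) ^+ 2 / a ^+ 2)).
  by move=> a0; field.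
have d4 (a b : R) : a != 0 -> 96 * (b / a) ^+ 2 * (a ^+ 2 + 1) ^+ 2 =
    96 * (b ^+ 2 * ((a ^+ 2 - 1) ^+ 2 / a ^+ 2 + 4)).
  by move=> a0; field.
have p3 (a : R) : 0 <= (a ^+ 2 - 1) ^+ 2 / a ^+ 2 by rewrite divr_ge0 // sqr_ge0.
have p4 (a : R) : 1 < a -> 0 < (a ^+ 2 - 1) ^+ 2 / a ^+ 2.
  move=> a1; have a0 := lt_trans ltr01 a1; rewrite divr_gt0 // ?exprn_gt0 //.
  by rewrite subr_gt0 exprn_egt1.
have n3 (a : R) : 1 <= a -> a != 0 by move=> a1; rewrite gt_eqF // (lt_le_trans ltr01 a1).
have n4 (a : R) : 1 < a -> a != 0 by move=> a1; apply: n3; apply: ltW.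
have np (b : R) : b != 0 -> 0 < b ^+ 2 := sq b.
case: c => [b|b|a b|a b| | |b|b|a|a| | | |a| | | | | | | |] //;
case: c' => [b'|b'|a' b'|a' b'| | |b'|b'|a'|a'| | | |a'| | | | | | | |] //= r r' _ _ E1 E2.
- by congr Class1; apply: eq_sqr_pos => //; lra.
- exfalso; have := exprn_gt0 2 r; have := exprn_gt0 2 r'; lra.
- by exfalso; case: r' => _ H; case: H; lra.
- by exfalso; case: r' => _ H; case: H; lra.
- by exfalso; case: r'; lra.
- exfalso; have := exprn_gt0 2 r; have := exprn_gt0 2 r'; lra.
- by congr Class2; apply: eq_sqr_pos => //; lra.
- by exfalso; case: r' => _ H; case: H; lra.
- by exfalso; case: r' => _ H; case: H; lra.
- by exfalso; case: r'; lra.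
- by exfalso; case: r => _ H; case: H; lra.
- by exfalso; case: r => _ H; case: H; lra.
- have bb : b = b' by lra.
  case: r r' => a1 /eqP b0 [a1' _]; subst b'; congr Class3.
  apply: minus_inverse_inj => //; move: E2; rewrite !d3 ?n3 // => E2.
  by apply: (mulfI (lt0r_neq0 (np _ b0))); lra.
- exfalso; have bb : b = b' by lra.
  case: r r' => a1 /eqP b0 [a1' _]; subst b'.
  move: E2; rewrite (d3 _ _ (n3 _ a1)) (d4 _ _ (n4 _ a1')) => E2.
  have := mulr_ge0 (ltW (np _ b0)) (p3 a); have := mulr_gt0 (np _ b0) (p4 _ a1');
    have := np _ b0; lra.
- exfalso; have bb : b = b' by lra.
  case: r r' => a1 /eqP b0 _; subst b'.
  move: E2; rewrite d3 ?n3 // => E2.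
  by have := mulr_ge0 (ltW (np _ b0)) (p3 a); have := np _ b0; lra.
- by exfalso; case: r => _ H; case: H; lra.
- by exfalso; case: r => _ H; case: H; lra.
- exfalso; have bb : b = b' by lra.
  case: r r' => a1 /eqP b0 [a1' _]; subst b'.
  move: E2; rewrite (d3 _ _ (n3 _ a1')) (d4 _ _ (n4 _ a1)) => E2.
  have := mulr_ge0 (ltW (np _ b0)) (p3 a'); have := mulr_gt0 (np _ b0) (p4 _ a1);
    have := np _ b0; lra.
- have bb : b = b' by lra.
  case: r r' => a1 /eqP b0 [a1' _]; subst b'; congr Class4.
  apply: minus_inverse_inj; [exact: ltW|exact: ltW|]; move: E2; rewrite !d4 ?n4 // => E2.
  by apply: (mulfI (lt0r_neq0 (np _ b0))); lra.
- exfalso; have bb : b = b' by lra.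
  case: r r' => a1 /eqP b0 _; subst b'.
  move: E2; rewrite d4 ?n4 // => E2.
  by have := mulr_gt0 (np _ b0) (p4 _ a1); lra.
- by exfalso; case: r; lra.
- by exfalso; case: r; lra.
- exfalso; have bb : b = b' by lra.
  case: r' => a1' _; move/eqP: r => b0; subst b'.
  move: E2; rewrite d3 ?n3 // => E2.
  by have := mulr_ge0 (ltW (np _ b0)) (p3 a'); have := np _ b0; lra.
- exfalso; have bb : b = b' by lra.
  case: r' => a1' _; move/eqP: r => b0; subst b'.
  move: E2; rewrite d4 ?n4 // => E2.
  by have := mulr_gt0 (np _ b0) (p4 _ a1'); lra.
- by congr Class8; lra.
Qed.

Lemma negative_mt9_1 : ~ positive (mt9_1 R).
Proof.
case=> u; rewrite (vc_eta u) killing_mt9_1 -!expr2 => H.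
have := sqr_ge0 (u.1 0 0); have := sqr_ge0 (u.1 0 1); have := sqr_ge0 (u.1 0 2); lra.
Qed.

Lemma positive_mt5_2ii : positive (mt5_2ii R).
Proof. by exists (vc 1 0 0 0 0 0); rewrite killing_mt5_2ii; lra. Qed.

Lemma positive_twin (b : R) : positive (twin 1 0 1 b).
Proof. by exists (vc 1 0 0 0 0 0); rewrite killing_twin; lra. Qed.

(** Subtracting the two relations leaves m - m' times the nonzero product of Killing values. *)
Lemma cubic_unique t (m m' : R) u v w : killing t u u * killing t (lie_br t u v) w != 0 ->
  cubic_relation t m -> cubic_relation t m' -> m = m'.
Proof.
move=> n0 H H'; have := H u v w; rewrite H' => E; apply/esym/(mulfI n0).
by move: E; move: (pairing _ _) (pairing u u) => x y E; lra.
Qed.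

Lemma cubic_unique_twin (b m m' : R) : b != 0 ->
  cubic_relation (twin 1 0 1 b) m -> cubic_relation (twin 1 0 1 b) m' -> m = m'.
Proof.
move=> b0; apply: (@cubic_unique _ _ _ (vc 1 0 0 0 0 0) (vc 0 0 0 0 0 1) (vc 0 1 0 0 0 0)).
rewrite lie_br_diag !killing_twin; apply/eqP => E; case/eqP: b0; lra.
Qed.

(** Class 5 is singled out by a Killing form without positive values; among classes 6 and 7, the
    cubic coefficient is 0 or 1 / (8 b). *)
Lemma kind1_inj c c' : in_range c -> in_range c' -> kind c = 1 -> kind c' = 1 ->
  eqv (canon c) (canon c') -> c = c'.
Proof.
have i8 (b : R) : b != 0 -> (8 * b)^-1 != 0 by move=> b0; rewrite invr_eq0 mulf_neq0 // pnatr_eq0.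
case: c => [b|b|a b|a b| | |b|b|a|a| | | |a| | | | | | | |] //;
case: c' => [b'|b'|a' b'|a' b'| | |b'|b'|a'|a'| | | |a'| | | | | | | |] //= r r' _ _ e.
- by case: negative_mt9_1; apply: positive_eqv (isomorphic_sym e) positive_mt5_2ii.
- by case: negative_mt9_1; apply: positive_eqv (isomorphic_sym e) (positive_twin b').
- by case: negative_mt9_1; apply: positive_eqv e positive_mt5_2ii.
- move/eqP: r' => b0.
  have := cubic_unique_twin b0 (cubic_twin b0) (cubic_eqv (isomorphic_sym e) (@cubic_mt5_2ii R)).
  by move/eqP; rewrite (negPf (i8 _ b0)).
- by case: negative_mt9_1; apply: positive_eqv e (positive_twin b).
- move/eqP: r => b0.
  have := cubic_unique_twin b0 (cubic_twin b0) (cubic_eqv e (@cubic_mt5_2ii R)).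
  by move/eqP; rewrite (negPf (i8 _ b0)).
- move/eqP: r => b0; move/eqP: r' => b0'.
  have := cubic_unique_twin b0 (cubic_twin b0) (cubic_eqv e (cubic_twin b0')).
  by move/invr_inj/mulfI => H; congr Class7; apply: H; rewrite pnatr_eq0.
Qed.

End Injectivity.

(** * Classes whose Killing form has rank at most 1 *)

Section SolvableClasses.
Variable R : realType.
Local Notation vec := ('rV[R]_3 * 'rV[R]_3)%type.
Implicit Types (t : mtriple R) (u v w : vec) (c : dclass R).
Local Notation pairing := (@pairing R).

Definition semi_param c : R * R * R * R :=
  match c with
  | Class9 a | Class14 a => (a, 1, 1, 0)
  | Class10 a => (a, 1, -1, 0)
  | Class11 => (1, 0, 0, 0)
  | Class12 => (1, 0, 1, 0)
  | Class13 => (1, 1, -1, 0)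
  | Class15 => (0, 1, 1, 0)
  | Class16 => (0, 1, 1, 1)
  | Class17 => (0, 1, 1, -1)
  | Class18 => (1, 1, 1, 0)
  | Class19 => (0, 1, 0, 0)
  | Class20 => (0, 1, 0, 1)
  | Class21 => (0, 1, 0, -1)
  | _ => (0, 0, 0, 0)
  end.

Lemma canon_semi c : kind c = 2 -> canon c =
  let '(al, s2, s3, t) := semi_param c in semi al s2 s3 t.
Proof. by case: c. Qed.

Definition kappa c : R := let '(al, s2, s3, _) := semi_param c in al ^+ 2 - s2 * s3.
Definition delta c : R := let '(al, s2, s3, _) := semi_param c in - (al ^+ 2 * (s2 * s3)).

Lemma kappa_delta_eqv c c' : kind c = 2 -> kind c' = 2 -> eqv (canon c) (canon c') ->
  exists y, kappa c = kappa c' * y ^+ 2 /\ delta c = delta c' * y ^+ 4.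
Proof.
move=> k2 k2'; rewrite !canon_semi // /kappa /delta.
case: (semi_param c) => [[[al s2] s3] t]; case: (semi_param c') => [[[al' s2'] s3'] t'].
exact: semi_eqv.
Qed.

(** Groups the classes by the signs of [kappa] and [delta]. Within a group, the parameters and the
    nilpotent parts remain to be told apart. *)
Definition tag c : nat :=
  match c with
  | Class9 _ => 0 | Class11 | Class12 => 1 | Class10 _ | Class13 => 2
  | Class14 _ => 3 | Class15 | Class16 | Class17 => 4 | Class18 => 5 | _ => 6
  end.

Definition signs c := [:: 0 < kappa c; kappa c < 0; 0 < delta c; delta c < 0].
Definition tag_signs (n : nat) : seq bool :=
  match n with
  | 0 => [:: true; false; false; true] | 1 => [:: true; false; false; false]
  | 2 => [:: true; false; true; false] | 3 => [:: false; true; false; true]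
  | 4 => [:: false; true; false; false] | 5 => [:: false; false; false; true]
  | _ => [:: false; false; false; false]
  end.

Lemma signs_tag c : in_range c -> kind c = 2 -> signs c = tag_signs (tag c).
Proof.
have T (x : bool) : x -> x = true by case: x.
have F (x : bool) : ~~ x -> x = false by case: x.
case: c => [b|b|a b|a b| | |b|b|a|a| | | |a| | | | | | | |] //= r _;
  rewrite /signs /kappa /delta /=; congr [:: _; _; _; _];
  try (by apply: T; lra); try (by apply: F; rewrite -leNgt; lra).
- by apply: T; rewrite mulr1 subr_gt0 exprn_egt1.
- by apply: F; rewrite -leNgt mulr1 subr_ge0 ltW // exprn_egt1.
- by apply: F; rewrite -leNgt !mulr1 oppr_le0 sqr_ge0.
- by apply: T; rewrite !mulr1 oppr_lt0 exprn_gt0 // (lt_trans ltr01 r).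
- by apply: T; have := sqr_ge0 a; lra.
- by apply: F; rewrite -leNgt; have := sqr_ge0 a; lra.
- by apply: T; have := exprn_gt0 2 (lt_trans ltr01 r); lra.
- by apply: F; rewrite -leNgt; have := sqr_ge0 a; lra.
- by case: r => a0 a1; apply: F; rewrite -leNgt mulr1 subr_le0 exprn_ile1 // ltW.
- by case: r => a0 a1; apply: T; rewrite mulr1 subr_lt0 exprn_ilt1 // ltW.
- by apply: F; rewrite -leNgt !mulr1 oppr_le0 sqr_ge0.
- by case: r => a0 a1; apply: T; rewrite !mulr1 oppr_lt0 exprn_gt0.
Qed.

(** The factors y^2 and y^4 are nonnegative but might vanish, so each sign is carried over in both
    directions, with the inverse isomorphism for the second. *)
Lemma tag_eqv c c' : in_range c -> in_range c' -> kind c = 2 -> kind c' = 2 ->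
  eqv (canon c) (canon c') -> tag c = tag c'.
Proof.
move=> r r' k k' e.
have [y [E1 E2]] := kappa_delta_eqv k k' e.
have [z [E1' E2']] := kappa_delta_eqv k' k (isomorphic_sym e).
have P (p q x : R) : 0 <= x -> p = q * x -> (0 < p -> 0 < q) * (p < 0 -> q < 0).
  move=> x0 ->; have [xp|xn|x00] := ltgtP x 0; first by rewrite ltNge x0 in xp.
    by rewrite pmulr_lgt0 // pmulr_llt0.
  by rewrite x00 mulr0 ltxx.
have y2 := sqr_ge0 y; have z2 := sqr_ge0 z.
have y4 : 0 <= y ^+ 4 by rewrite (exprM y 2 2) sqr_ge0.
have z4 : 0 <= z ^+ 4 by rewrite (exprM z 2 2) sqr_ge0.
have : signs c = signs c'.
  rewrite /signs; congr [:: _; _; _; _]; apply/idP/idP.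
  - exact: (P _ _ _ y2 E1).1.
  - exact: (P _ _ _ z2 E1').1.
  - exact: (P _ _ _ y2 E1).2.
  - exact: (P _ _ _ z2 E1').2.
  - exact: (P _ _ _ y4 E2).1.
  - exact: (P _ _ _ z4 E2').1.
  - exact: (P _ _ _ y4 E2).2.
  - exact: (P _ _ _ z4 E2').2.
rewrite !signs_tag //.
have : (tag c < 7)%N by case: c {r k e E1 E2 E1' E2'}.
have : (tag c' < 7)%N by case: c' {r' k' e E1 E2 E1' E2'}.
by case: (tag c) => [|[|[|[|[|[|[|]]]]]]] //; case: (tag c') => [|[|[|[|[|[|[|]]]]]]].
Qed.

(** The Jordan form is 2t times a sum of squares, and equals 2t at the chosen pair; its value at the
    image pair is a nonnegative multiple of t'. *)
Lemma rot_sign (t t' : R) : eqv (semi 0 1 1 t) (semi 0 1 1 t') -> exists2 s, 0 <= s & t = t' * s.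
Proof.
case/jordan_eqv => f H.
have := H (vc 1 0 0 0 0 0) (vc 0 0 0 0 1 0).
rewrite (vc_eta (f (vc 1 0 0 0 0 0))) (vc_eta (f (vc 0 0 0 0 1 0))) !jordan_form70.
set s := _ ^+ 2 + _ ^+ 2; set s' := _ ^+ 2 + _ ^+ 2; set y := (f _).1 0 0 => E.
exists (y ^+ 2 * s'); first by rewrite mulr_ge0 ?addr_ge0 ?sqr_ge0.
have s1 : s = 1 by rewrite /s; ring.
move: E; rewrite s1 => E.
have -> : t = 2 * t * 1 ^+ 2 * 1 / 2 by field.
by rewrite E; field.
Qed.

Lemma nil_sign (t t' : R) : eqv (semi 0 1 0 t) (semi 0 1 0 t') -> exists2 s, 0 <= s & t = t' * s.
Proof.
case/square_eqv => f H.
have := H (vc 1 0 0 0 0 0) (vc 0 0 0 0 1 0).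
rewrite (vc_eta (f (vc 1 0 0 0 0 0))) (vc_eta (f (vc 0 0 0 0 1 0))) !square_nil.
set s := _ ^+ 2; set s' := _ ^+ 2 => E.
exists s'; first by rewrite sqr_ge0.
have s1 : s = 1 by rewrite /s; ring.
move: E; rewrite s1 => E.
have -> : t = 2 * t * 1 / 2 by field.
by rewrite E; field.
Qed.

Lemma abelian_eqv t : eqv t (semi 0 0 0 0) -> forall u v w, pairing (lie_br t u v) w = 0.
Proof.
case/eqv_data => f [g [fK gK fF fB]] u v w; rewrite -fF fB.
rewrite (vc_eta (f u)) (vc_eta (f v)) (vc_eta (f w)) lie_br_diag pairing_vc; ring.
Qed.

Lemma not_abelian_nil (t : R) : ~ eqv (semi 0 1 0 t) (semi 0 0 0 0).
Proof.
move/abelian_eqv => H; have := H (vc 1 0 0 0 0 0) (vc 0 0 1 0 0 0) (vc 0 0 0 0 1 0).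
by rewrite lie_br_diag pairing_vc; lra.
Qed.

Lemma not_eqv_11_12 : ~ eqv (semi 1 0 1 0) (semi 1 0 0 0 : mtriple R).
Proof.
case/jordan_eqv => f H; have := H (vc 1 0 0 0 0 0) (vc 0 1 0 0 0 1).
rewrite jordan_form_4_1 (vc_eta (f _)) [X in jordan_form _ _ X]vc_eta jordan_form_5_1; lra.
Qed.

(** Being nonnegative multiples of each other, t and t' have equal signs, so a nonpositive product
    forces both to vanish. *)
Lemma sign_absurd (P : Prop) (t t' : R) : t != t' -> t * t' <= 0 ->
  (exists2 s, 0 <= s & t = t' * s) -> (exists2 s, 0 <= s & t' = t * s) -> P.
Proof.
move=> n0 le0 [s s0 E] [s' s0' E']; case/eqP: n0.
have h : 0 <= t * t'.
  by rewrite E mulrAC mulr_ge0 // -expr2 sqr_ge0.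
have /eqP : t * t' = 0 by apply/eqP; rewrite eq_le le0.
rewrite mulf_eq0 => /orP[]/eqP z.
  by rewrite E' z mul0r.
by rewrite E z mul0r.
Qed.

Lemma kind2_inj c c' : in_range c -> in_range c' -> kind c = 2 -> kind c' = 2 ->
  eqv (canon c) (canon c') -> c = c'.
Proof.
move=> r r' k k' e.
have tE := tag_eqv r r' k k' e; have e' : eqv (canon c') (canon c) := isomorphic_sym e.
have [y [E1 E2]] := kappa_delta_eqv k k' e.
(* The scale-invariant ratio of [delta] to the square of [kappa], in cross-multiplied form; it
   recovers the parameter a. *)
have E : delta c * kappa c' ^+ 2 = delta c' * kappa c ^+ 2 by rewrite E1 E2; ring.
move: r r' k k' tE e e' E {E1 E2 y}.
have sa (t t' : R) (P : Prop) : t != t' -> t * t' <= 0 -> eqv (semi 0 1 1 t) (semi 0 1 1 t') ->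
    eqv (semi 0 1 1 t') (semi 0 1 1 t) -> P.
  by move=> n0 l0 /rot_sign h /rot_sign h'; apply: sign_absurd n0 l0 h h'.
have na (t t' : R) (P : Prop) : t != t' -> t * t' <= 0 -> eqv (semi 0 1 0 t) (semi 0 1 0 t') ->
    eqv (semi 0 1 0 t') (semi 0 1 0 t) -> P.
  by move=> n0 l0 /nil_sign h /nil_sign h'; apply: sign_absurd n0 l0 h h'.
have n01 : (0 : R) != 1 by rewrite eq_sym oner_neq0.
have n0N : (0 : R) != -1 by rewrite eq_sym oppr_eq0 oner_neq0.
have n1N : (1 : R) != -1 by apply/eqP => H; lra.
case: c => [b|b|a b|a b| | |b|b|a|a| | | |a| | | | | | | |] //;
case: c' => [b'|b'|a' b'|a' b'| | |b'|b'|a'|a'| | | |a'| | | | | | | |] //= r r' _ _ _ e e' E.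
- congr Class9; apply: minus_inverse_inj; [exact: ltW|exact: ltW|].
  have a0 : a != 0 by rewrite gt_eqF // (lt_trans ltr01 r).
  have a0' : a' != 0 by rewrite gt_eqF // (lt_trans ltr01 r').
  move: E; rewrite /kappa /delta /= !mulr1 => E.
  have -> : (a ^+ 2 - 1) ^+ 2 / a ^+ 2 =
    - (- a' ^+ 2 * (a ^+ 2 - 1) ^+ 2) / (a * a') ^+ 2 by field; rewrite a0 a0'.
  by rewrite -E; field; rewrite a0 a0'.
- congr Class10; apply: plus_inverse_inj => //.
  have a0 : a != 0 by rewrite gt_eqF // (lt_trans ltr01 r).
  have a0' : a' != 0 by rewrite gt_eqF // (lt_trans ltr01 r').
  move: E; rewrite /kappa /delta /= => E.
  have -> : (a ^+ 2 + 1) ^+ 2 / a ^+ 2 =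
    (- (a' ^+ 2 * (1 * -1)) * (a ^+ 2 - 1 * -1) ^+ 2) / (a * a') ^+ 2 by field; rewrite a0 a0'.
  by rewrite -E; field; rewrite a0 a0'.
- exfalso; move: E; rewrite /kappa /delta /= => E.
  have : 1 < a ^+ 2 by rewrite exprn_egt1.
  move: E; move: (a ^+ 2) => x E H; have : (x - 1) ^+ 2 = 0 by lra.
  by move/eqP; rewrite sqrf_eq0 subr_eq0 gt_eqF.
- by case: not_eqv_11_12.
- by case: not_eqv_11_12.
- exfalso; move: E; rewrite /kappa /delta /= => E.
  have : 1 < a' ^+ 2 by rewrite exprn_egt1.
  move: E; move: (a' ^+ 2) => x E H; have : (x - 1) ^+ 2 = 0 by lra.
  by move/eqP; rewrite sqrf_eq0 subr_eq0 gt_eqF.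
(* (a - 1/a)^2 does not change under a -> 1/a, so the injectivity for a >= 1 is applied to the
   inverses. *)
- congr Class14; apply: invr_inj; case: r => a0 a1; case: r' => a0' a1'.
  apply: minus_inverse_inj; rewrite ?invf_ge1 ?ltW //.
  have n0 : a != 0 by rewrite gt_eqF.
  have n0' : a' != 0 by rewrite gt_eqF.
  move: E; rewrite /kappa /delta /= !mulr1 => E.
  have -> : (a^-1 ^+ 2 - 1) ^+ 2 / a^-1 ^+ 2 =
    - (- a' ^+ 2 * (a ^+ 2 - 1) ^+ 2) / (a * a') ^+ 2 by field; rewrite n0 n0'.
  by rewrite -E; field; rewrite n0 n0'.
- by apply: (sa 0 1) => //; rewrite mul0r.
- by apply: (sa 0 (-1)) => //; rewrite mul0r.
- by apply: (sa 0 1) => //; rewrite mul0r.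
- by apply: (sa 1 (-1)) => //; rewrite mul1r oppr_le0 ler01.
- by apply: (sa 0 (-1)) => //; rewrite mul0r.
- by apply: (sa 1 (-1)) => //; rewrite mul1r oppr_le0 ler01.
- by apply: (na 0 1) => //; rewrite mul0r.
- by apply: (na 0 (-1)) => //; rewrite mul0r.
- by case: (not_abelian_nil e).
- by apply: (na 0 1) => //; rewrite mul0r.
- by apply: (na 1 (-1)) => //; rewrite mul1r oppr_le0 ler01.
- by case: (not_abelian_nil e).
- by apply: (na 0 (-1)) => //; rewrite mul0r.
- by apply: (na 1 (-1)) => //; rewrite mul1r oppr_le0 ler01.
- by case: (not_abelian_nil e).
- by case: (not_abelian_nil e').
- by case: (not_abelian_nil e').
- by case: (not_abelian_nil e').
Qed.

Lemma canon_inj c c' : in_range c -> in_range c' -> eqv (canon c) (canon c') -> c = c'.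
Proof.
move=> r r' e; have kE := kind_eqv r r' e.
case k : (kind c) => [|[|[|n]]]; rewrite k in kE.
- apply: (kind0_inj r r' k (esym kE)).
    by rewrite -(killing_trace_canon r) -(killing_trace_canon r') (killing_trace_eqv e).
  by rewrite -(killing2_trace_canon r) -(killing2_trace_canon r') (killing2_trace_eqv e).
- exact: kind1_inj.
- exact: kind2_inj.
- by case: c k {r e kE}.
Qed.

End SolvableClasses.

Lemma belongs_iso (R : realType) (D : metric_algebra R) (c : dclass R) :
  drinfeld_double6 D -> in_range c -> belongs_to D c ->
  isomorphic (double_of (canon c)) D.
Proof.
move=> [[lieD formD _] _] r [T Tc allT].
exact: isomorphic_trans (eqv_sym (canon_eqv r Tc)) (allows_iso lieD formD allT).
Qed.

(** The Jacobi identity is transported from the normal form of the class; the metric and the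
    dimension come with the construction of [double_of]. *)
Lemma double6_class (R : realType) (c : dclass R) (T : mtriple R) :
  in_range c -> T \in class_triples c ->
  drinfeld_double6 (double_of T) /\ allows_decomposition (double_of T) T.
Proof.
move=> r Tc; have lieT := lie_iso (eqv_sym (canon_eqv r Tc)) (lie_canon c).
have formT := double_invariant T; have dimT := dim_double T.
have allT := iso_allows lieT formT dimT (isomorphic_refl (double_of T)).
split; last exact: allT.
split; last exact: dimT.
split; [exact: lieT|exact: formT|].
by case: allT => G [Gt [X [Xt [mG _ _ _]]]]; exists G, Gt.
Qed.

Theorem theorem1 (R : realType) :
  [/\ (* every double belongs to exactly one class, for exactly one value of
         the parameters *)
      forall D : metric_algebra R, drinfeld_double6 D ->
        exists! c : dclass R, in_range c /\ belongs_to D c,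
      (* it allows decomposition into all triples of its class and their
         duals *)
      forall (D : metric_algebra R) (c : dclass R),
        drinfeld_double6 D -> in_range c -> belongs_to D c ->
        forall T : mtriple R, T \in class_triples c ->
          allows_decomposition D T /\ allows_decomposition D (dual_mtriple T),
      (* the listed symbols do denote Manin triples *)
      forall (c : dclass R) (T : mtriple R),
        in_range c -> T \in class_triples c ->
        drinfeld_double6 (double_of T) /\ allows_decomposition (double_of T) T,
      (* triples of the same class define isomorphic doubles *)
      forall (c : dclass R) (T T' : mtriple R),
        in_range c -> T \in class_triples c -> T' \in class_triples c ->
        isomorphic (double_of T) (double_of T')
    & (* doubles from different classes, or from the same class with different
         parameters, are not isomorphic *)
      forall (c c' : dclass R) (D D' : metric_algebra R),
        in_range c -> in_range c' -> c <> c' ->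
        drinfeld_double6 D -> drinfeld_double6 D' ->
        belongs_to D c -> belongs_to D' c' -> ~ isomorphic D D'].
Proof.
have distinct (c c' : dclass R) (D D' : metric_algebra R) : in_range c -> in_range c' ->
    drinfeld_double6 D -> drinfeld_double6 D' -> belongs_to D c -> belongs_to D' c' ->
    isomorphic D D' -> c = c'.
  move=> r r' dD dD' bD bD' e; apply: (canon_inj r r').
  apply: isomorphic_trans (belongs_iso dD r bD) _.
  exact: isomorphic_trans e (isomorphic_sym (belongs_iso dD' r' bD')).
split.
- move=> D dD; have [c r bD] := drinfeld_classified dD.
  exists c; split; first by split.
  by move=> c' [r' bD']; apply: (distinct _ _ _ _ r r' dD dD bD bD' (isomorphic_refl D)).
- move=> D c dD r bD T Tc; have e := belongs_iso dD r bD.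
  have [[lieD formD _] dimD] := dD.
  have eT := isomorphic_trans (canon_eqv r Tc) e.
  split; apply: (iso_allows lieD formD dimD); first exact: eT.
  exact: isomorphic_trans (eqv_dual T) eT.
- exact: double6_class.
- move=> c T T' r Tc T'c.
  exact: eqv_trans (canon_eqv r Tc) (eqv_sym (canon_eqv r T'c)).
- by move=> c c' D D' r r' cc' dD dD' bD bD' e; apply: cc'; apply: distinct e.
Qed.
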